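(* Let $T$ be a complete theory expanding the theory of integral domains, with monster model $\mathbb M$, and let $\mathrm{cl}$ be an existential matroid on $\mathbb M$. Then, for every $n$, the theory $T^{nd}$ (of sequences $\mathbb K_1\prec\dots\prec\mathbb K_{n+1}\models T$, each $\mathbb K_i$ a proper $\mathrm{cl}$-closed elementary substructure of $\mathbb K_{i+1}$, with $\mathbb K_1$ dense in $\mathbb K_{n+1}$) is complete, and there is a (unique) existential matroid on (a monster model of) $T^{nd}$.
   Context: Conventions: a monster model of a complete theory $T$ (in a language $\mathcal L$, with only infinite models) is a $\kappa$-saturated, strongly $\kappa$-homogeneous model $\mathbb M$, for a large cardinal $\kappa>|T|$. ''Small'' means of cardinality $<\kappa$; ''definable'' means definable with parameters. A (finitary) matroid on $\mathbb M$ is an operator $\mathrm{cl}:\mathcal P(\mathbb M)\to\mathcal P(\mathbb M)$ with: $X\subseteq \mathrm{cl}(X)$; $X\subseteq Y\Rightarrow \mathrm{cl}(X)\subseteq \mathrm{cl}(Y)$; $\mathrm{cl}(\mathrm{cl}(X))=\mathrm{cl}(X)$; $\mathrm{cl}(X)=\bigcup\{\mathrm{cl}(A): A\subseteq X \text{ finite}\}$; and exchange: $a\in \mathrm{cl}(X\cup\{c\})\setminus \mathrm{cl}(X)$ implies $c\in\mathrm{cl}(X\cup\{a\})$. A formula $\phi(x,\bar y)$ without parameters (in the language of the theory considered), $x$ a single variable, is $x$-narrow if for all $a,\bar b$, $\mathbb M\models\phi(a,\bar b)$ implies $a\in\mathrm{cl}(\bar b)$. The matroid is definable if for every $A$, $\mathrm{cl}(A)$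 is the union of the sets $\phi(\mathbb M,\bar a)$ with $\phi$ $x$-narrow and $\bar a$ a finite tuple from $A$. It satisfies Existence if for every element $a$ and all small $B,C$ with $a\notin\mathrm{cl}(B)$ there is $a'$ with the same type as $a$ over $B$ and $a'\notin\mathrm{cl}(B\cup C)$. The trivial matroid is $\mathrm{cl}^0(X)=\mathbb M$ for all $X$. An existential matroid is a definable matroid that satisfies Existence and is not trivial. Via the $x$-narrow formulas, $\mathrm{cl}$ transfers to any other monster model of $T$. $\mathrm{rk}(\bar b/A)$ is the cardinality of a maximal subtuple of $\bar b$ that is $\mathrm{cl}$-independent over $A$. For $V\subseteq\mathbb M^n$ definable over a small $A$, $\dim(V)=\max\{\mathrm{rk}(\bar b/A):\bar b\in V\}$, $\dim(\emptyset)=-\infty$. Since $T$ expands the theory of integral domains, this dimension is definable in families. Let $\mathbb K\models T$, viewed as an elementary substructure of a monster model; the dimension of a $\mathbb K$-definable set is that of its interpretation in the monster model. $X\subseteq\mathbb K$ is dense in $\mathbb K$ if $U\cap X\neq\emptyset$ for every $\mathbb K$-definable $U\subseteq\mathbb K$ with $\dim(U)=1$; $X$ is $\mathrm{cl}$-closed in $\mathbb K$ if $\mathrm{cl}(X)\cap\mathbb K=X$. For $n\ge1$, $\mathcal L^n$ is the expansion of $\mathcal L$ by $n-1$ new unary predicates $P_1,\dots,P_{n-1}$, and $T^n$ is the $\mathcal L^n$-theory whose models are sequences $\mathbb K_1\prec\dots\prec\mathbb K_{n-1}\prec\mathbb K_n\models T$ where each $\mathbb K_i$ (the interpretation of $P_i$,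 for $i<n$) is a proper $\mathrm{cl}$-closed elementary substructure of $\mathbb K_{i+1}$. $T^{nd}$ is the theory extending $T^{n+1}$ by the statement that $\mathbb K_1$ is dense in $\mathbb K_{n+1}$; $T^{0d}:=T$. *)

(* Defs.v *)
From mathcomp Require Import all_boot.
From mathcomp Require Import boolp classical_sets functions cardinality.

Set Implicit Arguments.
Unset Strict Implicit.
Unset Printing Implicit Defensive.

Local Open Scope classical_set_scope.

(** * First-order logic *)

Record language := Language {
  Fun : nat -> Type;
  Rel : nat -> Type }.

Inductive term (L : language) (n : nat) : Type :=
| Var : 'I_n -> term L n
| App : forall k, Fun L k -> ('I_k -> term L n) -> term L n.

(* [formula L n]: formulas whose free variables are among x_0, ..., x_(n-1).
   [All] binds x_0 and shifts the other variables by one. *)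
Inductive formula (L : language) : nat -> Type :=
| Fls : forall n, formula L n
| Eq : forall n, term L n -> term L n -> formula L n
| Atom : forall n k, Rel L k -> ('I_k -> term L n) -> formula L n
| Imp : forall n, formula L n -> formula L n -> formula L n
| All : forall n, formula L n.+1 -> formula L n.

Arguments Fls {L n}.

Definition Neg (L : language) n (phi : formula L n) : formula L n :=
  Imp phi Fls.

Definition sentence (L : language) := formula L 0.
Definition theory (L : language) := set (sentence L).

Record structure (L : language) := Structure {
  carrier :> Type;
  nonempty : inhabited carrier;
  fint : forall k, Fun L k -> ('I_k -> carrier) -> carrier;
  rint : forall k, Rel L k -> ('I_k -> carrier) -> Prop }.

Definition scons (M : Type) (a : M) n (b : 'I_n -> M) : 'I_n.+1 -> M :=
  fun i => oapp b a (unlift ord0 i).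

Fixpoint eval (L : language) (M : structure L) n (v : 'I_n -> M)
    (t : term L n) : M :=
  match t with
  | Var i => v i
  | App _ f ts => fint f (fun i => eval v (ts i))
  end.

Fixpoint sat (L : language) (M : structure L) n (phi : formula L n) :
    ('I_n -> M) -> Prop :=
  match phi in formula _ n return ('I_n -> M) -> Prop with
  | Fls _ => fun _ => False
  | Eq _ t u => fun v => eval v t = eval v u
  | Atom _ _ r ts => fun v => rint r (fun i => eval v (ts i))
  | Imp _ phi psi => fun v => sat phi v -> sat psi v
  | All _ phi => fun v => forall a : M, sat phi (scons a v)
  end.

Definition holds (L : language) (M : structure L) (s : sentence L) : Prop :=
  forall v : 'I_0 -> M, sat s v.

Definition model (L : language) (T : theory L) (M : structure L) : Prop :=
  forall s, T s -> holds M s.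

Definition entails (L : language) (T : theory L) (s : sentence L) : Prop :=
  forall M : structure L, model T M -> holds M s.

Definition complete (L : language) (T : theory L) : Prop :=
  (exists M : structure L, model T M) /\
  (forall s, entails T s \/ entails T (Neg s)).

Definition only_infinite_models (L : language) (T : theory L) : Prop :=
  forall M : structure L, model T M -> infinite_set [set: M].

Definition theory_of (L : language) (C : structure L -> Prop) : theory L :=
  [set s | forall M, C M -> holds M s].

(** ** Elementary maps and substructures *)

Definition elementary_embedding (L : language) (M N : structure L)
    (h : M -> N) : Prop :=
  forall n (phi : formula L n) (v : 'I_n -> M), sat phi v <-> sat phi (h \o v).

Definition automorphism (L : language) (M : structure L) (s : M -> M) : Prop :=
  [/\ bijective s,
      forall k (f : Fun L k) (v : 'I_k -> M), s (fint f v) = fint f (s \o v) &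
      forall k (r : Rel L k) (v : 'I_k -> M), rint r v <-> rint r (s \o v)].

Record universe_of_substructure (L : language) (M : structure L)
    (A : set M) : Prop := UnivSubstructure {
  us_nonempty : inhabited {x | A x};
  us_closed : forall k (f : Fun L k) (v : 'I_k -> M),
    (forall i, A (v i)) -> A (fint f v) }.

Definition induced (L : language) (M : structure L) (A : set M)
    (HA : universe_of_substructure A) : structure L :=
  @Structure L {x | A x} (us_nonempty HA)
    (fun k f v => exist A (fint f (fun i => sval (v i)))
                          (us_closed HA f (fun i => svalP (v i))))
    (fun k r v => rint r (fun i => sval (v i))).

(* A and B are universes of substructures of M, and the one with universe A
   is an elementary substructure of the one with universe B. *)
Definition elementary_sub (L : language) (M : structure L) (A B : set M) :
    Prop :=
  exists (HA : universe_of_substructure A) (HB : universe_of_substructure B)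
         (AB : A `<=` B),
    @elementary_embedding L (induced HA) (induced HB)
      (fun x => exist B (sval x) (AB _ (svalP x))).

(** ** Monster models *)

Definition card_lt (X Y : Type) (A : set X) (B : set Y) : Prop :=
  (A #<= B)%card /\ ~ (B #<= A)%card.

(* Cardinals are represented by types. *)
Definition small (kappa : Type) (X : Type) (A : set X) : Prop :=
  card_lt A [set: kappa].

(* A formula phi(x, b) in one variable with parameters b from M. *)
Record pformula (L : language) (M : structure L) := PFormula {
  pf_arity : nat;
  pf_formula : formula L pf_arity.+1;
  pf_params : 'I_pf_arity -> M }.

Definition psat (L : language) (M : structure L) (a : M) (p : pformula M) :
    Prop :=
  sat (pf_formula p) (scons a (@pf_params _ _ p)).

Definition over (L : language) (M : structure L) (A : set M)
    (p : pformula M) : Prop :=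
  range (@pf_params _ _ p) `<=` A.

Definition same_type (L : language) (M : structure L) (B : set M) (a a' : M) :
    Prop :=
  forall p : pformula M, over B p -> (psat a p <-> psat a' p).

Definition saturated (kappa : Type) (L : language) (M : structure L) : Prop :=
  forall (A : set M) (S : set (pformula M)),
    small kappa A -> S `<=` over A ->
    (forall S0, finite_set S0 -> S0 `<=` S ->
       exists a, forall p, S0 p -> psat a p) ->
    exists a, forall p, S p -> psat a p.

Definition partial_elementary (L : language) (M : structure L) (A : set M)
    (f : M -> M) : Prop :=
  forall n (phi : formula L n) (v : 'I_n -> M),
    (forall i, A (v i)) -> (sat phi v <-> sat phi (f \o v)).

Definition strongly_homogeneous (kappa : Type) (L : language)
    (M : structure L) : Prop :=
  forall (A : set M) (f : M -> M),
    small kappa A -> partial_elementary A f ->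
    exists2 s, automorphism s & forall a, A a -> s a = f a.

(* |T| is, as usual, the number of L-formulas. *)
Definition monster (kappa : Type) (L : language) (T : theory L)
    (M : structure L) : Prop :=
  [/\ small kappa [set: {n & formula L n}],
      model T M, saturated kappa M & strongly_homogeneous kappa M].

(** * Existential matroids *)

Definition matroid (M : Type) (cl : set M -> set M) : Prop :=
  [/\ forall X, X `<=` cl X,
      forall X Y, X `<=` Y -> cl X `<=` cl Y,
      forall X, cl (cl X) = cl X,
      forall X, cl X = \bigcup_(A in [set A | finite_set A /\ A `<=` X]) cl A &
      forall X a c, (cl (X `|` [set c]) `\` cl X) a -> cl (X `|` [set a]) c].

(* The distinguished variable x is x_0; the tuple y is the rest. *)
Definition narrow (L : language) (M : structure L) (cl : set M -> set M)
    m (phi : formula L m.+1) : Prop :=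
  forall (a : M) (b : 'I_m -> M), sat phi (scons a b) -> cl (range b) a.

(* The operator which the narrow formulas of (M, cl) define on a structure N. *)
Definition transfer (L : language) (M : structure L) (cl : set M -> set M)
    (N : structure L) (X : set N) : set N :=
  [set a | exists m (phi : formula L m.+1) (b : 'I_m -> N),
     [/\ narrow cl phi, range b `<=` X & sat phi (scons a b)]].

Arguments transfer {L M} cl N X.

Definition definable_matroid (L : language) (M : structure L)
    (cl : set M -> set M) : Prop :=
  forall A, cl A = transfer cl M A.

Definition Existence (kappa : Type) (L : language) (M : structure L)
    (cl : set M -> set M) : Prop :=
  forall (a : M) (B C : set M), small kappa B -> small kappa C -> ~ cl B a ->
    exists2 a', same_type B a a' & ~ cl (B `|` C) a'.

Definition trivial_matroid (M : Type) : set M -> set M := fun=> setT.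

Definition existential_matroid (kappa : Type) (L : language)
    (M : structure L) (cl : set M -> set M) : Prop :=
  [/\ matroid cl, definable_matroid cl, Existence kappa cl &
      cl <> @trivial_matroid M].

(** ** Rank and dimension *)

Definition independent_over (M : Type) (cl : set M -> set M) (A : set M)
    n (b : 'I_n -> M) (S : {set 'I_n}) : Prop :=
  forall i, i \in S -> ~ cl (A `|` [set b j | j in [set j | j \in S :\ i]]) (b i).

Definition rk (M : Type) (cl : set M -> set M) (A : set M)
    n (b : 'I_n -> M) : nat :=
  \max_(S : {set 'I_n} | `[< independent_over cl A b S >]) #|S|.

(* The dimension of V, a set definable over A; [None] stands for -oo. *)
Definition dim (M : Type) (cl : set M -> set M) (A : set M)
    n (V : set ('I_n -> M)) : option nat :=
  if `[< V = set0 >] then None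
  else Some (\max_(k < n.+1 | `[< exists2 b, V b & rk cl A b = k >]) k).

(** * Expansions of integral domains *)

Record ring_symbols (L : language) := RingSymbols {
  zero_sym : Fun L 0;
  one_sym : Fun L 0;
  opp_sym : Fun L 1;
  add_sym : Fun L 2;
  mul_sym : Fun L 2 }.

Definition is_integral_domain (L : language) (R : ring_symbols L)
    (M : structure L) : Prop :=
  let zero : M := fint (zero_sym R) (tnth [tuple]) in
  let one : M := fint (one_sym R) (tnth [tuple]) in
  let opp (x : M) : M := fint (opp_sym R) (tnth [tuple x]) in
  let add (x y : M) : M := fint (add_sym R) (tnth [tuple x; y]) in
  let mul (x y : M) : M := fint (mul_sym R) (tnth [tuple x; y]) in
  [/\ [/\ associative add, commutative add, left_id zero add &
          left_inverse zero opp add],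
      [/\ associative mul, commutative mul, left_id one mul &
          left_distributive mul add],
      one <> zero &
      forall x y, mul x y = zero -> x = zero \/ y = zero].

Definition expands_integral_domains (L : language) (R : ring_symbols L)
    (T : theory L) : Prop :=
  forall M : structure L, model T M -> is_integral_domain R M.

(** * Dense sequences *)

Inductive exp_rel (L : language) (n : nat) : nat -> Type :=
| OldRel : forall k, Rel L k -> exp_rel L n k
| NewPred : 'I_n -> exp_rel L n 1.

Arguments OldRel {L n k}.
Arguments NewPred {L n}.

(* L expanded by n new unary predicates. *)
Definition expansion (L : language) (n : nat) : language :=
  Language (Fun L) (exp_rel L n).

Definition reduct (L : language) n (S : structure (expansion L n)) :
    structure L :=
  @Structure L S (nonempty S) (@fint _ S)
    (fun k r v => @rint _ S k (OldRel r) v).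

(* Numbering from 0: [chain S i], for i <= n, is the (i+1)-st member of the
   sequence; the last one, [chain S n], is the whole structure. *)
Definition chain (L : language) n (S : structure (expansion L n)) (i : nat) :
    set (reduct S) :=
  if insub i is Some j then
    [set x | @rint (expansion L n) S 1 (NewPred j) (fun=> x)]
  else setT.

Arguments chain {L n} S i.

Section Chains.
Variables (L : language) (T : theory L) (M : structure L).
Variable cl : set M -> set M.

Section InMonster.
(* K is seen as an elementary substructure of a monster model N via h. *)
Variables (K N : structure L) (h : K -> N).

(* For A `<=` B `<=` K: A is cl-closed in B. *)
Definition closed_in (A B : set K) : Prop :=
  transfer cl N (h @` A) `&` (h @` B) = h @` A.

Definition dense_in (X : set K) : Prop :=
  forall m (phi : formula L m.+1) (b : 'I_m -> K),
    dim (transfer cl N) (range (h \o b))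
        [set c : 'I_1 -> N | sat phi (scons (c ord0) (h \o b))] = Some 1 ->
    [set a | sat phi (scons a b)] `&` X !=set0.

End InMonster.

(* The sequences K_1 < ... < K_n < K_(n+1) |= T with K_1 dense in K_(n+1). *)
Definition dense_chain n (S : structure (expansion L n)) : Prop :=
  model T (reduct S) /\
  exists (kappa : Type) (N : structure L) (h : reduct S -> N),
    [/\ monster kappa T N,
        elementary_embedding h,
        forall i, i < n ->
          [/\ elementary_sub (chain S i) (chain S i.+1),
              chain S i <> chain S i.+1 &
              closed_in h (chain S i) (chain S i.+1)] &
        dense_in h (chain S 0)].

Definition nd_language (n : nat) : language :=
  if n is 0 then L else expansion L n.

Definition nd_theory (n : nat) : theory (nd_language n) :=
  match n return theory (nd_language n) with
  | 0 => T
  | k.+1 => theory_of (@dense_chain k.+1)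
  end.

End Chains.

Arguments nd_theory {L} T {M} cl n.

(* Main.v *)
(* In an integral domain with an existential matroid, a definable set X has
   dimension 1 iff every z satisfies z x1 + x4 = z x2 + x3 for some x_i in X with
   x1 <> x2: otherwise (x, y) |-> z x - y would embed X^2 into a line. So
   dimension 1 is a first-order condition which does not mention the matroid.
   This gives uniqueness, transfers the matroid to all models of T, and makes the
   conditions defining dense sequences (nested, proper, closed, dense)
   first-order.

   Two models of these conditions are equivalent by a back-and-forth between
   families which have the same L-type, meet the predicates in the same way and
   are independent from each K_i over their trace on K_i. The extensions are found
   in ultrapowers. Density provides the elements of K_1. For the elements of
   K_(i+1) outside cl(A, K_i) one needs that K_(i+1) is not covered by finitely
   many c together with K_i; here one compares the many elements
   e_0 + e_1 b + .. + e_m b^m, with the e_l in K_i and b in K_(i+1) outside K_i,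
   with the bounded number of parameters of a narrow formula.

   The existential matroid on T^nd is X |-> cl(X, K_n), and Existence follows from
   the same back-and-forth. A dense sequence is found inside M as the values of
   Skolem terms, chosen to be as independent as possible. *)
Require Import Defs.
From mathcomp Require Import all_boot.
From mathcomp Require Import boolp classical_sets functions cardinality filter.
From mathcomp Require wochoice.
From Stdlib Require Import Ring Sumbool.

Set Implicit Arguments.
Unset Strict Implicit.
Unset Printing Implicit Defensive.

Local Open Scope classical_set_scope.

(** * First-order definability *)

(** Dense sequences are defined through an ambient monster model, so an arbitrary model of
    [nd_theory] is not one by definition. The arguments therefore run on [dense_model], a list of
    first-order properties in which the matroid enters only through [transfer] and dimension only
    through [crit]. Completeness is proved without a saturated model of the expanded theory. The
    back-and-forth is one-sided: a family in one structure gains an element of that structure, while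
    the other structure is replaced by an elementary extension. Induction on formulas asks for no
    more. The obstacle is that an L-type does not control the predicates. For a point depending on
    the family, independence from each level over its trace decides the levels. A point outside the
    closure of the family and a level has to be matched by one outside the closure of the new level,
    which grows with the extension; hence the formulas [away], which quantify over the level instead
    of naming its elements. In the construction inside M, the bound |T| < kappa serves to make the
    set of all values small, so that Existence can be used against all earlier values at once. *)

Definition from_I0 (A : Type) (i : 'I_0) : A :=
  False_rect A (notF (ltn_ord i)).

Section Definability.
Variable L : language.

Lemma scons0 (M : Type) (a : M) n (b : 'I_n -> M) : scons a b ord0 = a.
Proof. by rewrite /scons unlift_none. Qed.

Lemma sconsS (M : Type) (a : M) n (b : 'I_n -> M) i :
  scons a b (lift ord0 i) = b i.
Proof. by rewrite /scons liftK. Qed.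

Lemma comp_scons (M N : Type) (h : M -> N) a n (b : 'I_n -> M) :
  h \o scons a b = scons (h a) (h \o b).
Proof.
by apply/funext => i /=; rewrite /scons; case: (unlift ord0 i).
Qed.

Fixpoint rename_term n m (r : 'I_n -> 'I_m) (t : term L n) : term L m :=
  match t with
  | Var i => Var L (r i)
  | App _ f ts => App f (fun i => rename_term r (ts i))
  end.

Lemma eval_rename (M : structure L) n m (r : 'I_n -> 'I_m) (t : term L n)
    (v : 'I_m -> M) :
  eval v (rename_term r t) = eval (v \o r) t.
Proof.
elim: t => [i //|k f ts IH] /=; congr fint; apply/funext => i; exact: IH.
Qed.

Definition lift_map n m (r : 'I_n -> 'I_m) : 'I_n.+1 -> 'I_m.+1 :=
  scons ord0 (lift ord0 \o r).

Fixpoint rename n (phi : formula L n) : forall m, ('I_n -> 'I_m) -> formula L m :=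
  match phi in formula _ n return forall m, ('I_n -> 'I_m) -> formula L m with
  | Fls _ => fun m _ => Fls
  | Eq _ t u => fun m r => Eq (rename_term r t) (rename_term r u)
  | Atom _ _ R ts => fun m r => Atom R (fun i => rename_term r (ts i))
  | Imp _ p q => fun m r => Imp (rename p r) (rename q r)
  | All _ p => fun m r => All (rename p (lift_map r))
  end.

Lemma sat_rename (M : structure L) n (phi : formula L n) m (r : 'I_n -> 'I_m)
    (v : 'I_m -> M) :
  sat (rename phi r) v <-> sat phi (v \o r).
Proof.
elim: phi m r v => {n} [n|n t u|n k R ts|n p IHp q IHq|n p IH] m r v //=.
- by rewrite !eval_rename.
- suff -> : (fun i => eval v (rename_term r (ts i)))
          = (fun i => eval (v \o r) (ts i)) by [].
  by apply/funext => i; rewrite eval_rename.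
- by rewrite IHp IHq.
- have E a : scons a v \o lift_map r = scons a (v \o r).
    apply/funext => i /=; rewrite /lift_map /= /scons.
    by case: (unlift ord0 i) => [j|] /=; rewrite ?liftK ?unlift_none.
  by split=> H a; have := H a; rewrite IH E.
Qed.

(* Contexts of variables are arbitrary types: a context I is a set of names for
   variables, and taking I to be a structure S itself, with the environment id,
   gives the sets definable with parameters from S. *)
Definition ctxrel (I : Type) := forall M : structure L, (I -> M) -> Prop.

(** A single formula has to serve in every structure. This uniformity is what lets a statement
    proved in the monster model pass to all models of [T], and from a structure to its elementary
    extensions. *)
Definition definable (I : Type) (P : ctxrel I) : Prop :=
  exists n (phi : formula L n) (e : 'I_n -> I),
    forall (M : structure L) (v : I -> M), P M v <-> sat phi (v \o e).

Definition uterm (I : Type) (t : forall M : structure L, (I -> M) -> M) : Prop :=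
  exists n (s : term L n) (e : 'I_n -> I),
    forall (M : structure L) (v : I -> M), t M v = eval (v \o e) s.

(** The variables are put side by side in a disjoint union: two variables with the same name in [I]
    stay distinct, and only [E] sends them to the same place. *)
Lemma merge_contexts (J : finType) (n : J -> nat) I (e : forall j, 'I_(n j) -> I) :
  exists N (E : 'I_N -> I) (r : forall j, 'I_(n j) -> 'I_N),
    forall j, E \o r j = e j.
Proof.
pose K : finType := {j : J & 'I_(n j)}.
exists #|K|, (fun x => e (tag (enum_val x)) (tagged (enum_val x))).
exists (fun j i => enum_rank (Tagged (fun j => 'I_(n j)) i)) => j.
by apply/funext => i /=; rewrite enum_rankK.
Qed.

Lemma uterm_var I (i : I) : uterm (fun M v => v i).
Proof. by exists 1, (Var L ord0), (fun=> i). Qed.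

Lemma uterm_eval I n (s : term L n) (e : 'I_n -> I) :
  uterm (fun M v => eval (v \o e) s).
Proof. by exists n, s, e. Qed.

Lemma uterm_app I k (f : Defs.Fun L k) (t : 'I_k -> forall M : structure L, (I -> M) -> M) :
  (forall i, uterm (t i)) -> uterm (fun M v => fint f (fun i => t i M v)).
Proof.
move=> H.
pose n i := projT1 (cid (H i)); have Hn i := projT2 (cid (H i)).
pose s i := projT1 (cid (Hn i)); have Hs i := projT2 (cid (Hn i)).
pose e i := projT1 (cid (Hs i)); have He i := projT2 (cid (Hs i)).
have [N [E [r Er]]] := merge_contexts e.
exists N, (App f (fun i => rename_term (r i) (s i))), E => M v /=.
by congr fint; apply/funext => i; rewrite eval_rename -compA Er -He.
Qed.

Lemma definable_eq I (s t : forall M : structure L, (I -> M) -> M) :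
  uterm s -> uterm t -> definable (fun M v => s M v = t M v).
Proof.
move=> [n [s' [e He]]] [m [t' [f Hf]]].
have [N [E [r Er]]] := @merge_contexts bool (fun b => if b then n else m) I
  (fun b => if b return 'I_(if b then n else m) -> I then e else f).
exists N, (Eq (rename_term (r true) s') (rename_term (r false) t')), E => M v /=.
by rewrite !eval_rename He Hf -compA (Er true) -compA (Er false).
Qed.

Lemma definable_sat I n (phi : formula L n) (e : 'I_n -> I) :
  definable (fun M v => sat phi (v \o e)).
Proof. by exists n, phi, e. Qed.

Lemma definable_ext I (P Q : ctxrel I) :
  (forall M v, P M v <-> Q M v) -> definable P -> definable Q.
Proof.
move=> PQ [n [phi [e H]]]; exists n, phi, e => M v.
by rewrite -H; split=> /PQ.
Qed.

Lemma definable_fls I : definable (fun M (v : I -> M) => False).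
Proof. by exists 0, Fls, (@from_I0 I). Qed.

Lemma definable_cst I (A : Prop) : definable (fun M (v : I -> M) => A).
Proof.
have [HA|HA] := pselect A; last first.
  by apply: definable_ext (definable_fls I) => M v; split.
by exists 0, (Imp Fls Fls), (@from_I0 I) => M v; split=> //= _ [].
Qed.

Lemma definable_imp I (P Q : ctxrel I) :
  definable P -> definable Q -> definable (fun M v => P M v -> Q M v).
Proof.
move=> [n [s' [e He]]] [m [t' [f Hf]]].
have [N [E [r Er]]] := @merge_contexts bool (fun b => if b then n else m) I
  (fun b => if b return 'I_(if b then n else m) -> I then e else f).
exists N, (Imp (rename s' (r true)) (rename t' (r false))), E => M v /=.
rewrite !sat_rename He Hf -compA (Er true) -compA (Er false).
by [].
Qed.

Lemma definable_not I (P : ctxrel I) :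
  definable P -> definable (fun M v => ~ P M v).
Proof. by move=> HP; apply: (definable_imp HP (definable_fls I)). Qed.

Lemma definable_and I (P Q : ctxrel I) :
  definable P -> definable Q -> definable (fun M v => P M v /\ Q M v).
Proof.
move=> HP HQ.
apply: (@definable_ext _ (fun M v => ~ (P M v -> ~ Q M v))).
  by move=> M v; rewrite -[_ -> ~ _]/(_) not_implyE notK.
by apply/definable_not/definable_imp => //; apply: definable_not.
Qed.

Lemma definable_or I (P Q : ctxrel I) :
  definable P -> definable Q -> definable (fun M v => P M v \/ Q M v).
Proof.
move=> HP HQ.
apply: (@definable_ext _ (fun M v => ~ P M v -> Q M v)).
  move=> M v; split; first by move=> H; case: (pselect (P M v)); tauto.
  by case.
by apply/definable_imp => //; apply: definable_not.
Qed.

Lemma definable_sub I J (P : ctxrel I) (f : I -> J) :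
  definable P -> definable (fun M (v : J -> M) => P M (v \o f)).
Proof. by move=> [n [phi [e H]]]; exists n, phi, (f \o e) => M v; rewrite H. Qed.

Lemma definable_env I J (P : ctxrel I) (f : I -> J)
    (g : forall M : structure L, (J -> M) -> I -> M) :
  definable P -> (forall M v i, g M v i = v (f i)) ->
  definable (fun M v => P M (g M v)).
Proof.
move=> HP Hg; apply: definable_ext (definable_sub f HP) => M v.
by rewrite (_ : g M v = v \o f) //; apply/funext => i; rewrite Hg.
Qed.

Definition ocons (M I : Type) (a : M) (v : I -> M) : option I -> M := oapp v a.

Lemma definable_formula m (P : ctxrel (option 'I_m)) :
  definable P ->
  exists phi : formula L m.+1, forall (M : structure L) a (b : 'I_m -> M),
    sat phi (scons a b) <-> P M (ocons a b).
Proof.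
move=> [n [phi [e H]]].
exists (rename phi (fun i => oapp (lift ord0) ord0 (e i))) => M a b.
rewrite sat_rename H.
suff -> : scons a b \o (fun i => oapp (lift ord0) ord0 (e i)) = ocons a b \o e by [].
by apply/funext => i /=; case: (e i) => [j|] /=; rewrite ?sconsS ?scons0.
Qed.

Lemma definable_finite I (P : ctxrel (option I)) :
  definable P ->
  exists m (Q : ctxrel (option 'I_m)) (e : 'I_m -> I),
    definable Q /\
    forall (M : structure L) a (v : I -> M), P M (ocons a v) <-> Q M (ocons a (v \o e)).
Proof.
move=> [n [phi [e H]]].
(* Every variable keeps a slot of its own; [i0] fills the slots of those that [e] sends to the
   distinguished variable, and such a filler exists only if [I] is inhabited. *)
have [[i0 _]|noI] := pselect (exists i : I, True).
  exists n, (fun M w => sat phi (w \o (fun i => if e i is Some _ then Some i else None))).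
  exists (fun i => odflt i0 (e i)); split.
    exact: definable_sat.
  move=> M a v; rewrite H.
  set w1 := (X in sat _ X <-> _); set w2 := (X in _ <-> sat _ X).
  suff -> : w1 = w2 by [].
  by apply/funext => i; rewrite /w1 /w2 /=; case E: (e i) => [j|] //=; rewrite E.
exists 0, (fun M w => sat phi (w \o (fun i => None))).
exists (@from_I0 I); split.
  exact: definable_sat.
move=> M a v; rewrite H.
set w1 := (X in sat _ X <-> _); set w2 := (X in _ <-> sat _ X).
suff -> : w1 = w2 by [].
apply/funext => i; rewrite /w1 /w2 /=; case: (e i) => // j.
by case: noI; exists j.
Qed.

Lemma definable_all I (Q : forall M : structure L, (I -> M) -> M -> Prop) :
  definable (fun M (w : option I -> M) => Q M (w \o some) (w None)) ->
  definable (fun M v => forall a, Q M v a).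
Proof.
move=> /definable_finite [m [P [e [/definable_formula [phi Hphi] HP]]]].
exists m, (All phi), e => M v /=.
have E a : Q M v a <-> sat phi (scons a (v \o e)).
  by rewrite Hphi; exact: (HP M a v).
by split=> H a; apply/E.
Qed.

Lemma definable_ex I (Q : forall M : structure L, (I -> M) -> M -> Prop) :
  definable (fun M (w : option I -> M) => Q M (w \o some) (w None)) ->
  definable (fun M v => exists a, Q M v a).
Proof.
move=> H; apply: (@definable_ext _ (fun M v => ~ forall a, ~ Q M v a)).
  move=> M v; split; first by move=> /existsNP[a /contrapT Ha]; exists a.
  by move=> [a Ha] /(_ a).
by apply/definable_not/definable_all/definable_not.
Qed.

Lemma definable_big_and I k (P : 'I_k -> ctxrel I) :
  (forall i, definable (P i)) -> definable (fun M v => forall i, P i M v).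
Proof.
elim: k P => [|k IH] P HP.
  apply: (@definable_ext _ (fun M v => True)); last exact: definable_cst.
  by move=> M v; split=> // _ i; exact: (from_I0 _ i).
apply: (@definable_ext _ (fun M v => P ord0 M v /\ forall i, P (lift ord0 i) M v)).
  move=> M v; split=> [[H0 H] i|H]; last by split.
  by case: (unliftP ord0 i) => [j|] ->.
by apply: definable_and => //; apply: IH.
Qed.

Lemma definable_big_or I k (P : 'I_k -> ctxrel I) :
  (forall i, definable (P i)) -> definable (fun M v => exists i, P i M v).
Proof.
move=> HP; apply: (@definable_ext _ (fun M v => ~ forall i, ~ P i M v)).
  move=> M v; split; first by move=> /existsNP[a /contrapT Ha]; exists a.
  by move=> [a Ha] /(_ a).
by apply/definable_not/definable_big_and => i; apply/definable_not.
Qed.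

Definition scat (M I J : Type) (w : J -> M) (v : I -> M) (x : J + I) : M :=
  match x with inl j => w j | inr i => v i end.

Lemma definable_all_block I k
    (Q : forall M : structure L, (I -> M) -> ('I_k -> M) -> Prop) :
  definable (fun M (w : 'I_k + I -> M) => Q M (w \o inr) (w \o inl)) ->
  definable (fun M v => forall a, Q M v a).
Proof.
elim: k I Q => [|k IH] I Q HQ.
  pose f (x : 'I_0 + I) : I := match x with
      | inl i => from_I0 I i | inr i => i end.
  apply: definable_ext (definable_sub f HQ) => M v /=.
  have E (a a' : 'I_0 -> M) : a = a' by apply/funext => i; exact: (from_I0 _ i).
  have -> : (v \o f) \o inr = v by [].
  by split=> [H a|//]; rewrite (E a ((v \o f) \o inl)).
apply: (@definable_ext _ (fun M v => forall a b, Q M v (scons a b))).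
  move=> M v; split=> H a; last by [].
  have -> : a = scons (a ord0) (a \o lift ord0).
    by apply/funext => i; case: (unliftP ord0 i) => [j|] ->;
      rewrite ?scons0 ?sconsS.
  exact: H.
apply: definable_all.
apply: (IH (option I) (fun M w b => Q M (w \o some) (scons (w None) b))).
pose f (x : 'I_k.+1 + I) : 'I_k + option I := match x with
  | inl i => if unlift ord0 i is Some j then inl j else inr None
  | inr i => inr (Some i) end.
apply: definable_ext (definable_sub f HQ) => M w.
have -> : (w \o f) \o inl = scons ((w \o inr) None) (w \o inl).
  by apply/funext => i /=; rewrite /scons; case: (unlift ord0 i).
by [].
Qed.

Lemma definable_ex_block I k
    (Q : forall M : structure L, (I -> M) -> ('I_k -> M) -> Prop) :
  definable (fun M (w : 'I_k + I -> M) => Q M (w \o inr) (w \o inl)) ->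
  definable (fun M v => exists a, Q M v a).
Proof.
move=> H; apply: (@definable_ext _ (fun M v => ~ forall a, ~ Q M v a)).
  move=> M v; split; first by move=> /existsNP[a /contrapT Ha]; exists a.
  by move=> [a Ha] /(_ a).
by apply/definable_not/definable_all_block/definable_not.
Qed.

(** The map [e] naming the variables need not be injective, so the universal closure runs only over
    tuples that agree wherever [e] does. Exactly these tuples come from environments on [I]. *)
Lemma definable_sentence I (P : ctxrel I) :
  definable P -> exists s : sentence L, forall M : structure L,
    holds M s <-> forall v : I -> M, P M v.
Proof.
move=> HP.
have [n [phi [e H]]] := HP.
have [n' [s [e' Hs]]] : definable (fun M (v : void -> M) =>
    forall a : 'I_n -> M, (forall i j, e i = e j -> a i = a j) -> sat phi a).
  apply: definable_all_block; apply: definable_imp.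
    apply: definable_big_and => i; apply: definable_big_and => j.
    apply: definable_imp; first exact: definable_cst.
    by apply: definable_eq; apply: uterm_var.
  exact: (definable_sat phi inl).
have n'0 : n' = 0 by case: n' e' {s Hs} => // n' /(_ ord0) [].
move: s e' Hs; rewrite n'0 => s e' Hs.
exists s => M.
pose v0 (x : void) : M := match x with end.
have E (v : 'I_0 -> M) : v0 \o e' = v by apply/funext => i; exact: (from_I0 _ i).
have [x0] := Defs.nonempty M.
split=> [hs v|Hv v].
  have := hs (v0 \o e'); rewrite -Hs => /(_ (v \o e)) H'.
  by apply/H/H' => // i j; rewrite /= => ->.
rewrite -(E v); apply/Hs => a Ha.
pose w i := if pselect (exists j, e j = i) is left ex then a (projT1 (cid ex)) else x0.
have -> : a = w \o e.
  apply/funext => j /=; rewrite /w; case: pselect => [ex|[]]; last by exists j.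
  by apply: Ha; case: (cid ex) => /= j' ->.
exact/H/Hv.
Qed.

End Definability.

(** * Matroids *)

Definition select (X : Type) (x0 : X) (P : set X) : X :=
  if pselect (exists x, P x) is left e then projT1 (cid e) else x0.

Lemma selectP (X : Type) (x0 : X) (P : set X) : (exists x, P x) -> P (select x0 P).
Proof. by rewrite /select; case: pselect => // e _; case: (cid e). Qed.

(** [List.In] is used because elements of structures live in bare types without decidable
    equality. *)
Definition listed (X : Type) (s : seq X) : set X := [set x | List.In x s].

Lemma finite_listed (X : Type) (A : set X) :
  finite_set A -> exists s : seq X, A = listed s.
Proof.
move=> /(@finite_seqP {classic X}) [s ->]; exists s.
apply/seteqP; split=> x /=; elim: s => //= y s IH; rewrite inE.
  by case/orP => [/eqP ->|/IH]; [left|right].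
by move=> [->|/IH ->]; rewrite ?eqxx ?orbT.
Qed.

Lemma listed_finite (X : Type) (s : seq X) : finite_set (listed s).
Proof.
elim: s => [|x s IH]; first by rewrite (_ : listed [::] = set0) //; apply/seteqP; split.
rewrite (_ : listed (x :: s) = [set x] `|` listed s).
  by rewrite finite_setU; split=> //; exact: finite_set1.
by apply/seteqP; split=> y /= [->|]; [left|right|left|right].
Qed.

Lemma finite_range (J : finType) (X : Type) (b : J -> X) : finite_set (range b).
Proof. exact/finite_image/finite_finset. Qed.

Ltac setincl := let x := fresh in
  move=> x; rewrite /setU /setI /mkset /=; tauto.

Section Matroid.
Variables (X : Type) (cl : set X -> set X).
Hypothesis mat : matroid cl.

Lemma cl_in A : A `<=` cl A. Proof. by case: mat. Qed.

Lemma cl_mono A B : A `<=` B -> cl A `<=` cl B. Proof. by case: mat => _ + _ _ _; apply. Qed.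

Lemma cl_sub A B : A `<=` cl B -> cl A `<=` cl B.
Proof. by case: mat => _ _ idem _ _ /cl_mono; rewrite idem. Qed.

Lemma cl_finite A a : cl A a -> exists2 s, listed s `<=` A & cl (listed s) a.
Proof.
case: mat => _ _ _ fin _; rewrite fin => -[B [finB BA] Ba].
by have [s eB] := finite_listed finB; exists s; rewrite -eB.
Qed.

Lemma cl_exchange A a c : cl (A `|` [set c]) a -> ~ cl A a -> cl (A `|` [set a]) c.
Proof. by case: mat => _ _ _ _ exch Ha Na; apply: exch. Qed.

Lemma cl_split A Y a : cl (A `|` Y) a -> exists2 t, listed t `<=` Y & cl (A `|` listed t) a.
Proof.
move=> /cl_finite [s sAY cla].
suff [t tY st] : exists2 t, listed t `<=` Y & listed s `<=` A `|` listed t.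
  by exists t => //; apply: cl_mono cla.
elim: s sAY {cla} => [|x s IH] sAY; first by exists [::].
have [y sy|t tY st] := IH; first by apply: sAY; right.
case: (sAY x (or_introl erefl)) => [Ax|Yx].
  by exists t => // y [<-|/st //]; left.
exists (x :: t) => [y [<- //|/tY //]|y [<-|/st [?|?]]]; first by right; left.
  by left.
by right; right.
Qed.

(** The elements of a finite part of [Y] are added one at a time; [y] is the one at which [a] enters
    the closure, so exchange can be applied at [y]. *)
Lemma cl_split_finite A Y a :
  cl (A `|` Y) a -> ~ cl A a ->
  exists B y, [/\ B `<=` Y, Y y, cl (A `|` B `|` [set y]) a & ~ cl (A `|` B) a].
Proof.
move=> /cl_split [t]; elim: t A => [|y t IH] A tY cla Na.
  by case: Na; apply: cl_mono cla => y [//|[]].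
have [H|H] := pselect (cl (A `|` [set y]) a).
  exists set0, y; split=> //; first by apply: tY; left.
    by rewrite setU0.
  by rewrite setU0.
have [| |//|B [z [BY Yz H1 H2]]] := IH (A `|` [set y]).
- by move=> z tz; apply: tY; right.
- by apply: cl_mono cla => z [Az|[<-|tz]]; [left; left|left; right|right].
exists (B `|` [set y]), z; split=> //.
- by move=> x [/BY //| ->]; apply: tY; left.
- by apply: cl_mono H1; setincl.
- by move=> H3; apply: H2; apply: cl_mono H3; setincl.
Qed.

End Matroid.

(** * Independent sequences, and independence from a set over the trace on it *)

Section Independence.
Variables (X : Type) (cl : set X -> set X).
Hypothesis mat : matroid cl.

Fixpoint ind (A : set X) (s : seq X) : Prop :=
  if s is x :: s' then ~ cl A x /\ ind (A `|` [set x]) s' else True.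

Lemma ind_sub (A B : set X) s : B `<=` cl A -> ind A s -> ind B s.
Proof.
elim: s A B => //= x s IH A B BA [Nx /IH H]; split.
  by move=> /(cl_sub mat BA).
apply: H => y [/BA|->]; first by apply: (cl_mono mat); left.
by apply: (cl_in mat); right.
Qed.

(** Only the first member of [s] that enters the closure with [y] is dropped. It exchanges with [y],
    so the later members, independent over it, are independent over [y]. *)
Lemma ind_exchange A s y : ind A s ->
  exists s', [/\ listed s' `<=` listed s, size s <= (size s').+1 & ind (A `|` [set y]) s'].
Proof.
elim: s A => [|x s IH] A; first by move=> _; exists [::]; split.
move=> [Nx Hs]; have [Hx|Hx] := pselect (cl (A `|` [set y]) x).
  exists s; split => //; first by move=> z Hz; right.
  apply: ind_sub Hs => z [Az|->]; first by apply: (cl_in mat); left.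
  exact: (cl_exchange mat Hx Nx).
have [s' [s's size_s' Hs']] := IH _ Hs.
exists (x :: s'); split=> //=; first by move=> z [->|/s's]; [left|right].
by split => //; move: Hs'; congr (ind _ s'); rewrite -!setUA (setUC [set x]).
Qed.

Lemma steinitz A s t : ind A s -> listed s `<=` cl (A `|` listed t) -> size s <= size t.
Proof.
elim: t A s => [|y t IH] A s Hs st.
  case: s Hs st => //= x s [Nx _] st; case: Nx.
  apply: (cl_mono mat _ (st x (or_introl erefl))).
  by move=> z [|[]].
have [s' [s's size_s' Hs']] := ind_exchange y Hs.
apply: leq_trans size_s' _; rewrite ltnS; apply: IH Hs' _ => z /s's /st.
by apply: (cl_mono mat) => x [Ax|[<-|tx]]; [left; left|left; right|right].
Qed.

(** Elements of [s] are moved into the base until the rank of [s] over it is exactly one. If [a] is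
    not generated by [B] and [e], it joins [B]; by exchange [e] stays outside the closure. *)
Lemma rank_one_extension A s : ~ (listed s `<=` cl A) ->
  exists B e, [/\ A `<=` B, B `<=` A `|` listed s, listed s e, ~ cl B e &
    listed s `<=` cl (B `|` [set e])].
Proof.
elim: s => [|a s IH] Hs; first by case: Hs.
have [sA|/IH [B [e [AB BA se Ne sB]]]] := pselect (listed s `<=` cl A).
  have Na : ~ cl A a by move=> Aa; apply: Hs => x [<-|/sA].
  exists A, a; split=> //; last first.
    move=> x [<-|/sA]; first by apply: (cl_in mat); right.
    by apply: (cl_mono mat); left.
  - exact: (or_introl erefl).
have BA' : B `<=` A `|` listed (a :: s) by move=> x /BA [|sx]; [left|right; right].
have [Ba|Na] := pselect (cl (B `|` [set e]) a).
  by exists B, e; split=> //; [right|move=> x [<-|/sB]].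
exists (B `|` [set a]), e; split=> //.
- by move=> x /AB; left.
- by move=> x [/BA'//|->]; right; left.
- by right.
- by move=> H; apply: Na; apply: (cl_exchange mat H Ne).
move=> x [<-|/sB].
  by apply: (cl_in mat); left; right.
by apply: (cl_mono mat) => y [By|->]; [left; left|right].
Qed.

(* For P closed, this is the independence of A from P over their intersection;
   unlike the equivalent conclusion of good_indep, it passes to elementary
   extensions. *)
Definition good (A P : set X) : Prop :=
  exists A0, [/\ A0 `<=` A, A `<=` cl (A0 `|` (A `&` P)) &
    forall a, A0 a -> ~ cl ((A0 `\` [set a]) `|` P) a].

(** A point of [P] generated by [A] and [B] but not by [B] alone would, by exchange, put some member
    of [A0] into the closure of the rest of [A0] and [P]. *)
Lemma good_indep A P B : cl P `<=` P -> good A P -> A `&` P `<=` B -> B `<=` P ->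
  P `&` cl (A `|` B) `<=` cl B.
Proof.
move=> clP [A0 [A0A AA0 indA0]] APB BP x [Px Hx].
have {}Hx : cl (B `|` A0) x.
  apply: (cl_sub mat _ Hx) => y [/AA0|By]; last by apply: (cl_in mat); left.
  by apply: (cl_mono mat) => z [A0z|/APB Bz]; [right|left].
apply: contrapT => Nx.
have [C [y [CA0 A0y H1 H2]]] := cl_split_finite mat Hx Nx.
have Cy : ~ C y.
  by move=> Cy; apply: H2; apply: (cl_mono mat _ H1) => z [//|->]; right.
apply: (indA0 y A0y).
apply: (cl_mono mat _ (cl_exchange mat H1 H2)).
move=> z [[/BP Pz|Cz]|->]; [by right| |by right].
by left; split; [exact: CA0|move=> /= e; apply: Cy; rewrite -e].
Qed.

(** [A0] is a basis of [A] over [P], given by Zorn's lemma; finite character carries freeness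
    through unions of chains. *)
Lemma good_of_sub A P : P `<=` A -> good A P.
Proof.
move=> PA.
pose free A0 := forall a, A0 a -> ~ cl ((A0 `\` [set a]) `|` P) a.
have [F FP Ftot|A0 [[A0A indA0] A0max]] := @Zorn_bigcup _ [set A0 | A0 `<=` A /\ free A0].
  split=> [a [G /FP [GA _]]|a [G FG Ga] Ha]; first exact: GA.
  have {}Ha : cl (P `|` (\bigcup_(X0 in F) X0 `\` [set a])) a.
    by apply: (cl_mono mat _ Ha); setincl.
  have [t tF Ht] := cl_split mat Ha.
  have [H FH [tH HG]] : exists2 H, F H & listed t `<=` H `\` [set a] /\ H a.
    elim: t tF {Ht} => [|x t IH] tF; first by exists G.
    have [y ty|H FH [tH Ha']] := IH; first by apply: tF; right.
    have [[K FK Kx] xa] := tF x (or_introl erefl).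
    have [KH|HK] := Ftot _ _ FK FH.
      by exists H => //; split=> // z [<-|/tH//]; split=> //; exact: KH.
    exists K => //; split; last exact: HK.
    by move=> z [<-|/tH [/HK Kz za]]; split.
  apply: (FP _ FH).2 HG _; apply: (cl_mono mat _ Ht).
  by move=> z [Pz|/tH Hz]; [right|left].
exists A0; split=> //.
rewrite (_ : A `&` P = P); last by apply/seteqP; split=> [z []|z Pz] //; split=> //; exact: PA.
move=> x Ax; apply: contrapT => Nx.
apply: (A0max (A0 `|` [set x])).
  split; first by left.
  move=> /(_ x (or_intror erefl)) A0x; apply: Nx; apply: (cl_in mat); by left.
split; first by move=> z [/A0A//|->].
move=> a [A0a|->] Ha.
  apply: Nx; have Na := indA0 a A0a.
  have Ha' : cl ((A0 `\` [set a]) `|` P `|` [set x]) a.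
    by apply: (cl_mono mat _ Ha) => z [[[A0z|->] za]|Pz]; [left; left|right|left; right].
  apply: (cl_mono mat _ (cl_exchange mat Ha' Na)).
  by move=> z [[[A0z _]|Pz]|->]; [left|right|left].
apply: Nx; apply: (cl_mono mat _ Ha).
by move=> z [[[A0z|->] za]|Pz]; [left|case: za|right].
Qed.

Lemma good_add_dependent A P b : good A P -> cl A b \/ P b -> good (A `|` [set b]) P.
Proof.
move=> [A0 [A0A AA0 indA0]] Hb; exists A0; split=> //.
  by move=> z /A0A; left.
have sub : A0 `|` (A `&` P) `<=` A0 `|` ((A `|` [set b]) `&` P).
  by move=> z [A0z|[Az Pz]]; [left|right; split=> //; left].
move=> z [/AA0|->]; first exact: (cl_mono mat sub).
case: Hb => [Hb|Pb]; last by apply: (cl_in mat); right; split=> //; right.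
apply: (cl_sub mat _ Hb) => y /AA0; exact: (cl_mono mat sub).
Qed.

(** Here [b] joins [A0]. A dependence of an older member that uses [b] would, by exchange, place [b]
    in the closure of [A0] and [P]. *)
Lemma good_add_free A P b : good A P -> ~ cl (A `|` P) b -> good (A `|` [set b]) P.
Proof.
move=> [A0 [A0A AA0 indA0]] Nb; exists (A0 `|` [set b]); split.
- by move=> z [/A0A|]; [left|right].
- move=> z [/AA0|->]; last by apply: (cl_in mat); left; right.
  by apply: (cl_mono mat) => y [A0y|[Ay Py]]; [left; left|right; split=> //; left].
have sub : A0 `|` P `<=` A `|` P by move=> z [/A0A|]; [left|right].
move=> a [A0a|->] Ha.
  have Na := indA0 a A0a.
  have Ha' : cl ((A0 `\` [set a]) `|` P `|` [set b]) a.
    by apply: (cl_mono mat _ Ha) => z [[[A0z|->] za]|Pz]; [left; left|right|left; right].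
  apply: Nb; apply: (cl_mono mat sub); apply: (cl_mono mat _ (cl_exchange mat Ha' Na)).
  by move=> z [[[A0z _]|Pz]|->]; [left|right|left].
apply: Nb; apply: (cl_mono mat sub); apply: (cl_mono mat _ Ha).
by move=> z [[[A0z|->] za]|Pz]; [left|case: za|right].
Qed.

End Independence.

(** * Ultrapowers *)

Section Ultrapower.
Variables (L : language) (S : structure L).
Let J : Type := seq (pformula S).
Variable U : set_system J.
Hypothesis UU : UltraFilter U.

Let UP : ProperFilter U := @ultra_proper _ _ UU.

Lemma ultra_imp (A B : set J) : U [set i | A i -> B i] <-> (U A -> U B).
Proof.
split=> [H UA|H]; first by apply: filterS (filterI H UA) => i [/= + Ai]; apply.
have [/H UB|UnA] := in_ultra_setVsetC A UU; first by apply: filterS UB => i Bi _.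
by apply: filterS UnA => i nA /nA.
Qed.

Lemma ultra_false : ~ U (fun=> False).
Proof. exact: filter_not_empty. Qed.

Definition ultra_class (f : J -> S) : (J -> S) -> Prop := fun g => U [set i | f i = g i].

Definition ultra_carrier := {c : (J -> S) -> Prop | exists f, c = ultra_class f}.

Definition ultra_pi (f : J -> S) : ultra_carrier :=
  exist _ (ultra_class f) (ex_intro _ f erefl).

Definition ultra_rep (x : ultra_carrier) : J -> S := projT1 (cid (svalP x)).

Lemma ultra_repK x : ultra_pi (ultra_rep x) = x.
Proof.
rewrite /ultra_rep; case: cid => f /= e; case: x e => c H /= e.
exact/eq_exist.
Qed.

Lemma ultra_piE f g : ultra_pi f = ultra_pi g <-> U [set i | f i = g i].
Proof.
split=> [/(congr1 sval) /= e|H].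
  have : ultra_class g g by apply: filterS filterT => i.
  by rewrite -e.
apply/eq_exist/seteqP; split=> h /= Hh.
  by apply: filterS (filterI H Hh) => i [/= -> ->].
by apply: filterS (filterI H Hh) => i [/= -> ->].
Qed.

Definition ultrapower : structure L :=
  @Structure L ultra_carrier
    (let: inhabits x := Defs.nonempty S in inhabits (ultra_pi (fun=> x)))
    (fun k f v => ultra_pi (fun i => fint f (fun a => ultra_rep (v a) i)))
    (fun k r v => U [set i | rint r (fun a => ultra_rep (v a) i)]).

Lemma ultra_forall k (f g : 'I_k -> J -> S) :
  (forall a, U [set i | f a i = g a i]) -> U [set i | forall a, f a i = g a i].
Proof.
elim: k f g => [|k IH] f g H.
  by apply: filterS filterT => i _ a; exact: (from_I0 _ a).
have := IH _ _ (fun a => H (lift ord0 a)) => H'.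
apply: filterS (filterI (H ord0) H') => i [/= H0 HS] a.
by case: (unliftP ord0 a) => [b|] ->.
Qed.

Lemma ultra_eval n (t : term L n) (v : 'I_n -> ultrapower) :
  eval v t = ultra_pi (fun i => eval (fun a => ultra_rep (v a) i) t).
Proof.
elim: t => [a|k f ts IH] /=; first by rewrite ultra_repK.
apply/ultra_piE.
have H a : U [set i | ultra_rep (eval v (ts a)) i = eval (fun b => ultra_rep (v b) i) (ts a)].
  by apply/ultra_piE; rewrite ultra_repK.
by apply: filterS (ultra_forall H) => i /= Hi; congr fint; apply/funext.
Qed.

Lemma ultra_scons (a : ultrapower) n (v : 'I_n -> ultrapower) i :
  (fun b => ultra_rep (scons a v b) i) = scons (ultra_rep a i) (fun b => ultra_rep (v b) i).
Proof. by apply/funext => b; rewrite /scons; case: unlift. Qed.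

Lemma los n (phi : formula L n) (v : 'I_n -> ultrapower) :
  sat phi v <-> U [set i | sat phi (fun a => ultra_rep (v a) i)].
Proof.
elim: phi v => {n} [n|n t u|n k r ts|n p IHp q IHq|n p IH] v /=.
- by split=> // /ultra_false.
- by rewrite !ultra_eval ultra_piE.
- have H a : U [set i | ultra_rep (eval v (ts a)) i = eval (fun b => ultra_rep (v b) i) (ts a)].
    by apply/ultra_piE; rewrite ultra_repK -ultra_eval.
  split=> H'; apply: filterS (filterI (ultra_forall H) H') => i [/= Hi].
    by congr (rint r _); apply/funext.
  by congr (rint r _); apply/funext => a; rewrite Hi.
- by rewrite ultra_imp IHp IHq.
split=> H.
  have [//|UN] := in_ultra_setVsetC [set i | forall a, sat p (scons a (fun b => ultra_rep (v b) i))] UU.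
  have [x0] := Defs.nonempty S.
  (* [f] collects a counterexample at each index where there is one; its class in the ultrapower
     contradicts [H]. *)
  pose f i := select x0 [set a | ~ sat p (scons a (fun b => ultra_rep (v b) i))].
  have /IH := H (ultra_pi f).
  have Hf : U [set i | ultra_rep (ultra_pi f) i = f i] by apply/ultra_piE; rewrite ultra_repK.
  move=> H'; exfalso; apply: ultra_false; apply: filterS (filterI (filterI UN Hf) H') => i [[/= N e]].
  rewrite ultra_scons e => Hs.
  have : ~ sat p (scons (f i) (fun b => ultra_rep (v b) i)); last exact.
  by apply: (@selectP _ x0 [set a | ~ sat p (scons a (fun b => ultra_rep (v b) i))]); exact/existsNP.
move=> a; apply/IH; apply: filterS H => i /= Hi.
by rewrite ultra_scons; exact: Hi.
Qed.

Definition ultra_diag (x : S) : ultrapower := ultra_pi (fun=> x).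

Lemma ultra_sat n (phi : formula L n) (f : 'I_n -> J -> S) :
  sat phi (fun a => ultra_pi (f a) : ultrapower) <-> U [set i | sat phi (fun a => f a i)].
Proof.
rewrite los.
have H a : U [set i | ultra_rep (ultra_pi (f a)) i = f a i].
  by apply/ultra_piE; rewrite ultra_repK.
split=> H'; apply: filterS (filterI (ultra_forall H) H') => i [/= Hi].
  by congr (sat phi _); apply/funext.
by congr (sat phi _); apply/funext => a; rewrite Hi.
Qed.

Lemma ultra_diag_elementary : elementary_embedding ultra_diag.
Proof.
move=> n phi v; rewrite (ultra_sat phi (fun a _ => v a)).
split=> H; first exact: filterS filterT.
by have [i] := filter_ex H.
Qed.

End Ultrapower.

(** * Cardinals *)

Local Open Scope card_scope.

Lemma injective_card_le (X Y : Type) (A : set X) (B : set Y) (f : X -> Y) :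
  (forall x, A x -> B (f x)) -> (forall x y, A x -> A y -> f x = f y -> x = y) ->
  A #<= B.
Proof.
move=> fAB finj; have [|g] := (@injfunPex _ _ A B).2; last exact: inj_card_le.
by exists f => // x y /set_mem Ax /set_mem Ay; apply: finj.
Qed.

Lemma card_le_injective (X Y : Type) (A : set X) (B : set Y) : A #<= B ->
  A = set0 \/ exists f : X -> Y,
    (forall x, A x -> B (f x)) /\ (forall x y, A x -> A y -> f x = f y -> x = y).
Proof.
move=> /card_leP [f].
have [->|/set0P[a0 Aa0]] := eqVneq A set0; first by left.
right; pose y0 : Y := val (f (SigSub (mem_set Aa0))).
exists (fun x => if pselect (A x) is left Ax then val (f (SigSub (mem_set Ax))) else y0).
split=> [x Ax|x y Ax Ay]; case: pselect => // Ax'.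
  exact: set_valP.
case: pselect => // Ay' /val_inj /(@inj _ _ _ f) H.
by have := H (mem_setT _) (mem_setT _) => -[].
Qed.

Lemma surjective_card_le (X Y : Type) (A : set X) (f : X -> Y) : f @` A #<= A.
Proof.
have [->|/set0P[a0 Aa0]] := eqVneq A set0; first by rewrite image_set0.
pose g y := if pselect (exists2 x, A x & f x = y) is left e then s2val (cid2 e) else a0.
have gP y : (f @` A) y -> A (g y) /\ f (g y) = y.
  by move=> Hy; rewrite /g; case: pselect => // e; case: (cid2 e).
apply: (@injective_card_le _ _ _ _ g) => [y /gP []//|x y /gP [_ {2}<-] /gP [_ {2}<-] -> //].
Qed.

(** A maximal partial bijection between [A] and [B] is total on one of the two sides, since
    otherwise one more pair could be added. *)
Lemma card_le_total (X Y : Type) (A : set X) (B : set Y) : A #<= B \/ B #<= A.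
Proof.
pose P (G : set (X * Y)) := (forall p, G p -> A p.1 /\ B p.2) /\
  (forall p q, G p -> G q -> p.1 = q.1 \/ p.2 = q.2 -> p = q).
have [F FP Ftot|G [[GAB Ginj] Gmax]] := @Zorn_bigcup _ P.
  split=> [p [G /FP [GAB _]]|p q [G FG Gp] [H FH Hq] pq]; first exact: GAB.
  have [GH|HG] := Ftot _ _ FG FH.
    by apply: (FP _ FH).2 => //; apply: GH.
  by apply: (FP _ FG).2 => //; apply: HG.
have [totA|/existsNP[a /not_implyP[Aa Na]]] :=
    pselect (forall a, A a -> exists b, G (a, b)).
  have [->|/set0P[a0 Aa0]] := eqVneq A set0; first by left; exact: card_ge0.
  left; have [b0 _] := totA _ Aa0.
  pose f a := select b0 [set b | G (a, b)].
  have fP a : A a -> G (a, f a).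
    by move=> /totA [b Gb]; exact: (@selectP _ b0 [set b | G (a, b)] (ex_intro _ b Gb)).
  apply: (@injective_card_le _ _ _ _ f) => [a /fP /GAB []//|a a' /fP Ga /fP Ga' e].
  by have [] := Ginj _ _ Ga Ga' (or_intror e).
have [totB|/existsNP[b /not_implyP[Bb Nb]]] :=
    pselect (forall b, B b -> exists a, G (a, b)).
  right.
  pose f b := select a [set a | G (a, b)].
  have fP b : B b -> G (f b, b).
    by move=> /totB [c Gc]; exact: (@selectP _ a [set a | G (a, b)] (ex_intro _ c Gc)).
  apply: (@injective_card_le _ _ _ _ f) => [b /fP /GAB []//|b b' /fP Gb /fP Gb' e].
  by have [] := Ginj _ _ Gb Gb' (or_introl e).
case: (Gmax (G `|` [set (a, b)])).
  split; first by move=> p Gp; left.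
  by move=> /(_ (a, b) (or_intror erefl)) Gab; apply: Na; exists b.
split=> [p [/GAB //|-> //]|[x y] [x' y'] [Gp|[-> ->]] [Gq|[-> ->]] //=].
- by apply: (Ginj (x, y) (x', y')).
- by move=> [e|e]; [case: Na; exists y|case: Nb; exists x]; rewrite -e.
- by move=> [e|e]; [case: Na; exists y'|case: Nb; exists x']; rewrite e.
Qed.

(** A maximal family of disjoint injective sequences in [C] omits only a finite set, because an
    infinite remainder contains another sequence. Every element then has a position, a sequence with
    an index k, and its two copies go to the places 2k and 2k+1. *)
Lemma card_le_double (X : Type) (C : set X) : infinite_set C ->
  exists g : X -> bool -> X, (forall x b, C x -> C (g x b)) /\
    (forall x y b c, C x -> C y -> g x b = g y c -> x = y /\ b = c).
Proof.
move=> Cinf.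
pose P (F : set (nat -> X)) := forall f g, F f -> F g ->
  (forall i, C (f i)) /\ (forall i j, f i = g j -> f = g /\ i = j).
have [F FP Ftot|F [FP Fmax]] := @Zorn_bigcup _ P.
  move=> f g [G FG Gp] [H FH Hq].
  have [GH|HG] := Ftot _ _ FG FH.
    by apply: (FP _ FH) => //; apply: GH.
  by apply: (FP _ FG) => //; apply: HG.
pose D := [set x | C x /\ forall f i, F f -> f i <> x].
have /finite_listed [s Ds] : finite_set D.
  apply: contrapT => /infiniteP /card_le_injective [H|[h [hD hinj]]].
    by have : [set: nat] 0 by []; rewrite H.
  case: (Fmax (F `|` [set h])).
    split; first by left.
    move=> /(_ h (or_intror erefl)) Fh.
    by have [_ H] := hD 0 I; case: (H h 0 Fh).
  move=> f g [Ff|->] [Fg|->].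
  - exact: FP.
  - split; first by move=> i; have [] := FP f f Ff Ff.
    by move=> i j e; have [_ /(_ f i Ff)] := hD j I.
  - split=> [i|i j e]; first by have [] := hD i I.
    by have [_ H] := hD i I; case: (H g j Fg).
  - split=> [i|i j /hinj e]; first by have [] := hD i I.
    by split=> //; apply: e.
have [f0 Ff0] : exists f, F f.
  apply: contrapT => H; apply: Cinf; apply: (sub_finite_set _ (listed_finite s)).
  by rewrite -Ds => x Cx; split=> // f i Ff; case: H; exists f.
pose n := size s.
have idx x : List.In x s -> exists2 i, i < n & List.nth_error s i = Some x.
  rewrite /n; elim: s {Ds n} => //= y s IH [->|/IH [i Hi e]]; first by exists 0.
  by exists i.+1.
(* The omitted elements take the first [n] positions on the sequence [f0], whose own elements are
   shifted by [n]. *)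
pose pos x (p : (nat -> X) * nat) := [\/ [/\ F p.1, p.1 <> f0 & p.1 p.2 = x],
   p.1 = f0 /\ (exists2 k, p.2 = k + n & f0 k = x) |
   [/\ p.1 = f0, p.2 < n & List.nth_error s p.2 = Some x /\ D x]].
have posF x p : pos x p -> F p.1 by case=> [[]//|[-> _]//|[-> _ _]//].
have posE x : C x -> exists p, pos x p.
  move=> Cx; have [Dx|ND] := pselect (D x).
    have := Dx; rewrite Ds => /idx [i Hi e].
    by exists (f0, i); constructor 3.
  have [f [i [Ff e]]] : exists f i, F f /\ f i = x.
    apply: contrapT => H; apply: ND; split=> // f i Ff e.
    by apply: H; exists f, i.
  have [ff|ff] := pselect (f = f0); last by exists (f, i); constructor 1.
  by exists (f0, i + n); constructor 2; split => //; exists i; rewrite // -ff.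
have pos_inj x y p : pos x p -> pos y p -> x = y.
  case: p => f k [[/= Ff ff e]|[/= -> [i -> e]]|[/= -> ki [e Dx]]] [[/= Fg gf e']|[/= // _ [j e2 e']]|[/= // _ kj [e' Dy]]] //.
  - by rewrite -e.
  - by move/addIn: e2 => e2; rewrite -e -e' e2.
  - by move: kj; rewrite ltnNge leq_addl.
  - by move: ki; rewrite e2 ltnNge leq_addl.
  - by move: e; rewrite e' => -[].
have [p0 _] : exists p : (nat -> X) * nat, True by exists (f0, 0).
pose p x := select p0 (pos x).
have pP x : C x -> pos x (p x).
  by move=> /posE [q Hq]; exact: (@selectP _ p0 (pos x) (ex_intro _ q Hq)).
exists (fun x b => (p x).1 (b + (p x).2.*2)); split.
  by move=> x b /pP /posF Fp; have [] := FP _ _ Fp Fp.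
move=> x y b c /pP px /pP py e.
have [_ /(_ _ _ e) [e1 e2]] := FP _ _ (posF _ _ px) (posF _ _ py).
have bc : b = c.
  by move/(congr1 odd): e2; rewrite !oddD !odd_double !addbF; case: (b) (c) => -[].
split=> //; apply: (pos_inj _ _ (p x)) => //.
move: e2; rewrite bc => /addnI /double_inj e2.
by rewrite (_ : p x = p y) //; case: (p x) (p y) e1 e2 => ? ? [? ?] /= -> ->.
Qed.

Lemma finite_small (kappa X : Type) (A : set X) :
  infinite_set [set: kappa] -> finite_set A -> small kappa A.
Proof.
move=> kinf finA; split; last by move=> /card_le_finite /(_ finA).
have [n An] := finA.
apply: (@card_le_trans _ _ _ [set: nat]); last by move/infiniteP: kinf.
apply: (@card_le_trans _ _ _ `I_n); last exact: card_leT.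
by rewrite (card_le_eql An).
Qed.

Lemma card_le_small (kappa X Y : Type) (A : set X) (B : set Y) :
  A #<= B -> small kappa B -> small kappa A.
Proof.
move=> AB [Bk kB]; split; first exact: card_le_trans Bk.
by move=> kA; apply: kB; apply: card_le_trans AB.
Qed.

Lemma smallU (kappa X : Type) (A B : set X) :
  infinite_set [set: kappa] -> small kappa A -> small kappa B -> small kappa (A `|` B).
Proof.
move=> kinf; wlog AB : A B / A #<= B.
  move=> W sA sB; have [AB|BA] := card_le_total A B; first exact: W.
  by rewrite setUC; apply: W.
move=> _ sB; have [fB|iB] := pselect (finite_set B).
  apply: finite_small => //; rewrite finite_setU; split=> //.
  exact: card_le_finite AB fB.
have [->|[f [fAB finj]]] := card_le_injective AB; first by rewrite set0U.
have [g [gB ginj]] := card_le_double iB.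
apply: card_le_small sB.
pose h x := if pselect (A x) then g (f x) true else g x false.
apply: (@injective_card_le _ _ _ _ h).
  by move=> x; rewrite /h; case: pselect => [Ax _|Nx [//|Bx]]; apply: gB => //; exact: fAB.
have inB x : (A `|` B) x -> ~ A x -> B x by move=> [].
move=> x y ABx ABy; rewrite /h.
case: pselect => [Ax|Nx]; case: pselect => [Ay|Ny] /ginj H.
- by have [] := H (fAB _ Ax) (fAB _ Ay) => e _; apply: finj.
- by have [] := H (fAB _ Ax) (inB _ ABy Ny).
- by have [] := H (inB _ ABx Nx) (fAB _ Ay).
- by have [] := H (inB _ ABx Nx) (inB _ ABy Ny).
Qed.

Lemma monster_infinite (kappa : Type) (L : language) (T : theory L) (M : structure L) :
  monster kappa T M -> infinite_set [set: kappa].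
Proof.
case=> -[le _] _ _ _; apply/infiniteP; apply: card_le_trans le.
by apply: (@injective_card_le _ _ _ _ (fun n => existT (formula L) n Fls)) => // m n _ _ [].
Qed.

(** * Dimension one in integral domains *)

Section RingOperations.
Variables (L : language) (R : ring_symbols L).

Definition rzero (S : structure L) : S := fint (zero_sym R) (tnth [tuple]).
Definition rone (S : structure L) : S := fint (one_sym R) (tnth [tuple]).
Definition ropp (S : structure L) (x : S) : S := fint (opp_sym R) (tnth [tuple x]).
Definition radd (S : structure L) (x y : S) : S :=
  fint (add_sym R) (tnth [tuple x; y]).
Definition rmul (S : structure L) (x y : S) : S :=
  fint (mul_sym R) (tnth [tuple x; y]).
Definition rsub (S : structure L) (x y : S) : S := radd x (ropp y).

Lemma uterm_ext I (s t : forall S : structure L, (I -> S) -> S) :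
  (forall S v, s S v = t S v) -> uterm s -> uterm t.
Proof. by move=> st [n [u [e H]]]; exists n, u, e => S v; rewrite -st. Qed.

Lemma uterm_zero I : uterm (fun S (v : I -> S) => rzero S).
Proof.
apply: uterm_ext (@uterm_app _ I 0 (zero_sym R) (fun i S v => tnth [tuple] i) _).
  by move=> S v; congr fint; apply/funext.
by case.
Qed.

Lemma uterm_add I (s t : forall S : structure L, (I -> S) -> S) :
  uterm s -> uterm t -> uterm (fun S v => radd (s S v) (t S v)).
Proof.
move=> Hs Ht.
apply: uterm_ext (@uterm_app _ I 2 (add_sym R) (fun i S v => tnth [tuple s S v; t S v] i) _).
  by move=> S v; congr fint; apply/funext.
by case=> [[|[|//]]] Hi; [exact: uterm_ext Hs|exact: uterm_ext Ht].
Qed.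

Lemma uterm_mul I (s t : forall S : structure L, (I -> S) -> S) :
  uterm s -> uterm t -> uterm (fun S v => rmul (s S v) (t S v)).
Proof.
move=> Hs Ht.
apply: uterm_ext (@uterm_app _ I 2 (mul_sym R) (fun i S v => tnth [tuple s S v; t S v] i) _).
  by move=> S v; congr fint; apply/funext.
by case=> [[|[|//]]] Hi; [exact: uterm_ext Hs|exact: uterm_ext Ht].
Qed.

(* In an integral domain with an existential matroid, [crit P v] says that the
   set defined by P over v has dimension 1. *)
Definition crit I (P : ctxrel L (option I)) : ctxrel L I := fun S v =>
  forall z, exists x1 x2 x3 x4,
    [/\ P S (ocons x1 v), P S (ocons x2 v), P S (ocons x3 v), P S (ocons x4 v) &
        x1 <> x2 /\ radd (rmul z x1) x4 = radd (rmul z x2) x3].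

Lemma definable_crit I (P : ctxrel L (option I)) :
  definable P -> definable (crit P).
Proof.
move=> HP.
apply: definable_all; do 4 apply: definable_ex.
apply: (@definable_ext _ _ (fun S (w : option (option (option (option (option I)))) -> S) =>
  P S (w \o (fun i => if i is Some j then Some (Some (Some (Some (Some j)))) else Some (Some (Some None)))) /\
  P S (w \o (fun i => if i is Some j then Some (Some (Some (Some (Some j)))) else Some (Some None))) /\
  P S (w \o (fun i => if i is Some j then Some (Some (Some (Some (Some j)))) else Some None)) /\
  P S (w \o (fun i => if i is Some j then Some (Some (Some (Some (Some j)))) else None)) /\
  ~ (w (Some (Some (Some None))) = w (Some (Some None))) /\
  radd (rmul (w (Some (Some (Some (Some None))))) (w (Some (Some (Some None))))) (w None) =
  radd (rmul (w (Some (Some (Some (Some None))))) (w (Some (Some None)))) (w (Some None)))).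
  move=> S w.
  have E (a : S) j : ocons a ((((w \o some) \o some) \o some \o some) \o some) =
     w \o (fun i : option I => if i is Some k then Some (Some (Some (Some (Some k)))) else j)
     <-> a = w j.
    split=> [H|->]; first exact: (congr1 (fun f => f None) H).
    by apply/funext => -[].
  have e1 := (E _ (Some (Some (Some None)))).2 erefl.
  have e2 := (E _ (Some (Some None))).2 erefl.
  have e3 := (E _ (Some None)).2 erefl.
  have e4 := (E _ None).2 erefl.
  rewrite -e1 -e2 -e3 -e4; split=> [[? [? [? [? [? ?]]]]]|[? ? ? ? [? ?]]]; first by split.
  by do 5 (split => //).
do 4 (apply: definable_and; first exact: definable_sub).
apply: definable_and.
  by apply: definable_not; apply: definable_eq; apply: uterm_var.
by apply: definable_eq; apply: uterm_add; rewrite //; try apply: uterm_mul; apply: uterm_var.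
Qed.

Lemma crit_finite I J (P : ctxrel L (option I)) (Q : ctxrel L (option J)) (e : J -> I)
    (S : structure L)
    (v : I -> S) :
  (forall a, P S (ocons a v) <-> Q S (ocons a (v \o e))) ->
  crit P v <-> crit Q (v \o e).
Proof.
move=> PQ; split=> H z; have [x1 [x2 [x3 [x4 [/PQ H1 /PQ H2 /PQ H3 /PQ H4 H5]]]]] := H z.
  by exists x1, x2, x3, x4.
by exists x1, x2, x3, x4.
Qed.

Lemma crit_mono I J (P : ctxrel L (option I)) (Q : ctxrel L (option J))
    (S : structure L)
    (v : I -> S) (w : J -> S) :
  (forall a, P S (ocons a v) -> Q S (ocons a w)) -> crit P v -> crit Q w.
Proof.
move=> PQ H z; have [x1 [x2 [x3 [x4 [/PQ ? /PQ ? /PQ ? /PQ ? ?]]]]] := H z.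
by exists x1, x2, x3, x4.
Qed.

Lemma crit_inhabited I (P : ctxrel L (option I)) (S : structure L) (v : I -> S) :
  crit P v -> exists a, P S (ocons a v).
Proof.
move=> H; have [x] := Defs.nonempty S.
by have [x1 [_ [_ [_ [H1 _ _ _ _]]]]] := H x; exists x1.
Qed.

Section Domain.
Variable S : structure L.
Hypothesis dom : is_integral_domain R S.

Lemma domain_ring_theory :
  ring_theory (rzero S) (rone S) (@radd S) (@rmul S) (@rsub S) (@ropp S) eq.
Proof.
case: dom => [[addA addC add0 addN] [mulA mulC mul1 mulD] _ _].
split; rewrite /radd /rmul /rzero /rone /ropp /rsub //.
by move=> x; rewrite addC addN.
Qed.

Add Ring domain_ring : domain_ring_theory.

Lemma rmul_eq0 (x y : S) : rmul x y = rzero S -> x = rzero S \/ y = rzero S.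
Proof. by case: dom => _ _ _; apply. Qed.

Lemma rsub_eq0 (x y : S) : rsub x y = rzero S -> x = y.
Proof.
move=> H; have -> : x = radd (rsub x y) y by ring.
by rewrite H; ring.
Qed.

Lemma rmul_cancel (z z' x1 x2 x3 x4 : S) :
  x1 <> x2 -> radd (rmul z x1) x4 = radd (rmul z x2) x3 ->
  radd (rmul z' x1) x4 = radd (rmul z' x2) x3 -> z = z'.
Proof.
move=> x12 H H'; apply: rsub_eq0.
case: (@rmul_eq0 (rsub z z') (rsub x1 x2)) => [|//|/rsub_eq0 //].
have -> : rmul (rsub z z') (rsub x1 x2)
   = rsub (rsub (radd (rmul z x1) x4) (radd (rmul z x2) x3))
          (rsub (radd (rmul z' x1) x4) (radd (rmul z' x2) x3)) by ring.
by rewrite H H'; ring.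
Qed.

Lemma radd_cancelr (x y z : S) : radd x z = radd y z -> x = y.
Proof.
move=> H; have -> : x = rsub (radd x z) z by ring.
by rewrite H; ring.
Qed.

End Domain.
End RingOperations.

Lemma same_type_definable (L : language) (S : structure L) (B : set S) a a' I
    (P : ctxrel L (option I)) (v : I -> S) :
  same_type B a a' -> range v `<=` B -> definable P ->
  P S (ocons a v) -> P S (ocons a' v).
Proof.
move=> st vB /definable_finite [m [Q [e [/definable_formula [phi Hphi] HQ]]]].
rewrite !HQ -!Hphi => H.
have /st [+ _] : Defs.over B (PFormula phi (v \o e)).
  by move=> _ [i _ <-] /=; apply: vB; exists (e i).
exact.
Qed.

Section Existential.
Variables (L : language) (R : ring_symbols L) (kappa : Type) (M : structure L).
Variable cl : set M -> set M.
Hypothesis dom : is_integral_domain R M.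
Hypothesis kinf : infinite_set [set: kappa].
Hypothesis Hcl : existential_matroid kappa cl.

Add Ring M_ring : (domain_ring_theory dom).

Lemma existential_mat : matroid cl. Proof. by case: Hcl. Qed.
Local Notation mat := existential_mat.

Lemma generic_conjugate (B C : set M) a : finite_set B -> finite_set C -> ~ cl B a ->
  exists2 a', same_type B a a' & ~ cl (B `|` C) a'.
Proof. by case: Hcl => _ _ + _ fB fC; apply; exact: finite_small. Qed.

(** Otherwise Existence would give a conjugate of [a] over the parameters outside the closure of [a]
    itself, while uniqueness makes every conjugate equal to [a]. *)
Lemma functional_cl (J : finType) (P : ctxrel L (option J)) (v : J -> M) a :
  definable P -> (forall a', P M (ocons a' v) -> a' = a) -> P M (ocons a v) ->
  cl (range v) a.
Proof.
move=> defP uniq Pa; apply: contrapT => Na.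
have [a' st] := generic_conjugate (finite_range v) (finite_set1 a) Na; apply.
rewrite (uniq a'); first by apply: (cl_in mat); right.
exact: (same_type_definable st _ defP Pa).
Qed.

Lemma generic_exists : exists a, ~ cl set0 a.
Proof.
case: Hcl => _ _ _ nontriv; apply: contrapT => H; apply: nontriv.
apply/funext => X; apply/seteqP; split => // a _.
apply: (cl_mono mat (@sub0set _ X)); apply: contrapT => Na.
by apply: H; exists a.
Qed.

Lemma cl_finite_proper (A : set M) : finite_set A -> exists a, ~ cl A a.
Proof.
move=> fA; have [a Na] := generic_exists.
have [a' _] := generic_conjugate (finite_set0 M) fA Na.
by rewrite set0U; exists a'.
Qed.

Lemma rmul_cl (z x1 x2 x3 x4 : M) :
  x1 <> x2 -> radd R (rmul R z x1) x4 = radd R (rmul R z x2) x3 ->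
  cl [set x1; x2; x3; x4] z.
Proof.
move=> x12 H.
pose v (i : 'I_4) := tnth [tuple x1; x2; x3; x4] i.
pose o0 := @Ordinal 4 0 isT; pose o1 := @Ordinal 4 1 isT.
pose o2 := @Ordinal 4 2 isT; pose o3 := @Ordinal 4 3 isT.
apply: (@cl_mono _ _ mat (range v)).
  by move=> _ [[[|[|[|[|//]]]] Hi] _ <-] /=; rewrite /v (tnth_nth x1) /=; 
    [left; left; left|left; left; right|left; right|right].
apply: (@functional_cl _ (fun S w => radd R (rmul R (w None) (w (Some o0))) (w (Some o3)) =
    radd R (rmul R (w None) (w (Some o1))) (w (Some o2)))) => //.
  by apply: definable_eq; apply: uterm_add; rewrite //; try apply: uterm_mul; apply: uterm_var.
move=> z' Hz'; apply: (rmul_cancel dom x12) H; exact: Hz'.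
Qed.

Lemma radd_cl (w y z x : M) :
  radd R w y = rmul R z x -> cl [set w; z; x] y.
Proof.
move=> H; pose v (i : 'I_3) := tnth [tuple w; z; x] i.
pose o0 := @Ordinal 3 0 isT; pose o1 := @Ordinal 3 1 isT; pose o2 := @Ordinal 3 2 isT.
apply: (@cl_mono _ _ mat (range v)).
  by move=> _ [[[|[|[|//]]] Hi] _ <-] /=; rewrite /v (tnth_nth w) /=;
    [left; left|left; right|right].
apply: (@functional_cl _ (fun S u => radd R (u (Some o0)) (u None) =
    rmul R (u (Some o1)) (u (Some o2)))) => //.
  by apply: definable_eq; [apply: uterm_add|apply: uterm_mul]; apply: uterm_var.
move=> y' /= Hy'.
have -> : y = rsub R (radd R w y) w by ring.
by rewrite H -[rmul _ _ _]Hy'; rewrite /v !(tnth_nth w) /=; ring.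
Qed.

(** If the set lies in the closure of [v], then by [rmul_cl] so does every z solved for by its
    points, although some z is generic. Conversely, for a given z, two generic points [x], [y] of
    the set are taken, independent over [v] and z, and a second pair with the same value z x - y is
    sought. *)
Lemma crit_dim (J : finType) (P : ctxrel L (option J)) (v : J -> M) :
  definable P ->
  crit R P v <-> exists2 a, P M (ocons a v) & ~ cl (range v) a.
Proof.
move=> defP; split.
  move=> crP; apply: contrapT => H.
  have sub a : P M (ocons a v) -> cl (range v) a.
    by move=> Pa; apply: contrapT => Na; apply: H; exists a.
  have [z Nz] := cl_finite_proper (finite_range v).
  have [x1 [x2 [x3 [x4 [P1 P2 P3 P4 [x12 e]]]]]] := crP z.
  apply: Nz; apply: (cl_sub mat _ (rmul_cl x12 e)).
  by move=> _ [[[->|->]|->]|->]; apply: sub.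
move=> [a Pa Na] z.
have [x stx Nx] := generic_conjugate (finite_range v) (finite_set1 z) Na.
have Px : P M (ocons x v) by exact: (same_type_definable stx _ defP Pa).
have fzx : finite_set ([set z] `|` [set x]).
  by rewrite finite_setU; split; exact: finite_set1.
have [y sty Ny] := generic_conjugate (finite_range v) fzx Na.
have Py : P M (ocons y v) by exact: (same_type_definable sty _ defP Pa).
pose w := rsub R (rmul R z x) y.
have wy : radd R w y = rmul R z x by rewrite /w; ring.
pose v' : option (option J) -> M := ocons w (ocons z v).
(* [x] stays generic over [v], [z] and [w]: otherwise exchange would generate [w], hence [y] = [z]
   [x] - [w], from [v], [z] and [x]. *)
have [Hx|Hx] := pselect (cl (range v') x).
  case: Ny; rewrite setUA.
  have clw : cl (range v `|` [set z] `|` [set x]) w.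
    apply: (cl_exchange mat) Nx; apply: (cl_mono mat _ Hx).
    move=> _ [[[j|]|] _ <-] /=; [left; left; by exists j|left; right|right] => //.
  apply: (cl_sub mat _ (radd_cl wy)).
  move=> _ [[->|->]|->] //; apply: (cl_in mat); first by left; right.
  by right.
pose Q : ctxrel L (option (option (option J))) := fun S u =>
  P S (ocons (u None) (u \o some \o some \o some)) /\ exists y, 
  P S (ocons y (u \o some \o some \o some)) /\
   radd R (u (Some None)) y = rmul R (u (Some (Some None))) (u None).
have defQ : definable Q.
  apply: definable_and.
    by apply: (@definable_env _ _ _ _ (fun i => if i is Some j then Some (Some (Some j)) else None)) => // S u [].
  apply: definable_ex; apply: definable_and.
    by apply: (@definable_env _ _ _ _ (fun i => if i is Some j then Some (Some (Some (Some j))) else None)) => // S u [].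
  by apply: definable_eq; [apply: uterm_add|apply: uterm_mul]; apply: uterm_var.
(* [Q] says that a point of the set is the first entry of a pair with value [w]; a conjugate of [x]
   over [v], [z] and [w] supplies the second pair. *)
have [x' stx' Nx'] := generic_conjugate (finite_range v') (finite_set1 x) Hx.
have [] : Q M (ocons x' v').
  apply: (same_type_definable stx' _ defQ) => //.
  by split => //; exists y.
move=> /= Px' [y' [Py' wy']].
exists x, x', y, y'; split=> //; split.
  by move=> xx'; apply: Nx'; apply: (cl_in mat); right; rewrite xx'.
by rewrite -wy -wy'; ring.
Qed.

Lemma existential_matroidE (A : set M) :
  cl A = [set a | exists m (P : ctxrel L (option 'I_m)) (b : 'I_m -> M),
    [/\ definable P, range b `<=` A, P M (ocons a b) & ~ crit R P b]].
Proof.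
have defcl : definable_matroid cl by case: Hcl.
apply/seteqP; split=> a.
  rewrite {1}defcl => -[m [phi [b [nar bA Hphi]]]].
  exists m, (fun S w => sat phi (w \o (fun i => if unlift ord0 i is Some j then Some j else None))), b.
  have E (x : M) : ocons x b \o (fun i => if unlift ord0 i is Some j then Some j else None) = scons x b.
    by apply/funext => i /=; rewrite /scons; case: (unlift ord0 i).
  have defP := definable_sat phi (fun i => if unlift ord0 i is Some j then Some j else None).
  split=> //; first by rewrite E.
  by move=> /(crit_dim b defP) [a']; rewrite E => /nar.
move=> [m [P [b [defP bA Pa NP]]]].
apply: (cl_mono mat bA); apply: contrapT => Na; apply: NP.
by apply/crit_dim => //; exists a.
Qed.

End Existential.

Lemma existential_matroid_unique (L : language) (R : ring_symbols L) (kappa : Type)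
    (M : structure L) (cl cl' : set M -> set M) :
  is_integral_domain R M -> infinite_set [set: kappa] ->
  existential_matroid kappa cl -> existential_matroid kappa cl' -> cl = cl'.
Proof.
move=> dom kinf H H'; apply/funext => A.
by rewrite (existential_matroidE dom kinf H) (existential_matroidE dom kinf H').
Qed.

(** * Transfer to models of T *)

Section Realizing.
Variable L : language.

Lemma elementary_definable (S S' : structure L) (h : S -> S') I (P : ctxrel L I) (v : I -> S) :
  elementary_embedding h -> definable P -> P S v <-> P S' (h \o v).
Proof. by move=> Hh [n [phi [e H]]]; rewrite !H; exact: Hh. Qed.

Lemma comp_ocons (X Y I : Type) (h : X -> Y) (a : X) (v : I -> X) :
  h \o ocons a v = ocons (h a) (h \o v).
Proof. by apply/funext => -[]. Qed.

Lemma ocons_omap (X I J : Type) (a : X) (v : I -> X) (f : J -> I) :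
  ocons a v \o omap f = ocons a (v \o f).
Proof. by apply/funext => -[]. Qed.

Lemma definable_omap I J (P : ctxrel L (option J)) (f : J -> I) : definable P ->
  definable (fun S (w : option I -> S) => P S (w \o omap f)).
Proof. exact: definable_sub. Qed.

(* The types over u which are finitely satisfiable in S, given as directed
   families of formulas, are realized over u' in S'. *)
Definition realizes I (S S' : structure L) (u : I -> S) (u' : I -> S') : Prop :=
  forall Sigma : ctxrel L (option I) -> Prop,
    (forall P, Sigma P -> definable P) -> (exists P, Sigma P) ->
    (forall P Q, Sigma P -> Sigma Q -> exists2 Q', Sigma Q' &
       forall a, Q' S (ocons a u) -> P S (ocons a u) /\ Q S (ocons a u)) ->
    (forall P, Sigma P -> exists a, P S (ocons a u)) ->
    exists a, forall P, Sigma P -> P S' (ocons a u').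

Lemma same_type_of_definable (S : structure L) (B : set S) a a' :
  (forall P : ctxrel L (option {x | B x}), definable P ->
     P S (ocons a sval) -> P S (ocons a' sval)) -> same_type B a a'.
Proof.
move=> st p pB.
have cb i : B (@pf_params _ _ p i) by apply: pB; exists i.
pose f i : {x | B x} := exist _ _ (cb i).
pose g (i : 'I_(pf_arity p).+1) := if unlift ord0 i is Some j then Some (f j) else None.
have E x : ocons x sval \o g = scons x (@pf_params _ _ p).
  by apply/funext => i /=; rewrite /scons /g; case: (unlift ord0 i).
have defp := definable_sat (pf_formula p) g.
rewrite /psat -!E; split; first exact: (st _ defp).
by move=> H; apply: contrapT; apply: (fun H' => st _ (definable_not defp) H' H).
Qed.

Lemma directed_list (X : Type) (S : structure L) I (u : I -> S) (Sigma : ctxrel L (option I) -> Prop)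
    (F : X -> S -> Prop) (s : seq X) :
  (exists P, Sigma P) ->
  (forall P Q, Sigma P -> Sigma Q -> exists2 Q', Sigma Q' &
       forall a, Q' S (ocons a u) -> P S (ocons a u) /\ Q S (ocons a u)) ->
  (forall x, List.In x s -> exists2 P, Sigma P & forall a, P S (ocons a u) -> F x a) ->
  exists2 P, Sigma P & forall a, P S (ocons a u) -> forall x, List.In x s -> F x a.
Proof.
move=> [P0 SP0] dir; elim: s => [|x s IH] H; first by exists P0.
have [P SP HP] := H x (or_introl erefl).
have [|Q SQ HQ] := IH; first by move=> y sy; apply: H; right.
have [Q' SQ' HQ'] := dir _ _ SP SQ.
by exists Q' => // a /HQ' [/HP Fx /HQ Fs] y [<-//|/Fs].
Qed.

Lemma pformula_of_definable (S : structure L) I (P : ctxrel L (option I)) (u : I -> S) :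
  definable P -> exists2 p : pformula S, range (@pf_params _ _ p) `<=` range u &
   forall a, psat a p <-> P S (ocons a u).
Proof.
move=> /definable_finite [m [Q [e [/definable_formula [phi Hphi] HQ]]]].
exists (PFormula phi (u \o e)) => [_ [i _ <-]|a] /=; first by exists (e i).
by rewrite HQ -Hphi.
Qed.

Lemma saturated_realizes kappa (S : structure L) (A : set S) :
  saturated kappa S -> small kappa A ->
  @realizes {x | A x} S S sval sval.
Proof.
move=> satS sA Sigma defS neS dirS finS.
pose F := [set p : pformula S | Defs.over A p /\ exists2 P, Sigma P &
   forall a, P S (ocons a sval) <-> psat a p].
have [|S0 /finite_listed [s ->] sF|a Ha] := satS A F sA; first by move=> p [].
  have [|P SP HP] := @directed_list _ S _ sval Sigma (fun p a => psat a p) s neS dirS.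
    by move=> p /sF [_ [P SP HP]]; exists P => // a /HP.
  have [a Pa] := finS _ SP.
  by exists a; apply: HP.
exists a => P SP.
have [p pA Hp] := pformula_of_definable (sval : {x | A x} -> S) (defS _ SP).
apply/Hp/Ha; split; last by exists P => // b; rewrite Hp.
by move=> x /pA [[y Ay] _ <-].
Qed.

(** The indices of the ultrapower are finite lists of formulas over [S], and the ultrafilter
    contains, for each list, the set of all longer ones. At the index [l] a realization only has to
    satisfy the formulas in [l], which directedness and finite satisfiability allow. This holds for
    arbitrary [S], without any bound on cardinals. *)
Lemma realizing_extension (S : structure L) :
  exists (S' : structure L) (j : S -> S'),
    elementary_embedding j /\ realizes (fun x => x) j.
Proof.
pose J : Type := seq (pformula S).
pose F : set_system J := [set A | exists s : J, forall l : J, 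
  (forall p, List.In p s -> List.In p l) -> A l].
have FP : ProperFilter F.
  split; first by move=> [s /(_ s)]; apply.
  split; first by exists [::].
  - move=> A B [s Hs] [t Ht]; exists (s ++ t) => l H; split.
      by apply: Hs => p Hp; apply: H; apply/List.in_app_iff; left.
    by apply: Ht => p Hp; apply: H; apply/List.in_app_iff; right.
  - by move=> A B AB [s Hs]; exists s => l /Hs /AB.
have [U [UU FU]] := ultraFilterLemma FP.
exists (ultrapower U), (@ultra_diag _ S U); split; first exact: ultra_diag_elementary.
move=> Sigma defS neS dirS finS.
pose G (p : pformula S) := exists2 P, Sigma P & forall a, P S (ocons a (fun x => x)) <-> psat a p.
have [x0] := Defs.nonempty S.
pose f (l : J) := select x0 [set a | forall p, List.In p l -> G p -> psat a p].
have fP l p : List.In p l -> G p -> psat (f l) p.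
  apply: (@selectP _ x0 [set a | forall p, List.In p l -> G p -> psat a p]) p.
  have [P SP HP] : exists2 P, Sigma P & forall a, P S (ocons a (fun x => x)) ->
      forall p, List.In p l -> G p -> psat a p.
    apply: directed_list => // p _; have [[P SP HP]|NG] := pselect (G p).
      by exists P => // a /HP.
    by have [P SP] := neS; exists P.
  by have [a Pa] := finS _ SP; exists a; apply: HP.
exists (ultra_pi U f) => P SP.
have [m [Q [e [/definable_formula [phi Hphi] HQ]]]] := definable_finite (defS _ SP).
rewrite HQ -Hphi.
pose p := PFormula phi (e : 'I_m -> S).
have Gp : G p by exists P => // a; rewrite HQ -Hphi.
have := ultra_sat UU phi (fun i => if unlift ord0 i is Some k then fun=> e k else f).
set v := (X in sat phi X <-> _).
have -> : v = scons (ultra_pi U f : ultrapower U) (@ultra_diag _ S U \o e).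
  by apply/funext => i; rewrite /v /scons; case: unlift.
move=> ->; apply: FU; exists [:: p] => l Hl.
have := fP l p (Hl _ (or_introl erefl)) Gp.
rewrite /psat /=; congr (sat phi _); apply/funext => i.
by rewrite /scons; case: unlift.
Qed.

End Realizing.

Section Transfer.
Variables (L : language) (R : ring_symbols L) (T : theory L) (kappa : Type) (M : structure L).
Variable cl : set M -> set M.
Hypothesis compT : complete T.
Hypothesis MT : model T M.
Hypothesis domT : expands_integral_domains R T.
Hypothesis kinf : infinite_set [set: kappa].
Hypothesis Hcl : existential_matroid kappa cl.

Local Notation mat := (existential_mat Hcl).
Let dom : is_integral_domain R M := domT MT.

Definition narrow_in (J : Type) (P : ctxrel L (option J)) : Prop :=
  definable P /\ forall (a : M) (b : J -> M), P M (ocons a b) -> cl (range b) a.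

Lemma valid_transfer (S : structure L) I (P : ctxrel L I) : model T S ->
  definable P -> (forall v, P M v) -> forall v, P S v.
Proof.
move=> ST /definable_sentence [s Hs] PM; apply/Hs.
have Ms : holds M s by apply/Hs.
case: compT => _ /(_ s) [/(_ S ST) //|/(_ M MT) NMs].
pose v0 := @from_I0 M.
by case: (NMs v0 (Ms v0)).
Qed.

Lemma functional_narrow (J : finType) (P : ctxrel L (option J)) :
  definable P ->
  (forall (a a' : M) b, P M (ocons a b) -> P M (ocons a' b) -> a' = a) ->
  narrow_in P.
Proof.
move=> defP H; split => // a b Pa.
by apply: (functional_cl kinf Hcl defP) => // a' Pa'; apply: H Pa'.
Qed.

Lemma narrow_sub (J K : Type) (P : ctxrel L (option J)) (f : J -> K) :
  narrow_in P -> narrow_in (fun S (w : option K -> S) => P S (w \o omap f)).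
Proof.
move=> [defP nP]; split; first exact: definable_omap.
move=> a b; rewrite ocons_omap => /nP; apply: (cl_mono mat).
by move=> _ [j _ <-]; exists (f j).
Qed.

Lemma narrow_or (J K : Type) (P : ctxrel L (option J)) (Q : ctxrel L (option K)) :
  narrow_in P -> narrow_in Q -> 
  narrow_in (fun S (w : option (J + K) -> S) =>
    P S (w \o omap inl) \/ Q S (w \o omap inr)).
Proof.
move=> nP nQ; have [dP nP'] := narrow_sub (inl : J -> J + K) nP.
have [dQ nQ'] := narrow_sub (inr : K -> J + K) nQ.
split; first by apply: definable_or.
by move=> a b [/nP'|/nQ'].
Qed.

Lemma narrow_false : narrow_in (fun S (w : option void -> S) => False).
Proof. by split => //; exact: definable_fls. Qed.

Section Model.
Variable S : structure L.
Hypothesis ST : model T S.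
Local Notation clS := (transfer cl S).

Lemma transfer_intro (J : finType) (P : ctxrel L (option J)) (b : J -> S) X a :
  narrow_in P -> range b `<=` X -> P S (ocons a b) -> clS X a.
Proof.
move=> nP bX Pa; have [/definable_formula [phi Hphi] nQ] := narrow_sub (@enum_rank J) nP.
exists #|J|, phi, (b \o enum_val); split.
- by move=> x c /Hphi /nQ.
- by move=> _ [i _ <-]; apply: bX; exists (enum_val i).
apply/Hphi; rewrite ocons_omap (_ : (b \o enum_val) \o enum_rank = b) //.
by apply/funext => j /=; rewrite enum_rankK.
Qed.

Lemma transfer_elim X a : clS X a ->
  exists m (P : ctxrel L (option 'I_m)) (b : 'I_m -> S),
    [/\ narrow_in P, range b `<=` X & P S (ocons a b)].
Proof.
move=> [m [phi [b [nphi bX Hphi]]]].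
pose g (i : 'I_m.+1) := if unlift ord0 i is Some j then Some j else None.
have E (Y : structure L) (x : Y) c : ocons x c \o g = scons x c.
  by apply/funext => i /=; rewrite /scons /g; case: (unlift ord0 i).
exists m, (fun Y w => sat phi (w \o g)), b; split=> //; last by rewrite E.
split; first exact: definable_sat.
by move=> x c; rewrite E => /nphi.
Qed.

Lemma transfer_elimU X Y a : clS (X `|` Y) a ->
  exists (J1 J2 : finType) (P : ctxrel L (option (J1 + J2))) (b1 : J1 -> S) (b2 : J2 -> S),
    [/\ narrow_in P, range b1 `<=` X, range b2 `<=` Y & P S (ocons a (scat b1 b2))].
Proof.
move=> /transfer_elim [m [P [b [nP bXY Pa]]]].
pose D := [pred i : 'I_m | `[< X (b i) >]].
pose J1 : finType := {i | D i}; pose J2 : finType := {i | ~~ D i}.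
pose f (i : 'I_m) : J1 + J2 :=
  match Sumbool.sumbool_of_bool (D i) with
  | left H => inl (exist _ i H) | right H => inr (exist _ i (negbT H)) end.
exists J1, J2, (fun S w => P S (w \o omap f)), (b \o sval), (b \o sval); split.
- exact: (narrow_sub f nP).
- by move=> _ [[i Hi] _ <-] /=; apply/asboolP; exact: Hi.
- move=> _ [[i Hi] _ <-] /=.
  have Hi' : ~ X (b i) by apply/asboolPn; exact: Hi.
  by case: (bXY (b i)) => //; exists i.
rewrite ocons_omap (_ : _ \o f = b) //.
by apply/funext => i /=; rewrite /f; case: Sumbool.sumbool_of_bool.
Qed.

(** By [crit_dim] in the monster model, the formula saying P and not [crit] P is narrow. If [crit]
    failed over [v], this formula would witness that [a] is in the closure. *)
Lemma crit_of_generic I (P : ctxrel L (option I)) (v : I -> S) X a :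
  definable P -> range v `<=` X -> P S (ocons a v) -> ~ clS X a -> crit R P v.
Proof.
move=> defP vX Pa Na.
have [m [Q [e [defQ HQ]]]] := definable_finite defP.
rewrite (@crit_finite _ R _ _ P Q e); last by move=> x; exact: HQ.
apply: contrapT => Ncr; apply: Na.
apply: (@transfer_intro _ (fun S w => Q S w /\ ~ crit R Q (w \o some)) (v \o e)).
- split.
    apply: definable_and => //; apply: definable_not.
    exact: (definable_sub some (definable_crit R defQ)).
  move=> x b [Qx /= Nx]; apply: contrapT => Nc; apply: Nx.
  by apply/(crit_dim dom kinf Hcl _ defQ); exists x.
- by move=> _ [i _ <-]; apply: vX; exists (e i).
by split => //; exact/HQ.
Qed.

(* P' is left free so that its context need only contain the parameters v of P
   and d of Q. *)
Lemma crit_avoid I (J : finType) (P : ctxrel L (option I)) (Q : ctxrel L (option J))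
    (v : I -> S) (d : J -> S) I' (P' : ctxrel L (option I')) (v' : I' -> S) :
  definable P -> narrow_in Q -> crit R P v ->
  (forall a, P S (ocons a v) -> ~ Q S (ocons a d) -> P' S (ocons a v')) ->
  crit R P' v'.
Proof.
move=> defP nQ + PP'.
have [m [P0 [e [defP0 HP0]]]] := definable_finite defP.
rewrite (@crit_finite _ R _ _ P P0 e); last by move=> x; exact: HP0.
pose PQ : ctxrel L (option ('I_m + J)) := fun S w =>
  P0 S (w \o omap inl) /\ ~ Q S (w \o omap inr).
have defPQ : definable PQ.
  by apply: definable_and; [|apply: definable_not]; apply: definable_omap => //; case: nQ.
move=> crP; apply: (@crit_mono _ R _ _ PQ _ _ (scat (v \o e) d)).
  move=> a; rewrite /PQ !ocons_omap => -[Pa Qa].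
  by apply: PP' => //; apply/HP0.
(* The implication is checked in [M], where a generic point of [P0] has a conjugate outside the
   closure of the parameters of both formulas; completeness carries it to [S]. *)
have := @valid_transfer S _ (fun S w => crit R P0 (w \o inl) -> crit R PQ w) ST.
apply => //.
  apply: definable_imp; last exact: definable_crit.
  exact: (definable_sub inl (definable_crit R defP0)).
move=> w /(crit_dim dom kinf Hcl _ defP0) [a P0a Na].
have [a' st Na'] := generic_conjugate kinf Hcl (finite_range (w \o inl)) (finite_range (w \o inr)) Na.
apply/(crit_dim dom kinf Hcl _ defPQ); exists a'.
  rewrite /PQ !ocons_omap; split; first exact: (same_type_definable st _ defP0).
  by move=> /nQ.2 H; apply: Na'; apply: (cl_mono mat _ H); right.
move=> H; apply: Na'; apply: (cl_mono mat _ H).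
by move=> _ [[i|j] _ <-]; [left; exists i|right; exists j].
Qed.

Lemma transfer_mono X Y : X `<=` Y -> clS X `<=` clS Y.
Proof.
move=> XY a [m [phi [b [n bX H]]]]; exists m, phi, b; split=> //.
exact: subset_trans XY.
Qed.

Lemma transfer_in X : X `<=` clS X.
Proof.
move=> a Xa; apply: (@transfer_intro unit (fun S w => w None = w (Some tt)) (fun=> a)) => //.
  apply: functional_narrow; first by apply: definable_eq; apply: uterm_var.
  by move=> x x' b /= -> ->.
by move=> _ [_ _ <-].
Qed.

(** Narrow formulas compose: quantifying away the intermediate elements [y] in [Z] leaves a formula
    over the parameters [c] which is narrow because [cl] is idempotent on [M]. *)
Lemma transfer_sub X Y : X `<=` clS Y -> clS X `<=` clS Y.
Proof.
move=> XY a /transfer_elim [m [P [b [nP bX Pa]]]].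
have bY i : clS Y (b i) by apply/XY/bX; exists i.
have H i := transfer_elim (bY i).
pose k i := projT1 (cid (H i)); have H1 i := projT2 (cid (H i)).
pose Q i := projT1 (cid (H1 i)); have H2 i := projT2 (cid (H1 i)).
pose c i := projT1 (cid (H2 i)); have H3 i := projT2 (cid (H2 i)).
rewrite -/(k _) -/(Q _) -/(c _) in H3.
pose J : finType := {i : 'I_m & 'I_(k i)}.
pose in_J i (j : 'I_(k i)) : J := Tagged (fun i => 'I_(k i)) j.
pose Z : ctxrel L (option J) := fun S w => exists y : 'I_m -> S,
  (forall i, Q i S (ocons (y i) (w \o some \o in_J i))) /\ P S (ocons (w None) y).
apply: (@transfer_intro J Z (fun x => c (tag x) (tagged x))).
- split.
    apply: definable_ex_block; apply: definable_and.
      apply: definable_big_and => i; have [[dQ _] _ _] := H3 i.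
      apply: (@definable_env _ _ _ _ (fun x => if x is Some j then inr (Some (in_J i j)) else inl i) _ dQ).
      by move=> S0 v [].
    apply: (@definable_env _ _ _ _ (fun x => if x is Some j then inl j else inr None) _ nP.1).
    by move=> S0 v [].
  move=> x w [y [Qy Py]]; apply: (cl_sub mat _ (nP.2 _ _ Py)).
  move=> _ [i _ <-]; have [[_ nQ] _ _] := H3 i.
  apply: (cl_mono mat _ (nQ _ _ (Qy i))).
  by move=> _ [j _ <-]; exists (in_J i j).
- by move=> _ [[i j] _ <-] /=; have [_ + _] := H3 i; apply; exists j.
exists b; split=> // i; have [_ _] := H3 i.
by congr (Q i S (ocons _ _)).
Qed.

(** If [c] were outside the closure of [X] and [a], the points z that can replace [c] in [P] would
    form a set of dimension 1. That they do so is a narrow condition on [a], by exchange in [M], so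
    [a] would be in the closure of [X]. *)
Lemma transfer_exchange X a c :
  clS (X `|` [set c]) a -> ~ clS X a -> clS (X `|` [set a]) c.
Proof.
move=> /transfer_elimU [J1 [J2 [P [b1 [b2 [nP b1X b2c Pa]]]]]] Na.
have {}b2c : b2 = fun=> c by apply/funext => j; apply: b2c; exists j.
rewrite {}b2c in Pa.
pose f (x : option (J1 + J2)) : option (option J1) :=
  match x with None => Some None | Some (inl j) => Some (Some j) | Some (inr _) => None end.
have E (Y : Type) (x z : Y) (w : J1 -> Y) :
    ocons z (ocons x w) \o f = ocons x (scat w (fun=> z)).
  by apply/funext => -[[]|].
pose Pz : ctxrel L (option (option J1)) := fun S w => P S (w \o f).
have defPz : definable Pz by apply: definable_sub nP.1.
apply: contrapT => Nc; apply: Na.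
have crP : crit R Pz (ocons a b1).
  apply: (crit_of_generic defPz _ _ Nc); last by rewrite /Pz E.
  by move=> _ [[j|] _ <-]; [left; apply: b1X; exists j|right].
apply: (@transfer_intro J1 (fun S w => crit R Pz w) b1) => //.
split; first exact: definable_crit.
move=> x w /(crit_dim dom kinf Hcl _ defPz) [z]; rewrite /Pz E => Hz Nz.
apply: contrapT => Nx; apply: Nz.
have -> : range (ocons x w) = range w `|` [set x].
  apply/seteqP; split=> [_ [[j|] _ <-]|_ [[j _ <-]|->]].
  - by left; exists j.
  - by right.
  - by exists (Some j).
  - by exists None.
apply: (cl_exchange mat) Nx; apply: (cl_mono mat _ (nP.2 _ _ Hz)).
by move=> _ [[j|j] _ <-]; [left; exists j|right].
Qed.

Lemma transfer_matroid : matroid clS.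
Proof.
split.
- exact: transfer_in.
- exact: transfer_mono.
- by move=> X; apply/seteqP; split; [exact: transfer_sub|exact: transfer_in].
- move=> X; apply/seteqP; split=> [a /transfer_elim [m [P [b [nP bX Pa]]]]|a [A [_ AX]]].
    exists (range b); first by split=> //; exact: finite_range.
    exact: (transfer_intro nP _ Pa).
  exact: transfer_mono.
- by move=> X a c [H1 H2]; apply: transfer_exchange.
Qed.

(** The type to be realized adds to [F] the negations of all narrow formulas over [u]. It is
    finitely satisfiable because a set of dimension 1 keeps that dimension after a narrow fibre is
    removed. *)
Lemma realize_generic (S' : structure L) I (u : I -> S) (u' : I -> S')
    (F : ctxrel L (option I) -> Prop) :
  realizes u u' ->
  (forall P, F P -> definable P) -> (exists P, F P) ->
  (forall P Q, F P -> F Q -> exists2 Q', F Q' &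
     forall a, Q' S (ocons a u) -> P S (ocons a u) /\ Q S (ocons a u)) ->
  (forall P, F P -> crit R P u) ->
  exists a, (forall P, F P -> P S' (ocons a u')) /\ ~ transfer cl S' (range u') a.
Proof.
move=> Hr defF neF dirF crF.
pose Sigma := fun Z : ctxrel L (option I) => exists (J : finType)
   (P : ctxrel L (option I)) (Q : ctxrel L (option J)) (f : J -> I),
   [/\ F P, narrow_in Q & Z = fun S w => P S w /\ ~ Q S (w \o omap f)].
have [||||a Ha] := Hr Sigma.
- move=> _ [J [P [Q [f [FP nQ ->]]]]]; apply: definable_and; first exact: defF.
  by apply: definable_not; apply: definable_omap nQ.1.
- have [P FP] := neF.
  exists (fun S w => P S w /\ ~ False), void, P, (fun S w => False), (fun x : void => match x with end).
  by split => //; exact: narrow_false.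
- move=> _ _ [J [P [Q [f [FP nQ ->]]]]] [J' [P' [Q' [f' [FP' nQ' ->]]]]].
  have [P2 FP2 H] := dirF _ _ FP FP'.
  eexists.
    eexists (J + J')%type, P2, _, (fun x => match x with inl j => f j | inr j => f' j end).
    by split; [exact: FP2|exact: narrow_or nQ nQ'|reflexivity].
  move=> a [/H [Pa P'a]] /not_orP [H1 H2]; split; split=> // H3; [apply: H1|apply: H2];
    by move: H3; rewrite !ocons_omap.
- move=> _ [J [P [Q [f [FP nQ ->]]]]].
  apply: (@crit_inhabited _ R _ (fun S w => P S w /\ ~ Q S (w \o omap f)) S u).
  apply: (crit_avoid (defF _ FP) nQ (crF _ FP) (d := u \o f)) => a Pa Qa.
  by split=> //; rewrite ocons_omap.
exists a; split.
  move=> P FP.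
  have [] // := Ha (fun S w => P S w /\ ~ False).
  by exists void, P, (fun S w => False), (fun x : void => match x with end); split => //; exact: narrow_false.
move=> [m [phi [b [nphi bu Hphi]]]].
have cb i : exists j, u' j = b i by have [|j _ <-] := bu (b i); [exists i|exists j].
pose f i := projT1 (cid (cb i)).
have fb : u' \o f = b by apply/funext => i /=; rewrite /f; case: (cid _).
pose g (i : 'I_m.+1) := if unlift ord0 i is Some j then Some j else None.
have E (Y : structure L) (x : Y) c : ocons x c \o g = scons x c.
  by apply/funext => i /=; rewrite /scons /g; case: (unlift ord0 i).
have nQ : narrow_in (fun Y (w : option 'I_m -> Y) => sat phi (w \o g)).
  split; first exact: definable_sat.
  by move=> x c; rewrite E => /nphi.
have [P FP] := neF.
have [] := Ha (fun S w => P S w /\ ~ sat phi (w \o omap f \o g)).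
  by exists 'I_m, P, (fun Y w => sat phi (w \o g)), f; split => //; exact: nQ.
by rewrite ocons_omap fb E.
Qed.

End Model.

Lemma transfer_elementary (S S' : structure L) (h : S -> S') X a :
  elementary_embedding h -> transfer cl S' (h @` X) (h a) <-> transfer cl S X a.
Proof.
move=> Hh; split=> -[m [phi [b [nphi bX Hphi]]]].
  have cb i : exists2 x, X x & h x = b i by apply: bX; exists i.
  pose b' i := s2val (cid2 (cb i)).
  have b'X i : X (b' i) by rewrite /b'; case: (cid2 _).
  have hb' : h \o b' = b by apply/funext => i /=; rewrite /b'; case: (cid2 _).
  exists m, phi, b'; split=> //; first by move=> _ [i _ <-].
  by apply/Hh; rewrite comp_scons hb'.
exists m, phi, (h \o b); split=> //.
  by move=> _ [i _ <-] /=; exists (b i) => //; apply: bX; exists i.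
by rewrite -comp_scons; apply/Hh.
Qed.

Lemma crit_true (S : structure L) I (u : I -> S) : model T S ->
  crit R (fun S (w : option I -> S) => True) u.
Proof.
move=> ST.
have := @valid_transfer S void (fun S v => crit R (fun S (w : option void -> S) => True) v) ST.
have defT : definable (fun (S : structure L) (w : option void -> S) => True) by exact: definable_cst.
move=> /(_ (definable_crit R defT)) H.
apply: (@crit_mono _ R _ _ _ (fun S w => True) _ (fun x : void => match x with end)); first by [].
apply: H => v; apply/(crit_dim dom kinf Hcl _ defT).
have [a Na] := generic_exists Hcl; exists a => //.
by rewrite (_ : range v = set0) //; apply/seteqP; split=> // _ [[]].
Qed.

Lemma transfer_existential (kappa' : Type) (S : structure L) :
  monster kappa' T S -> existential_matroid kappa' (transfer cl S).
Proof.
move=> mS; have kinf' := monster_infinite mS; have [_ ST satS _] := mS.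
have matS := transfer_matroid S.
have defS : definable_matroid (transfer cl S).
  move=> A; apply/seteqP; split=> a [m [phi [b [nphi bA Hphi]]]].
    by exists m, phi, b; split=> // x c Hc; exists m, phi, c; split.
  exact: (transfer_mono bA (nphi _ _ Hphi)).
split=> //.
- move=> a B C sB sC Na.
  have sBC := smallU kinf' sB sC.
  pose incl (x : {x | B x}) : {x | (B `|` C) x} := exist _ (sval x) (or_introl (svalP x)).
  pose F := fun P : ctxrel L (option {x | (B `|` C) x}) => exists P0 : ctxrel L (option {x | B x}),
    [/\ definable P0, P0 S (ocons a sval) & P = fun S w => P0 S (w \o omap incl)].
  have FE (P0 : ctxrel L (option {x | B x})) x :
    P0 S (ocons x sval \o omap incl) = P0 S (ocons x sval) by rewrite ocons_omap.
  have [||||a' [Ha' Na']] := realize_generic ST (saturated_realizes satS sBC) (F := F).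
  + by move=> _ [P0 [defP0 _ ->]]; exact: definable_omap.
  + exists (fun S w => True), (fun S w => True); split => //; exact: definable_cst.
  + move=> _ _ [P0 [defP0 Pa ->]] [P1 [defP1 P1a ->]].
    exists (fun S w => (fun S w => P0 S w /\ P1 S w) S (w \o omap incl)) => //.
    by exists (fun S w => P0 S w /\ P1 S w); split=> //; exact: definable_and.
  + move=> _ [P0 [defP0 Pa ->]].
    apply: (@crit_mono _ R _ _ P0 _ _ sval) => [x|]; first by rewrite FE.
    apply: (crit_of_generic defP0 _ Pa Na).
    by move=> _ [[x Bx] _ <-].
  have range_sval (A : set S) : range (sval : {x | A x} -> S) = A.
    by apply/seteqP; split=> [_ [[x Ax] _ <-]//|x Ax]; exists (exist _ x Ax).
  rewrite range_sval in Na'; exists a' => //.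
  have st (P0 : ctxrel L (option {x | B x})) : definable P0 -> P0 S (ocons a sval) -> P0 S (ocons a' sval).
    move=> defP0 Pa; rewrite -FE.
    by apply: (Ha' (fun S w => P0 S (w \o omap incl))); exists P0.
  exact: same_type_of_definable.
- have s0 : small kappa' (@set0 S) by apply: finite_small => //; exact: finite_set0.
  have [||||a [_ Na]] := realize_generic ST (saturated_realizes satS s0) (F := fun P => P = fun S w => True).
  + by move=> _ ->; exact: definable_cst.
  + by exists (fun S w => True).
  + by move=> _ _ -> ->; exists (fun S w => True).
  + by move=> _ ->; exact: crit_true.
  by move=> H; apply: Na; rewrite H.
Qed.

End Transfer.

(** * Dense sequences *)

Section Expansion.
Variables (L : language) (n : nat).
Local Notation LL := (expansion L n).

Fixpoint lift_term k (t : term L k) : term LL k :=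
  match t with
  | Var i => Var LL i
  | App _ f ts => @App LL k _ f (fun i => lift_term (ts i))
  end.

Fixpoint lift_formula k (phi : formula L k) : formula LL k :=
  match phi with
  | Fls _ => Fls
  | Eq _ t u => Eq (lift_term t) (lift_term u)
  | Atom _ _ r ts => @Atom LL _ _ (OldRel r) (fun i => lift_term (ts i))
  | Imp _ p q => Imp (lift_formula p) (lift_formula q)
  | All _ p => All (lift_formula p)
  end.

Lemma eval_lift (S : structure LL) k (t : term L k) (v : 'I_k -> S) :
  eval v (lift_term t) = @eval L (reduct S) k v t.
Proof.
elim: t => [i //|m f ts IH] /=; congr fint; apply/funext => i; exact: IH.
Qed.

Lemma sat_lift (S : structure LL) k (phi : formula L k) (v : 'I_k -> S) :
  sat (lift_formula phi) v <-> @sat L (reduct S) k phi v.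
Proof.
elim: phi v => {k} [k|k t u|k m r ts|k p IHp q IHq|k p IH] v //=.
- by rewrite !eval_lift.
- suff -> : (fun i => eval v (lift_term (ts i))) = (fun i => @eval L (reduct S) k v (ts i)) by [].
  by apply/funext => i; rewrite eval_lift.
- by rewrite IHp IHq.
- by split=> H a; apply/IH; exact: H.
Qed.

Lemma definable_lift I (P : ctxrel L I) :
  definable P -> @definable LL I (fun S v => P (reduct S) v).
Proof.
move=> [k [phi [e H]]]; exists k, (lift_formula phi), e => S v.
by rewrite sat_lift H.
Qed.

Lemma reduct_elementary (S S' : structure LL) (j : S -> S') :
  elementary_embedding j -> @elementary_embedding L (reduct S) (reduct S') j.
Proof. by move=> H k phi v; rewrite -!sat_lift; exact: H. Qed.

Lemma chain_insub (S : structure LL) i (H : i < n) x :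
  chain S i x = @rint LL S 1 (NewPred (Ordinal H)) (fun=> x).
Proof. by rewrite /chain insubT. Qed.

Lemma chain_last (S : structure LL) i : n <= i -> chain S i = setT.
Proof. by move=> H; rewrite /chain insubF // ltnNge H. Qed.

Lemma definable_chain I i (t : I) :
  @definable LL I (fun S v => chain S i (v t)).
Proof.
have [H|H] := ltnP i n; last first.
  by apply: definable_ext (definable_cst LL I True) => S v; rewrite chain_last.
exists 1, (@Atom LL 1 1 (NewPred (Ordinal H)) (fun=> Var LL ord0)), (fun=> t) => S v.
by rewrite chain_insub.
Qed.

Lemma chain_elementary (S S' : structure LL) (j : S -> S') i x :
  elementary_embedding j -> chain S i x <-> chain S' i (j x).
Proof.
move=> Hj.
exact: (@elementary_definable LL S S' j unit _ (fun=> x) Hj (definable_chain i tt)).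
Qed.

End Expansion.

Lemma theory_of_valid (L : language) (C : structure L -> Prop) (S : structure L) I
    (P : ctxrel L I) :
  model (theory_of C) S -> definable P -> (forall S0, C S0 -> forall v, P S0 v) ->
  forall v, P S v.
Proof.
move=> mS /definable_sentence [s Hs] H; apply/Hs; apply: mS => S0 CS0.
by apply/Hs; exact: H.
Qed.

Lemma elementary_theory_of (L : language) (S S' : structure L) (j : S -> S') :
  elementary_embedding j -> model (theory_of (fun S0 => S0 = S)) S'.
Proof.
move=> Hj s Hs v.
have -> : v = j \o @from_I0 S by apply/funext => i; exact: (from_I0 _ i).
by apply/Hj; exact: Hs.
Qed.

Lemma elementary_inj (L : language) (S S' : structure L) (j : S -> S') :
  elementary_embedding j -> injective j.
Proof.
move=> Hj x y e.
have := elementary_definable (fun b : bool => if b then x else y) Hj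
  (@definable_eq L bool (fun S v => v true) (fun S v => v false) (uterm_var _ _) (uterm_var _ _)).
by move=> ->.
Qed.

Lemma dim_one (X : Type) (cl : set X -> set X) (A : set X) (V : set ('I_1 -> X)) c :
  V c -> ~ cl A (c ord0) -> dim cl A V = Some 1.
Proof.
move=> Vc Nc; rewrite /dim; case: asboolP => [V0|_]; first by move: Vc; rewrite V0.
congr Some; apply/eqP; rewrite eqn_leq; apply/andP; split.
  by apply/bigmax_leqP => i _; rewrite -ltnS.
have rk1 : rk cl A c = 1.
  apply/eqP; rewrite eqn_leq; apply/andP; split.
    by apply/bigmax_leqP => B _; apply: leq_trans (max_card _) _; rewrite card_ord.
  have H : `[< independent_over cl A c [set: 'I_1] >].
    apply/asboolP => i _; rewrite (ord1 i) (_ : _ `|` _ = A) //.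
    apply/seteqP; split=> [x [//|[j /= + _]]|x Ax]; last by left.
    by rewrite !inE (ord1 j) eqxx.
  apply: leq_trans (leq_bigmax_cond _ H).
  by rewrite cardsT card_ord.
have H : `[< exists2 b, V b & rk cl A b = (@Ordinal 2 1 isT) >] by apply/asboolP; exists c.
exact: leq_trans (leq_bigmax_cond _ H).
Qed.

Section DenseModels.
Variables (L : language) (R : ring_symbols L) (T : theory L) (kappa : Type) (M : structure L).
Variable cl : set M -> set M.
Hypothesis compT : complete T.
Hypothesis MT : model T M.
Hypothesis domT : expands_integral_domains R T.
Hypothesis kinf : infinite_set [set: kappa].
Hypothesis Hcl : existential_matroid kappa cl.
Variable n : nat.
Local Notation LL := (expansion L n).

(** The first-order content of [dense_chain]: no monster model is mentioned, and a member is closed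
    in the whole structure, not just in the next member. Every field can be expressed by a set of
    sentences, so it reaches all models of the theory. *)
Record dense_model (S : structure LL) : Prop := DenseModel {
  dm_model : model T (reduct S);
  dm_nested : forall i, i < n -> chain S i `<=` chain S i.+1;
  dm_proper : forall i, i < n -> exists x, chain S i.+1 x /\ ~ chain S i x;
  dm_closed : forall i, i < n -> transfer cl (reduct S) (chain S i) `<=` chain S i;
  dm_dense : forall m (P : ctxrel L (option 'I_m)) (b : 'I_m -> reduct S),
    definable P -> crit R P b -> exists a, chain S 0 a /\ P (reduct S) (ocons a b) }.

Lemma dense_model_theory_of (C : structure LL -> Prop) (S : structure LL) :
  (forall S0, C S0 -> dense_model S0) -> model (theory_of C) S -> dense_model S.
Proof.
move=> HC mS; split.
- move=> s Ts v; apply/sat_lift.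
  have Hs : theory_of C (lift_formula n s).
    by move=> S0 /HC /dm_model /(_ s Ts) Hs w; apply/sat_lift/Hs.
  exact: (mS _ Hs).
- move=> i Hi x.
  apply: (@theory_of_valid _ C S unit (fun S v => chain S i (v tt) -> chain S i.+1 (v tt)) mS _ _ (fun=> x)).
    by apply: definable_imp; apply: definable_chain.
  by move=> S0 /HC H v; apply: dm_nested.
- move=> i Hi.
  apply: (@theory_of_valid _ C S void (fun S v => exists x, chain S i.+1 x /\ ~ chain S i x) mS _ _ (fun x : void => match x with end)).
    apply: (@definable_ex LL); apply: definable_and; first exact: definable_chain.
    by apply: definable_not; exact: definable_chain.
  by move=> S0 /HC H v; apply: dm_proper.
- move=> i Hi x [m [phi [b [nphi bX Hphi]]]].
  have := @theory_of_valid _ C S 'I_m.+1 (fun S v => sat (lift_formula n phi) v ->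
    (forall k, chain S i (v (lift ord0 k))) -> chain S i (v ord0)) mS.
  move=> /(_ _ _ (@scons S x _ b)); rewrite scons0; apply.
  + apply: definable_imp; first exact: (definable_sat _ id).
    by apply: definable_imp; [apply: definable_big_and => k|]; apply: definable_chain.
  + move=> S0 /HC H v /sat_lift Hv vi; apply: (dm_closed H Hi).
    exists m, phi, (fun k => v (lift ord0 k)); split=> //; first by move=> _ [k _ <-].
    move: Hv; congr sat; apply/funext => k.
    by case: (unliftP ord0 k) => [k'|] ->; rewrite ?sconsS ?scons0.
  + by apply/sat_lift.
  + by move=> k; rewrite sconsS; apply: bX; exists k.
- move=> m P b defP.
  apply: (@theory_of_valid _ C S 'I_m (fun S v => @crit L R _ P (reduct S) v ->
    exists a, chain S 0 a /\ P (reduct S) (ocons a v)) mS _ _ b).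
    apply: definable_imp; first exact: (definable_lift _ (definable_crit R defP)).
    apply: (@definable_ex LL); apply: definable_and; first exact: definable_chain.
    apply: definable_ext (definable_lift n defP) => S0 w.
    by rewrite (_ : ocons _ _ = w) //; apply/funext => -[].
  by move=> S0 /HC H v; apply: dm_dense.
Qed.

Lemma dense_model_elementary (S S' : structure LL) (j : S -> S') :
  elementary_embedding j -> dense_model S -> dense_model S'.
Proof.
move=> Hj dS; apply: dense_model_theory_of (elementary_theory_of Hj).
by move=> _ ->.
Qed.

Lemma dense_chain_model (S : structure LL) : dense_chain T cl S -> dense_model S.
Proof.
move=> [ST [kN [N [h [mN Hh HC HD]]]]].
have nested i : i < n -> chain S i `<=` chain S i.+1.
  by move=> /HC [[_ [_ [AB _]]]].
have clos i : i <= n -> transfer cl (reduct S) (chain S i) `<=` chain S i.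
  move=> Hi; rewrite -(subKn Hi); elim: (n - i) (leq_subr i n) => [|k IH] Hk.
    by rewrite subn0 chain_last.
  set l := n - k.+1; have ln : l < n by rewrite /l ltn_subrL; case: (n) Hk.
  have lE : n - k = l.+1 by rewrite /l -subSn // subSS.
  have {}IH := IH (ltnW Hk); rewrite lE in IH.
  move=> a Ha; have [_ _ Hcl'] := HC l ln.
  have Ha' : chain S l.+1 a by apply: IH; apply: transfer_mono Ha; exact: nested.
  have : (h @` chain S l) (h a).
    by rewrite -Hcl'; split; [exact/transfer_elementary|exists a].
  by move=> [x Hx /(elementary_inj Hh) <-].
have [_ NT satN _] := mN.
split=> //.
- move=> i Hi; have [_ ne _] := HC i Hi.
  apply: contrapT => H; apply: ne; apply/seteqP; split; first exact: nested.
  by move=> x Hx; apply: contrapT => Nx; apply: H; exists x.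
- by move=> i /ltnW; exact: clos.
- move=> m P b defP cr; have [phi Hphi] := definable_formula defP.
  suff [a [Ha Ca]] : [set a | sat phi (scons a b)] `&` chain S 0 !=set0.
    by exists a; split=> //; exact/Hphi.
  apply: HD.
  have crN : crit R P (h \o b) by apply/(elementary_definable b Hh (definable_crit R defP)).
  pose A := range (h \o b).
  pose f (i : 'I_m) : {x | A x} := exist _ (h (b i)) (ex_intro2 _ _ i I erefl).
  have sA : small kN A by apply: finite_small; [exact: monster_infinite mN|exact: finite_range].
  (* Saturation of [N] turns [crit] into an actual point of the set outside the closure of the
     parameters, which is what [dim] asks for. *)
  have [||||c [Pc Nc]] := realize_generic compT MT domT kinf Hcl NT (saturated_realizes satN sA) 
     (F := fun P' => P' = fun S0 w => P S0 (w \o omap f)).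
  + by move=> _ ->; exact: definable_omap.
  + by eexists.
  + by move=> _ _ -> ->; eexists.
  + move=> _ ->; apply: (crit_mono _ crN) => x /=.
    by rewrite ocons_omap.
  have := Pc _ erefl; rewrite ocons_omap => /Hphi Hc.
  apply: (@dim_one _ _ _ _ (fun=> c)) => //.
  move=> H; apply: Nc; apply: transfer_mono H => _ [i _ <-].
  by exists (f i).
Qed.

End DenseModels.

(** * Polynomials *)

Section Polynomials.
Variables (L : language) (R : ring_symbols L).

Fixpoint pol (S : structure L) (s : seq S) (x : S) : S :=
  if s is a :: s' then radd R a (rmul R x (pol s' x)) else rzero R S.

(* The coefficients of the quotient of pol s x - pol s c by x - c. *)
Fixpoint pol_quotient (S : structure L) (c : S) (s : seq S) : seq S :=
  match s with
  | [::] => [::]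
  | a :: s' => if s' is [::] then [::] else pol s' c :: pol_quotient c s'
  end.

Fixpoint pol_sub (S : structure L) (s t : seq S) : seq S :=
  match s, t with
  | a :: s', b :: t' => rsub R a b :: pol_sub s' t'
  | _, _ => [::]
  end.

Lemma uterm_pol I (l : seq I) (t : forall S : structure L, (I -> S) -> S) :
  uterm t -> uterm (fun S v => pol (map v l) (t S v)).
Proof.
move=> Ht; elim: l => [|i l IH] /=; first exact: uterm_zero.
by apply: uterm_add; [exact: uterm_var|exact: uterm_mul].
Qed.

Lemma map_nth_enum (X : Type) (x0 : X) (s : seq X) :
  [seq nth x0 s (i : 'I_(size s)) | i <- enum 'I_(size s)] = s.
Proof.
rewrite (map_comp (nth x0 s) val) val_enum_ord; exact: mkseq_nth.
Qed.

Section Domain.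
Variable S : structure L.
Hypothesis dom : is_integral_domain R S.

Add Ring S_ring : (domain_ring_theory dom).

Lemma pol_quotientP (c x : S) s :
  rsub R (pol s x) (pol s c) = rmul R (rsub R x c) (pol (pol_quotient c s) x).
Proof.
elim: s => [|a [|b s] IH] /=; [ring|ring|].
move: IH; set p := pol (b :: s) x; set q := pol (b :: s) c => IH.
rewrite -/(pol (b :: s) x) -/(pol (b :: s) c) -/p -/q.
rewrite -/(pol_quotient c (b :: s)).
have -> : rsub R (radd R a (rmul R x p)) (radd R a (rmul R c q))
        = radd R (rmul R (rsub R x c) q) (rmul R x (rsub R p q)) by ring.
by rewrite IH; ring.
Qed.

Lemma pol_subP (x : S) s t : size s = size t ->
  pol (pol_sub s t) x = rsub R (pol s x) (pol t x).
Proof.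
elim: s t => [|a s IH] [|b t] //=; first by move=> _; ring.
by move=> [/IH ->]; ring.
Qed.

Definition all_zero (s : seq S) := forall x, List.In x s -> x = rzero R S.

Lemma pol_all_zero s x : all_zero s -> pol s x = rzero R S.
Proof.
elim: s => //= a s IH H; rewrite IH; last by move=> y sy; apply: H; right.
by rewrite (H a); [ring|left].
Qed.

Lemma pol_sub_all_zero s t : size s = size t -> all_zero (pol_sub s t) -> s = t.
Proof.
elim: s t => [|a s IH] [|b t] //= [e] H.
rewrite (IH t) // => [|x Hx]; last by apply: H; right.
by congr cons; apply: (rsub_eq0 dom); apply: H; left.
Qed.

(** The argument goes down from the top degree: once the higher coefficients vanish, the coefficient
    [pol] s' [c] of the quotient is just the constant term of s'. *)
Lemma pol_quotient_all_zero (c : S) s :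
  all_zero (pol_quotient c s) -> all_zero (behead s).
Proof.
elim: s => [|a [|b s] IH] //= H.
have H1 : all_zero s.
  by apply: IH => x Hx; apply: H; right.
move=> x [<-|]; last exact: H1.
have := H _ (or_introl erefl); rewrite (pol_all_zero c H1) => <-; ring.
Qed.

End Domain.
End Polynomials.

Section PolynomialRoots.
Variables (L : language) (R : ring_symbols L) (kappa : Type) (M : structure L).
Variable cl : set M -> set M.
Hypothesis dom : is_integral_domain R M.
Hypothesis kinf : infinite_set [set: kappa].
Hypothesis Hcl : existential_matroid kappa cl.

Local Notation mat := (existential_mat Hcl).

Add Ring M_ring : (domain_ring_theory dom).

Lemma uterm_cl I (v : I -> M) (t : forall S : structure L, (I -> S) -> S) :
  uterm t -> cl (range v) (t M v).
Proof.
move=> [n [s [e H]]].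
apply: (@cl_mono _ _ mat (range (v \o e))); first by move=> _ [i _ <-]; exists (e i).
rewrite H; apply: (@functional_cl L kappa M cl kinf Hcl _
  (fun S w => w None = eval (w \o some) s)) => //.
by apply: definable_eq; [exact: uterm_var|exact: uterm_eval].
Qed.

Lemma fma_cl A a x y : cl A a -> cl A x -> cl A y -> cl A (radd R a (rmul R x y)).
Proof.
move=> Ha Hx Hy.
pose v (b : option bool) := match b with None => a | Some true => x | Some false => y end.
have := @uterm_cl _ v (fun S w => radd R (w None) (rmul R (w (Some true)) (w (Some false)))).
move=> H; apply: (cl_sub mat _ (H _)); first by move=> _ [[[|]|] _ <-].
by apply: uterm_add; [|apply: uterm_mul]; exact: uterm_var.
Qed.

Lemma rsub_cl A x y : cl A x -> cl A y -> cl A (rsub R x y).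
Proof.
move=> Hx Hy.
apply: (@cl_sub _ _ mat [set y; x]); first by move=> _ [|] ->.
pose v (b : bool) := if b then x else y.
apply: (@cl_mono _ _ mat (range v)).
  by move=> _ [[|] _ <-]; [right|left].
apply: (@functional_cl L kappa M cl kinf Hcl _
  (fun S w => radd R (w None) (w (Some false)) = w (Some true))) => /=.
- by apply: definable_eq; [apply: uterm_add|]; exact: uterm_var.
- by move=> z <-; ring.
- by ring.
Qed.

Lemma pol_cl A s x : listed s `<=` cl A -> cl A x -> cl A (pol R s x).
Proof.
move=> sA Hx; elim: s sA => [|a s IH] sA /=.
  apply: (cl_mono mat (@sub0set _ A)).
  apply: (@cl_mono _ _ mat (range (fun x : void => match x return M with end))); first by move=> _ [[]].
  exact: (uterm_cl _ (uterm_zero R void)).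
apply: fma_cl => //; first by apply: sA; left.
by apply: IH => y sy; apply: sA; right.
Qed.

Lemma pol_quotient_cl A (c : M) s : listed s `<=` cl A -> cl A c ->
  listed (pol_quotient R c s) `<=` cl A.
Proof.
move=> + Hc; elim: s => [|a [|b s] IH] sA; [by move=> y []|by move=> y []|].
have sA' : listed (b :: s) `<=` cl A by move=> y sy; apply: sA; right.
move=> y [<-|]; last exact: IH.
exact: (pol_cl sA' Hc).
Qed.

Lemma pol_sub_cl A s t : listed s `<=` cl A -> listed t `<=` cl A ->
  listed (pol_sub R s t) `<=` cl A.
Proof.
elim: s t => [|a s IH] [|b t] sA tA y //= [<-|].
  by apply: rsub_cl; [apply: sA|apply: tA]; left.
by apply: IH => z Hz; [apply: sA|apply: tA]; right.
Qed.

Lemma listed_cat (X : Type) (s t : seq X) : listed (s ++ t) = listed s `|` listed t.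
Proof. by apply/seteqP; split=> x; move/List.in_app_iff. Qed.

(** A conjugate [x'] of [x] is another root, so [x] is a root of the quotient by X - [x']. The
    quotient has lower degree and coefficients in the closure of [t] and [x'], over which [x] is
    still generic. The list [t] is kept apart from [s] so that it can grow with these
    coefficients. *)
Lemma root_cl k s t (x : M) : size s <= k -> listed s `<=` listed t ->
  pol R s x = rzero R M -> ~ cl (listed t) x -> all_zero R s.
Proof.
elim: k s t x => [|k IH] [|a s] t x sk st Hx Nx;
  [by move=> y []|by []|by move=> y []|].
have [x' stx Nx'] := generic_conjugate kinf Hcl (listed_finite t) (finite_set1 x) Nx.
have Hx' : pol R (a :: s) x' = rzero R M.
  pose v (i : 'I_(size (a :: s))) := nth a (a :: s) i.
  pose P : ctxrel L (option 'I_(size (a :: s))) := fun S w =>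
    pol R (map w [seq Some i | i <- enum 'I_(size (a :: s))]) (w None) = rzero R S.
  have PE y : P M (ocons y v) <-> pol R (a :: s) y = rzero R M.
    rewrite /P -map_comp (_ : ocons y v \o some = v); last exact: funext.
    by rewrite (map_nth_enum a (a :: s)).
  apply/PE; apply: (same_type_definable stx _ _ _); last exact/PE.
    move=> _ [i _ <-]; apply: st; rewrite /v.
    elim: (a :: s) (i) => [|b s' IH'] [[|j] Hj] //=; first by left.
    by right; exact: (IH' (Ordinal (Hj : j < size s'))).
  apply: definable_eq; last exact: uterm_zero.
  by apply: (uterm_pol _ _ (uterm_var _ _)).
have xx' : x <> x'.
  by move=> e; apply: Nx'; apply: (cl_in mat); right.
have Hq : pol R (pol_quotient R x' (a :: s)) x = rzero R M.
  have := pol_quotientP dom x' x (a :: s); rewrite Hx' Hx => e.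
  have {}e : rmul R (rsub R x x') (pol R (pol_quotient R x' (a :: s)) x) = rzero R M.
    by rewrite -e; ring.
  by have [/(rsub_eq0 dom)|] := rmul_eq0 dom e.
set q := pol_quotient R x' (a :: s) in Hq.
have qcl : listed q `<=` cl (listed t `|` [set x']).
  apply: pol_quotient_cl; last by apply: (cl_in mat); right.
  by move=> y /st ty; apply: (cl_in mat); left.
have Nq : ~ cl (listed (q ++ t)) x.
  rewrite listed_cat => H; apply: Nx'.
  apply: (cl_exchange mat) Nx; apply: (cl_sub mat _ H) => y [/qcl //|ty].
  by apply: (cl_in mat); left.
have sz_q : size q <= k.
  suff -> : size q = size s by [].
  by rewrite /q; elim: (s) (a) => [|b s' IH'] c //=; rewrite -(IH' b).
have /(pol_quotient_all_zero dom) zs : all_zero R q.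
  by apply: (IH q (q ++ t) x) => //; rewrite listed_cat; left.
move=> y [<-|]; last exact: zs.
have H : pol R s x = rzero R M := pol_all_zero dom x zs.
by move: Hx; rewrite /= H => Hx; rewrite -[RHS]Hx; ring.
Qed.

(** The point is a root of the difference of the two polynomials, which is not zero. Later this
    recovers b from two expressions of one element as a polynomial in b. *)
Lemma pol_inj_narrow N :
  narrow_in cl (fun S (w : option ('I_N + 'I_N) -> S) =>
   (pol R [seq w (Some (inl i)) | i <- enum 'I_N] (w None) =
    pol R [seq w (Some (inr i)) | i <- enum 'I_N] (w None)) /\
   exists i, w (Some (inl i)) <> w (Some (inr i))).
Proof.
split.
  apply: definable_and.
    apply: (@definable_ext _ _ (fun S (w : option ('I_N + 'I_N) -> S) =>
   (pol R (map w [seq (Some (inl i)) | i <- enum 'I_N]) (w None) =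
    pol R (map w [seq (Some (inr i)) | i <- enum 'I_N]) (w None)))).
      by move=> S w; rewrite -!map_comp.
    by apply: definable_eq; apply: uterm_pol; exact: uterm_var.
  by apply: definable_big_or => i; apply/definable_not/definable_eq; exact: uterm_var.
move=> x b [e [i Hi]]; apply: contrapT => Nx; apply: Hi.
pose s := [seq b (inl i) | i <- enum 'I_N]; pose t := [seq b (inr i) | i <- enum 'I_N].
have {}e : pol R s x = pol R t x := e.
have sz : size s = size t by rewrite !size_map.
have inb (f : 'I_N -> 'I_N + 'I_N) : listed [seq b (f j) | j <- enum 'I_N] `<=` range b.
  by elim: (enum 'I_N) => //= j l IH y [<-|/IH]; [exists (f j)|].
have scl := pol_sub_cl (subset_trans (inb inl) (cl_in mat (A := range b)))
  (subset_trans (inb inr) (cl_in mat (A := range b))).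
have zs : all_zero R (pol_sub R s t).
  apply: (@root_cl _ _ (pol_sub R s t ++ s ++ t) x (leqnn _)).
  - by rewrite listed_cat; left.
  - by rewrite (pol_subP dom) // e; ring.
  move=> H; apply: Nx; apply: (cl_sub mat _ H); rewrite !listed_cat => y [|[]].
  - exact: scl.
  - by move=> /(inb inl); exact: (cl_in mat).
  - by move=> /(inb inr); exact: (cl_in mat).
have st := pol_sub_all_zero dom sz zs.
by move/eq_in_map: st => /(_ i); apply; rewrite mem_enum.
Qed.

End PolynomialRoots.

(** * Far points *)

Section Levels.
Variables (L : language) (R : ring_symbols L) (T : theory L) (kappa : Type) (M : structure L).
Variable cl : set M -> set M.
Hypothesis compT : complete T.
Hypothesis MT : model T M.
Hypothesis domT : expands_integral_domains R T.
Hypothesis kinf : infinite_set [set: kappa].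
Hypothesis Hcl : existential_matroid kappa cl.
Variable n : nat.
Local Notation LL := (expansion L n).
Local Notation dense := (dense_model R T cl).

Definition clos (S : structure LL) : set (reduct S) -> set (reduct S) :=
  transfer cl (reduct S).

Lemma clos_matroid (S : structure LL) : matroid (@clos S).
Proof. exact: (transfer_matroid MT domT kinf Hcl). Qed.
Local Notation matS := clos_matroid.

(* [lev S 0] is empty and [lev S i.+1] is the i-th member of the chain. *)
Definition lev (S : structure LL) (i : nat) : set (reduct S) :=
  if i is i'.+1 then chain S i' else set0.

Arguments lev : clear implicits.

Lemma lev_last (S : structure LL) : lev S n.+1 = setT.
Proof. exact: chain_last. Qed.

Lemma lev_mono (S : structure LL) i k : dense S -> i <= k -> lev S i `<=` lev S k.
Proof.
move=> dS; elim: k => [|k IH]; first by rewrite leqn0 => /eqP ->.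
rewrite leq_eqVlt => /orP [/eqP -> //|]; rewrite ltnS => /IH H x /H.
case: k {IH H} => //= k; have [kn|nk] := ltnP k n; first exact: (dm_nested dS kn).
by rewrite (@chain_last _ _ S k.+1) // ltnW.
Qed.

Lemma lev_closed (S : structure LL) i : dense S -> clos (lev S i.+1) `<=` lev S i.+1.
Proof.
move=> dS /=; have [H|H] := ltnP i n; first exact: (dm_closed dS H).
by rewrite chain_last.
Qed.

Lemma definable_lev I i (t : I) : @definable LL I (fun S v => lev S i (v t)).
Proof. by case: i => [|i]; [exact: definable_fls|exact: definable_chain]. Qed.

Lemma lev_elementary (S S' : structure LL) (j : S -> S') i x :
  elementary_embedding j -> lev S i x <-> lev S' i (j x).
Proof. by case: i => [|i] Hj //=; exact: chain_elementary. Qed.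

Lemma dense_exists (S : structure LL) I (P : ctxrel L (option I)) (v : I -> reduct S) :
  dense S -> definable P -> crit R P v ->
  exists a, chain S 0 a /\ P (reduct S) (ocons a v).
Proof.
move=> dS /definable_finite [m [Q [e [defQ HQ]]]].
rewrite (@crit_finite _ R _ _ P Q e); last by move=> x; exact: HQ.
by move=> /(dm_dense dS defQ) [a [Ca Qa]]; exists a; split=> //; exact/HQ.
Qed.

Lemma transfer_uterm (S : structure L) I (v : I -> S)
    (t : forall S : structure L, (I -> S) -> S) :
  uterm t -> transfer cl S (range v) (t S v).
Proof.
move=> [k [s [e H]]]; rewrite H.
apply: (@transfer_mono _ _ _ _ (range (v \o e))); first by move=> _ [i _ <-]; exists (e i).
apply: (@transfer_intro _ _ _ _ Hcl _ _ (fun S w => w None = eval (w \o some) s) (v \o e)) => //.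
apply: (functional_narrow kinf Hcl).
  by apply: definable_eq; [exact: uterm_var|exact: uterm_eval].
by move=> a a' b /= -> ->.
Qed.

(* The element w None is not in Q(b) for any tuple b whose entries are
   parameters, as prescribed by f, or else arbitrary elements of level i. *)
Definition away i m (Q : ctxrel L (option 'I_m)) I (f : 'I_m -> option I) :
    ctxrel LL (option I) := fun S w =>
  forall b : 'I_m -> S,
    (forall k, if f k is Some t then b k = w (Some t) else lev S i (b k)) ->
    ~ Q (reduct S) (ocons (w None) b).

Lemma definable_away i m (Q : ctxrel L (option 'I_m)) I (f : 'I_m -> option I) :
  definable Q -> definable (away i Q f).
Proof.
move=> defQ; apply: definable_all_block; apply: definable_imp.
  apply: definable_big_and => k; case: (f k) => [t|]; last exact: definable_lev.
  by apply: definable_eq; exact: uterm_var.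
apply: definable_not.
apply: (@definable_env LL _ _ _ (fun x => if x is Some k then inl k else inr None)
  _ (definable_lift n defQ)).
by move=> S v [].
Qed.

Lemma away_intro (S : structure LL) I (u : I -> S) i m (Q : ctxrel L (option 'I_m))
    (f : 'I_m -> option I) a :
  narrow_in cl Q -> ~ clos (range u `|` lev S i) a -> away i Q f (ocons a u).
Proof.
move=> nQ Na b Hb Qb; apply: Na; apply: (transfer_intro Hcl nQ _ Qb).
move=> _ [k _ <-]; have := Hb k; case: (f k) => [t ->|]; last by right.
by left; exists t.
Qed.

(** Together with [away_intro], this makes the formulas [away] for narrow Q an axiomatization of
    being outside the closure of the parameters and level [i]. Level 0 is empty, so there every
    entry is a prescribed one. *)
Lemma away_elim (S : structure LL) I (u : I -> S) i a :
  clos (range u `|` lev S i) a ->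
  exists m (Q : ctxrel L (option 'I_m)) (f : 'I_m -> option I),
    [/\ narrow_in cl Q, (i = 0 -> forall k, f k <> None) & ~ away i Q f (ocons a u)].
Proof.
move=> /transfer_elim [m [Q [b [nQ bX Qb]]]].
have cb k : exists o : option I, if o is Some t then u t = b k else lev S i (b k).
  have [|[t _ ut]|lb] := bX (b k); first by exists k.
    by exists (Some t).
  by exists None.
pose f k := projT1 (cid (cb k)); have fP k := projT2 (cid (cb k)).
rewrite -/(f _) in fP.
exists m, Q, f; split=> //.
  by move=> i0 k fk; move: (fP k); rewrite -/(f k) fk i0.
move=> H; apply: (H b _ Qb) => k; move: (fP k); rewrite -/(f k).
by case: (f k) => [t <-|].
Qed.

(** Level [i] of [S'] may be larger than the image of level [i] of [S]. The parameters taken from it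
    are quantified over in [away], a formula over [X] and [a] alone, so it passes to [S']. *)
Lemma clos_lev_elementary (S S' : structure LL) (j : S -> S') X i a :
  elementary_embedding j ->
  clos (j @` X `|` lev S' i) (j a) <-> clos (X `|` lev S i) a.
Proof.
move=> Hj; split; last first.
  move=> /(transfer_elementary cl _ _ (reduct_elementary Hj)).
  apply: transfer_mono => _ [x [Xx|lx] <-]; first by left; exists x.
  by right; apply/(lev_elementary _ _ Hj).
have eX : j @` X = range (fun x : {x | X x} => j (sval x)).
  apply/seteqP; split=> [_ [x Xx <-]|_ [[x Xx] _ <-]]; first by exists (exist _ x Xx).
  by exists x.
rewrite eX => /away_elim [m [Q [f [nQ _ H]]]]; apply: contrapT => Na; apply: H.
have := @away_intro S {x | X x} (fun x => sval x) i m Q f a nQ.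
have -> : range (sval : {x | X x} -> S) = X.
  by apply/seteqP; split=> [_ [[x Xx] _ <-]//|x Xx]; exists (exist _ x Xx).
move=> /(_ Na) /(elementary_definable _ Hj (definable_away i f nQ.1)).
by rewrite comp_ocons.
Qed.

Lemma good_elementary (S S' : structure LL) (j : S -> S') A i :
  elementary_embedding j -> good (@clos S) A (lev S i) ->
  good (@clos S') (j @` A) (lev S' i).
Proof.
move=> Hj [A0 [A0A AA0 indA0]]; exists (j @` A0); split.
- by move=> _ [x A0x <-]; exists x => //; exact: A0A.
- move=> _ [x /AA0 Hx <-].
  have := (transfer_elementary cl _ x (reduct_elementary Hj)).2 Hx.
  apply: transfer_mono => _ [y [A0y|[Ay ly]] <-]; first by left; exists y.
  by right; split; [exists y|apply/(lev_elementary _ _ Hj)].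
move=> _ [a A0a <-] Ha; apply: (indA0 a A0a).
apply/(clos_lev_elementary _ _ _ Hj); apply: transfer_mono Ha.
move=> z [[[x A0x <-] xa]|lx]; [left|by right].
by exists x => //; split=> // xa'; apply: xa; rewrite xa'.
Qed.

End Levels.

Arguments lev {L n} S i.

Lemma elementary_comp (L : language) (S1 S2 S3 : structure L) (j : S1 -> S2) (k : S2 -> S3) :
  elementary_embedding j -> elementary_embedding k -> elementary_embedding (k \o j).
Proof. by move=> Hj Hk m phi v; rewrite (Hj m phi v) (Hk m phi (j \o v)). Qed.

Lemma listed_codom (X : Type) m (g : 'I_m -> X) :
  listed [seq g k | k <- enum 'I_m] = range g.
Proof.
apply/seteqP; split=> x.
  by elim: (enum 'I_m) => //= k s IH [<-|/IH]; [exists k|].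
move=> [k _ <-]; have : k \in enum 'I_m by rewrite mem_enum.
elim: (enum 'I_m) => //= l s IH; rewrite inE => /orP [/eqP ->|/IH]; first by left.
by right.
Qed.

Lemma listed_nth (X : Type) (x0 x : X) s : listed s x ->
  exists l : 'I_(size s), nth x0 s l = x.
Proof.
elim: s => //= y s IH [->|/IH [l Hl]]; first by exists ord0.
by exists (lift ord0 l).
Qed.

Section Far.
Variables (L : language) (R : ring_symbols L) (T : theory L) (kappa : Type) (M : structure L).
Variable cl : set M -> set M.
Hypothesis compT : complete T.
Hypothesis MT : model T M.
Hypothesis domT : expands_integral_domains R T.
Hypothesis kinf : infinite_set [set: kappa].
Hypothesis Hcl : existential_matroid kappa cl.
Variable n : nat.
Local Notation LL := (expansion L n).
Local Notation dense := (dense_model R T cl).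
Local Notation clos := (@clos L M cl n).
Local Notation matS := (clos_matroid MT domT kinf Hcl).

(** This is finite satisfiability for far points: by compactness it yields, in an elementary
    extension, a point of level [i.+1] which realizes a given L-type of dimension 1 outside the
    closure of the parameters and level [i]. *)
Definition far_claim i := forall (S : structure LL), dense S ->
  forall I (u : I -> S) (P : ctxrel L (option I)) m (Q : ctxrel L (option 'I_m))
    (f : 'I_m -> option I),
    definable P -> @crit L R _ P (reduct S) u -> narrow_in cl Q ->
    (i = 0 -> forall k, f k <> None) ->
    exists x, [/\ lev S i.+1 x, P (reduct S) (ocons x u) & away i Q f (ocons x u)].

Lemma away_or i I m1 m2 (Q1 : ctxrel L (option 'I_m1)) (Q2 : ctxrel L (option 'I_m2))
    (f1 : 'I_m1 -> option I) (f2 : 'I_m2 -> option I) :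
  narrow_in cl Q1 -> narrow_in cl Q2 ->
  (i = 0 -> forall k, f1 k <> None) -> (i = 0 -> forall k, f2 k <> None) ->
  exists m (Q : ctxrel L (option 'I_m)) (f : 'I_m -> option I),
    [/\ narrow_in cl Q, (i = 0 -> forall k, f k <> None) &
      forall (S : structure LL) (u : I -> S) c, dense S ->
        away i Q f (ocons c u) -> away i Q1 f1 (ocons c u) /\ away i Q2 f2 (ocons c u)].
Proof.
move=> nQ1 nQ2 f10 f20.
pose Q : ctxrel L (option 'I_(m1 + m2)) := fun S w =>
  Q1 S (w \o omap (lshift m2)) \/ Q2 S (w \o omap (@rshift m1 m2)).
pose f k := match fintype.split k with inl a => f1 a | inr a => f2 a end.
exists (m1 + m2), Q, f; split.
- have [d1 n1] := narrow_sub Hcl (lshift m2) nQ1.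
  have [d2 n2] := narrow_sub Hcl (@rshift m1 m2) nQ2.
  by split; [exact: definable_or|move=> c b [/n1|/n2]].
- by move=> i0 k; rewrite /f; case: fintype.split => l; [exact: f10|exact: f20].
move=> S u c dS ac.
(* The joint formula quantifies over the entries of both tuples at once, so to refute one of the two
   formulas the free entries of the other need some value in level [i]. For [i] = 0 there are no
   free entries. *)
have [x0 Hx0] : exists x0, 0 < i -> lev S i x0.
  have [x0 [Hx0 _]] := dense_exists dS (definable_cst L _ True)
    (crit_true compT MT domT kinf Hcl (fun x : reduct S => x) (dm_model dS)).
  by exists x0 => i0; apply: (lev_mono dS i0).
pose d m' (f' : 'I_m' -> option I) k := if f' k is Some t then u t else x0.
have dP m' (f' : 'I_m' -> option I) : (i = 0 -> forall k, f' k <> None) -> forall k,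
    if f' k is Some t then d m' f' k = ocons c u (Some t) else lev S i (d m' f' k).
  move=> f'0 k; rewrite /d; case E: (f' k) => [t //|]; apply: Hx0.
  by rewrite lt0n; apply/eqP => i0; exact: (f'0 i0 k).
split=> b Hb Qb.
  apply: (ac (fun k => match fintype.split k with inl l => b l | inr l => d _ f2 l end)).
    by move=> k; rewrite /f; case: (fintype.split k) => l; [exact: Hb|exact: dP].
  left; rewrite ocons_omap; move: Qb; congr (Q1 _ (ocons _ _)).
  by apply/funext => l /=; rewrite (unsplitK (inl l)).
apply: (ac (fun k => match fintype.split k with inl l => d _ f1 l | inr l => b l end)).
  by move=> k; rewrite /f; case: (fintype.split k) => l; [exact: dP|exact: Hb].
right; rewrite ocons_omap; move: Qb; congr (Q2 _ (ocons _ _)).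
by apply/funext => l /=; rewrite (unsplitK (inr l)).
Qed.

Lemma realize_far (S S' : structure LL) I (u : I -> S) (u' : I -> S') i
    (G : ctxrel LL (option I) -> Prop) :
  dense S -> realizes u u' ->
  (forall P, G P -> definable P) -> (exists P, G P) ->
  (forall P Q, G P -> G Q -> exists2 Q', G Q' & forall a,
     Q' S (ocons a u) -> P S (ocons a u) /\ Q S (ocons a u)) ->
  (forall P m (Q : ctxrel L (option 'I_m)) (f : 'I_m -> option I), G P -> narrow_in cl Q ->
    (i = 0 -> forall k, f k <> None) ->
    exists x, P S (ocons x u) /\ away i Q f (ocons x u)) ->
  exists a, (forall P, G P -> P S' (ocons a u')) /\ ~ clos (range u' `|` lev S' i) a.
Proof.
move=> dS Hr defG neG dirG farG.
pose Sigma (Z : ctxrel LL (option I)) := exists P m (Q : ctxrel L (option 'I_m))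
  (f : 'I_m -> option I), [/\ G P, narrow_in cl Q, i = 0 -> forall k, f k <> None &
    Z = fun S0 w => P S0 w /\ away i Q f w].
have nfls : narrow_in cl (fun S (w : option 'I_0 -> S) => False).
  by split=> //; exact: definable_fls.
have [||||a Ha] := Hr Sigma.
- move=> _ [P [m [Q [f [GP nQ _ ->]]]]].
  by apply: definable_and; [exact: defG|exact: definable_away nQ.1].
- have [P GP] := neG.
  eexists; exists P, 0, (fun S w => False), (@from_I0 _); split; [done|done| |reflexivity].
  by move=> _ k; exact: (from_I0 _ k).
- move=> _ _ [P1 [m1 [Q1 [f1 [GP1 nQ1 f10 ->]]]]] [P2 [m2 [Q2 [f2 [GP2 nQ2 f20 ->]]]]].
  have [P GP PP] := dirG _ _ GP1 GP2.
  have [m [Q [f [nQ f0 QQ]]]] := away_or nQ1 nQ2 f10 f20.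
  exists (fun S0 w => P S0 w /\ away i Q f w); first by exists P, m, Q, f.
  by move=> c [/PP [Pc1 Pc2] /(QQ _ _ _ dS) [ac1 ac2]].
- by move=> _ [P [m [Q [f [GP nQ f0 ->]]]]]; exact: farG.
have Ha' P m (Q : ctxrel L (option 'I_m)) f : G P -> narrow_in cl Q ->
    (i = 0 -> forall k, f k <> None) -> P S' (ocons a u') /\ away i Q f (ocons a u').
  move=> GP nQ f0; apply: (Ha (fun S0 w => P S0 w /\ away i Q f w)).
  by exists P, m, Q, f.
exists a; split.
  by move=> P GP; have [] := Ha' P 0 _ (@from_I0 _) GP nfls (fun _ k => from_I0 _ k).
move=> /away_elim [m [Q [f [nQ f0 H]]]]; apply: H.
by have [P GP] := neG; have [_] := Ha' P m Q f GP nQ f0.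
Qed.

Lemma far_extension i : far_claim i -> forall (S : structure LL), dense S ->
  forall F : ctxrel L (option S) -> Prop,
  (forall P, F P -> definable P) -> (exists P, F P) ->
  (forall P Q, F P -> F Q -> exists2 Q', F Q' & forall a : S,
     Q' (reduct S) (ocons a (fun x => x)) ->
     P (reduct S) (ocons a (fun x => x)) /\ Q (reduct S) (ocons a (fun x => x))) ->
  (forall P, F P -> @crit L R _ P (reduct S) (fun x => x)) ->
  exists (S' : structure LL) (j : S -> S') (a : S'),
    [/\ elementary_embedding j, dense S',
        forall P, F P -> P (reduct S') (ocons a j),
        lev S' i.+1 a & ~ clos (range j `|` lev S' i) a].
Proof.
move=> claim S dS F defF neF dirF crF.
have [S' [j [Hj Hr]]] := realizing_extension S.
pose G (Z : ctxrel LL (option S)) := exists2 P, F P &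
  Z = fun S0 w => P (reduct S0) w /\ lev S0 i.+1 (w None).
have [||||a [Ha Na]] := realize_far (i := i) dS Hr (G := G).
- move=> _ [P FP ->]; apply: definable_and; first exact: definable_lift (defF _ FP).
  exact: definable_lev.
- by have [P FP] := neF; eexists; exists P.
- move=> _ _ [P1 FP1 ->] [P2 FP2 ->]; have [P FP PP] := dirF _ _ FP1 FP2.
  exists (fun S0 w => P (reduct S0) w /\ lev S0 i.+1 (w None)); first by exists P.
  by move=> c [/PP [Pc1 Pc2]].
- move=> _ m Q f [P FP ->] nQ f0.
  have [x [lx Px ax]] := claim S dS S (fun x => x) P m Q f (defF _ FP) (crF _ FP) nQ f0.
  by exists x.
have Ha' P : F P -> P (reduct S') (ocons a j) /\ lev S' i.+1 a.
  by move=> FP; apply: (Ha (fun S0 w => P (reduct S0) w /\ lev S0 i.+1 (w None))); exists P.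
exists S', j, a; split=> //.
- exact: dense_model_elementary Hj dS.
- by move=> P /Ha' [].
by have [P /Ha' []] := neF.
Qed.

(** Level 0 is empty, so all entries of Q are parameters. The set P without the fibre of Q still has
    dimension 1, and density gives a point of it. *)
Lemma far_claim0 : far_claim 0.
Proof.
move=> S dS I u P m Q f defP crP nQ f0.
have fS k : exists t, f k = Some t.
  by case E: (f k) => [t|]; [exists t|case: (f0 erefl k)].
pose g k := projT1 (cid (fS k)); have gP k : f k = Some (g k) := projT2 (cid (fS k)).
pose PQ : ctxrel L (option (I + 'I_m)) := fun S w =>
  P S (w \o omap inl) /\ ~ Q S (w \o omap inr).
have defPQ : definable PQ.
  by apply: definable_and; [|apply: definable_not]; apply: definable_omap => //; exact: nQ.1.
have [|x [Cx]] := @dense_exists _ _ _ _ _ _ _ _ PQ (scat u (u \o g)) dS defPQ.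
  apply: (crit_avoid compT MT domT kinf Hcl (dm_model dS) defP nQ crP (d := u \o g)) => a Pa Qa.
  by rewrite /PQ !ocons_omap.
rewrite /PQ !ocons_omap => -[Px Qx]; exists x; split=> // b Hb.
have -> : b = u \o g by apply/funext => k; have := Hb k; rewrite gP.
exact: Qx.
Qed.

Lemma ind_extension N (S : structure LL) : dense S ->
  exists (S' : structure LL) (j : S -> S') (s : seq S'),
    [/\ elementary_embedding j, dense S', size s = N, listed s `<=` chain S' 0 &
        ind (clos (S := S')) (range j) s].
Proof.
elim: N S => [|N IH] S dS.
  by exists S, (fun x => x), [::]; split=> // x [].
have [||||S1 [j1 [e [Hj1 dS1 _ le Ne]]]] := @far_extension 0 far_claim0 S dS (fun P => P = fun S w => True).
- by move=> _ ->; exact: definable_cst.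
- by eexists.
- by move=> _ _ -> ->; eexists.
- by move=> _ ->; apply: (crit_true compT MT domT kinf Hcl); exact: dm_model dS.
have [S2 [j2 [s [Hj2 dS2 sN sC Hs]]]] := IH S1 dS1.
exists S2, (j2 \o j1), (j2 e :: s); split=> //=.
- exact: elementary_comp.
- by rewrite sN.
- by move=> x [<-|/sC //]; apply/(chain_elementary _ _ Hj2).
split.
  rewrite /= -(image_comp j1 j2).
  by move/(transfer_elementary cl _ _ (reduct_elementary Hj2)); move: Ne; rewrite setU0.
apply: (ind_sub (matS S2)) Hs => x [[y _ <-]|->]; apply: (cl_in (matS S2)); last by exists e.
by exists (j1 y).
Qed.

Lemma lev_fma (S : structure LL) i a x y : dense S ->
  lev S i.+1 a -> lev S i.+1 x -> lev S i.+1 y ->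
  lev S i.+1 (@radd L R (reduct S) a (rmul R x y)).
Proof.
move=> dS la lx ly; apply: (lev_closed dS).
pose v (b : option bool) := match b with None => a | Some true => x | Some false => y end.
apply: (@transfer_mono _ _ _ _ (range v)); first by move=> _ [[[]|] _ <-].
apply: (transfer_uterm kinf Hcl (S := reduct S) v
  (t := fun S w => radd R (w None) (rmul R (w (Some true)) (w (Some false))))).
by apply: uterm_add; [|apply: uterm_mul]; exact: uterm_var.
Qed.

Lemma lev_pol (S : structure LL) i (s : seq S) x : dense S ->
  listed s `<=` lev S i.+1 -> lev S i.+1 x -> lev S i.+1 (@pol L R (reduct S) s x).
Proof.
move=> dS + lx; elim: s => [|a s IH] sl /=.
  apply: (lev_closed dS).
  apply: (@transfer_mono _ _ _ _ (range (fun y : void => match y return reduct S with end))).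
    by move=> _ [[]].
  exact: (transfer_uterm kinf Hcl (S := reduct S) _ (uterm_zero R void)).
apply: (lev_fma dS) => //; first by apply: sl; left.
by apply: IH => y sy; apply: sl; right.
Qed.

End Far.

Lemma nth_listed (X : Type) (x0 : X) s (l : 'I_(size s)) : listed s (nth x0 s l).
Proof.
elim: s l => [|a s IH] [[|l] Hl] //=; first by left.
by right; exact: (IH (Ordinal (Hl : l < size s))).
Qed.

Section Shift.
Variables (L : language) (R : ring_symbols L) (S : structure L).
Hypothesis dom : is_integral_domain R S.

Add Ring S_ring : (domain_ring_theory dom).

Lemma rsubK (x e : S) : radd R (rsub R x e) e = x.
Proof. ring. Qed.

Lemma shift_equation (z x1 x2 x3 x4 e : S) :
  radd R (rmul R z x1) x4 = radd R (rmul R z x2) x3 ->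
  radd R (rmul R z (rsub R x1 e)) (rsub R x4 e) =
  radd R (rmul R z (rsub R x2 e)) (rsub R x3 e).
Proof.
move=> E.
have -> : radd R (rmul R z (rsub R x1 e)) (rsub R x4 e) =
  rsub R (rsub R (radd R (rmul R z x1) x4) (rmul R z e)) e by ring.
by rewrite E; ring.
Qed.

End Shift.

(** * A level is not covered by narrow fibres over the previous one *)

Section Core.
Variables (L : language) (R : ring_symbols L) (T : theory L) (kappa : Type) (M : structure L).
Variable cl : set M -> set M.
Hypothesis compT : complete T.
Hypothesis MT : model T M.
Hypothesis domT : expands_integral_domains R T.
Hypothesis kinf : infinite_set [set: kappa].
Hypothesis Hcl : existential_matroid kappa cl.
Variable n : nat.
Local Notation LL := (expansion L n).
Local Notation dense := (dense_model R T cl).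
Local Notation clos := (@clos L M cl n).
Local Notation matS := (clos_matroid MT domT kinf Hcl).

Lemma good_range (S S' : structure LL) (j : S -> S') i :
  elementary_embedding j -> good (clos (S := S')) (range j) (lev S' i).
Proof.
move=> Hj; apply: (good_elementary Hcl Hj).
exact: (good_of_sub (matS S) (@subsetT _ (lev S i))).
Qed.

(* If level i+2 were covered by the fibres of Q over level i+1, then in an
   extension, with b new in level i+2 and with more independent elements e_l in
   level i+1 than Q has parameters, a point x = e_0 + e_1 b + .. + e_m b^m would
   be covered. The parameters of Q cannot control all the e_l, so x has another
   such expression with independent coefficients, and b is a root of the
   difference. *)
Lemma far_from_level (S : structure LL) i I (u : I -> S) m (Q : ctxrel L (option 'I_m))
    (f : 'I_m -> option I) :
  dense S -> i < n -> narrow_in cl Q ->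
  exists x, lev S i.+2 x /\ away i.+1 Q f (ocons x u).
Proof.
move=> dS Hi nQ; apply: contrapT => H.
have [b0 [Lb0 Nb0]] := dm_proper dS Hi.
have [S1 [j1 [s [Hj1 dS1 sz_s sC inds]]]] :=
  ind_extension compT MT domT kinf Hcl m.+1 dS.
have defH : @definable LL I (fun S w => exists x, lev S i.+2 x /\ away i.+1 Q f (ocons x w)).
  apply: (@definable_ex LL); apply: definable_and; first exact: definable_lev.
  apply: (@definable_env LL (option I) (option I) _ id
    (fun S0 w => ocons (w None) (w \o some)) (definable_away n i.+1 f nQ.1)).
  by move=> S0 w [].
have H1 : ~ exists x, lev S1 i.+2 x /\ away i.+1 Q f (ocons x (j1 \o u)).
  by move=> H1; apply: H; apply/(elementary_definable u Hj1 defH).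
set b := j1 b0; pose x : S1 := @pol L R (reduct S1) s b.
have sl : listed s `<=` lev S1 i.+1 by move=> y /sC; exact: (lev_mono dS1 (isT : 1 <= i.+1)).
have lb : lev S1 i.+2 b by apply/(chain_elementary _ _ Hj1).
have lx : lev S1 i.+2 x.
  by apply: (lev_pol kinf Hcl dS1) => // y /sl; exact: (lev_mono dS1 (leqnSn _)).
have [c [cP Qc]] : exists c : 'I_m -> S1,
    (forall k, if f k is Some t then c k = j1 (u t) else lev S1 i.+1 (c k)) /\
    Q (reduct S1) (ocons x c).
  apply: contrapT => Nc; apply: H1; exists x; split=> // c cP Qc.
  by apply: Nc; exists c.
have [e0 se0] : exists e0, listed s e0.
  by case: (s) sz_s => // e0 s' _; exists e0; left.
(* Entries of [c] prescribed by [f] come from [S]; they are replaced by the dummy [e0], so that [t]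
   lies in level [i.+1] and has length [m]. *)
pose t := [seq if f k is Some _ then e0 else c k | k <- enum 'I_m].
have tl : listed t `<=` lev S1 i.+1.
  rewrite /t listed_codom => _ [k _ <-]; have := cP k.
  by case: (f k) => // a _; apply: sl.
pose D0 := j1 @` lev S i.+1 `|` listed t.
have D0l : D0 `<=` lev S1 i.+1.
  by move=> y [[z lz <-]|/tl //]; apply/(chain_elementary _ _ Hj1).
(* This is where [m.+1] coefficients are needed: by Steinitz, the [m] entries of [t] cannot generate
   that many elements independent over the image of [S]. *)
have ND0 : ~ (listed s `<=` clos D0).
  move=> sD; have : size s <= size t.
    apply: (steinitz (matS S1) inds) => y /sD; apply: transfer_mono => z [[w _ <-]|tz].
      by left; exists w.
    by right.
  by rewrite sz_s /t size_map size_enum_ord ltnn.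
have [D [e [D0D DD0 se Ne sD]]] := rank_one_extension (matS S1) ND0.
have Dl : D `<=` lev S1 i.+1 by move=> y /DD0 [/D0l|/sl].
(* The image of [S] is independent from level [i.+1] over its trace, and the trace is contained in
   [D]; thus the rest of the image does not help to generate [e]. *)
have Ne1 : ~ clos (range j1 `|` D) e.
  move=> He; apply: Ne.
  apply: (good_indep (matS S1) (@lev_closed _ _ _ _ _ _ _ i dS1) (good_range i.+1 Hj1) _ Dl).
    move=> _ [[z _ <-] lz]; apply: D0D; left; exists z => //.
    by apply/(chain_elementary _ _ Hj1).
  by split=> //; exact: sl.
(* Adding [x] changes nothing: by Q it is generated by [c], hence by the image of [S] and [D]. So
   [e] is generic even over [b] and [x]. *)
pose X := range j1 `|` D `|` [set x].
have NX : ~ clos X e.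
  move=> He; apply: Ne1; apply: (cl_sub (matS S1) _ He) => y [|->].
    exact: (cl_in (matS S1)).
  apply: (transfer_intro Hcl nQ _ Qc) => _ [k _ <-].
  have := cP k; have : listed t (if f k is Some _ then e0 else c k).
    by rewrite /t listed_codom; exists k.
  case: (f k) => [a _ ->|tk _]; first by left; exists (u a).
  by right; apply: D0D; right.
pose N := size s; pose y0 (l : 'I_N) : S1 := nth e s l.
have [l0 Hl0] := listed_nth e se.
have y0s l : listed s (y0 l).
  exact: nth_listed.
have Hy l := transfer_elim (sD _ (y0s l)).
pose ar l := projT1 (cid (Hy l)); have Hy1 l := projT2 (cid (Hy l)).
pose q l := projT1 (cid (Hy1 l)); have Hy2 l := projT2 (cid (Hy1 l)).
pose d l := projT1 (cid (Hy2 l)); have Hy3 l := projT2 (cid (Hy2 l)).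
rewrite -/(ar _) -/(q _) -/(d _) in Hy3.
have DX : D `<=` X by move=> z Dz; left; right.
pose g l k : option {z | X z} :=
  if pselect (D (d l k)) is left Dk then Some (exist _ _ (DX _ Dk)) else None.
have gP l k : D (d l k) /\ (exists Xk, g l k = Some (exist _ (d l k) Xk)) \/
    d l k = e /\ g l k = None.
  rewrite /g; case: pselect => Dk; first by left; split=> //; exists (DX _ Dk).
  right; split=> //; have [_ sub _] := Hy3 l.
  by case: (sub (d l k) (ex_intro2 _ _ k Logic.I erefl)).
have Xb : X b by left; left; exists b0.
have Xx : X x by right.
(* [Psi] says of its distinguished variable that it is the coefficient number [l0] of some
   expression of [x] as a polynomial in [b], whose coefficients depend on it and [D] as those of [s]
   depend on [e]. As [e] is generic over [X], the solutions have dimension 1 and an extension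
   contains a new one, [e']. *)
pose Psi : ctxrel L (option {z | X z}) := fun S w => exists y : 'I_N -> S,
  (forall l, q l S (ocons (y l) (w \o g l))) /\ y l0 = w None /\
  pol R [seq y l | l <- enum 'I_N] (w (Some (exist _ b Xb))) = w (Some (exist _ x Xx)).
have defPsi : definable Psi.
  apply: definable_ex_block; apply: definable_and.
    apply: definable_big_and => l; have [[dq _] _ _] := Hy3 l.
    apply: (@definable_env _ _ _ _ (fun z => if z is Some k then inr (g l k) else inl l) _ dq).
    by move=> S0 v [].
  apply: definable_and; first by apply: definable_eq; exact: uterm_var.
  apply: definable_eq; last exact: uterm_var.
  apply: (@uterm_ext _ _ (fun S v => pol R (map v [seq inl l | l <- enum 'I_N]) (v (inr (Some (exist _ b Xb)))))).
    by move=> S0 v; rewrite -map_comp.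
  by apply: uterm_pol; exact: uterm_var.
have sE : [seq y0 l | l <- enum 'I_N] = s by exact: map_nth_enum.
have Psie : Psi (reduct S1) (ocons e (fun z => sval z)).
  exists y0; split.
    move=> l; have [_ _] := Hy3 l; congr (q l _ (ocons _ _)); apply/funext => k /=.
    by have [[_ [Xk ->]]|[e1 ->]] := gP l k; last exact: e1.
  by rewrite sE; split.
have crPsi : @crit L R _ Psi (reduct S1) (fun z => sval z).
  apply: (crit_of_generic MT domT kinf Hcl defPsi _ Psie NX).
  by move=> _ [[z Xz] _ <-].
have [||||S2 [j2 [e' [Hj2 dS2 HPsi _ Ne']]]] := @far_extension L R T kappa M cl compT MT domT kinf Hcl n 0
  (far_claim0 compT MT domT kinf Hcl (n := n)) S1 dS1 
  (fun P => P = fun S w => Psi S (w \o omap (fun z : {z | X z} => sval z))).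
- by move=> _ ->; exact: definable_omap.
- by eexists.
- by move=> _ _ -> ->; eexists.
- by move=> _ ->; apply: (crit_mono _ crPsi) => z; rewrite ocons_omap.
have := HPsi _ erefl; rewrite ocons_omap => -[y [yq [/= yl0 ypol]]].
have {}Ne' : ~ clos (range j2) e' by move: Ne'; rewrite setU0.
pose W := j2 @` (D `|` [set e]).
have Wl : W `<=` lev S2 i.+1.
  by move=> _ [z [/Dl lz|->] <-]; apply/(chain_elementary _ _ Hj2) => //; exact: sl.
have NWb : ~ clos W (j2 b).
  move=> Hb; have {}Hb := lev_closed dS2 (transfer_mono (S := reduct S2) Wl Hb); apply: Nb0.
  by apply/(chain_elementary _ _ Hj1)/(chain_elementary _ _ Hj2).
have yW l : clos (W `|` [set e']) (y l).
  have [nq _ _] := Hy3 l; apply: (transfer_intro Hcl nq _ (yq l)) => _ [k _ <-] /=.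
  have [[Dk [Xk ->]]|[_ ->]] := gP l k; last by right.
  by left; exists (d l k) => //; left.
have y0W l : clos (W `|` [set e']) (j2 (y0 l)).
  apply: (@transfer_mono _ _ cl (reduct S2) W); first by left.
  by apply/(transfer_elementary cl _ _ (reduct_elementary Hj2)); exact: sD.
have polW : @pol L R (reduct S2) [seq j2 (y0 l) | l <- enum 'I_N] (j2 b) = j2 x.
  pose Z : ctxrel L (option (option 'I_N)) := fun S w => 
    pol R (map w [seq Some (Some l) | l <- enum 'I_N]) (w (Some None)) = w None.
  have defZ : definable Z.
    by apply: definable_eq; last exact: uterm_var; apply: uterm_pol; exact: uterm_var.
  have Z1 : Z (reduct S1) (ocons x (ocons b y0)).
    rewrite /Z -map_comp; rewrite -/(x); change (@pol L R (reduct S1) [seq y0 l | l <- enum 'I_N] b = x).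
    by rewrite sE.
  have := (elementary_definable _ (reduct_elementary Hj2) defZ).1 Z1.
  by rewrite /Z -map_comp.
have bW : clos (W `|` [set e']) (j2 b).
  have sub : range (scat y (j2 \o y0)) `<=` clos (W `|` [set e']).
    by move=> _ [[l|l] _ <-]; [exact: yW|exact: y0W].
  suff Hb : clos (range (scat y (j2 \o y0))) (j2 b) by exact: (cl_sub (matS S2) sub Hb).
  apply: (transfer_intro Hcl (b := scat y (j2 \o y0)) (pol_inj_narrow (domT MT) kinf Hcl N)) => //.
  split; first by rewrite [RHS]polW; exact: ypol.
  exists l0 => /=; rewrite yl0 => e'e; apply: Ne'; rewrite e'e; apply: (cl_in (matS S2)).
  by exists (y0 l0).
(* Comparing the two expressions puts [b] in the closure of [W] and [e']. Since [W] lies in level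
   [i.+1] and [b] does not, exchange generates [e'] from elements of the smaller structure, against
   its choice. *)
apply: Ne'; have := cl_exchange (matS S2) bW NWb; apply: transfer_mono.
by move=> _ [[z _ <-]|->]; [exists z|exists b].
Qed.

Lemma shift_narrow m (Q : ctxrel L (option 'I_m)) : narrow_in cl Q ->
  narrow_in cl (fun S (w : option 'I_m.+1 -> S) => exists y,
    y = radd R (w None) (w (Some ord0)) /\ Q S (ocons y (fun k => w (Some (lift ord0 k))))).
Proof.
move=> nQ; split.
  apply: definable_ex; apply: definable_and.
    by apply: definable_eq; [|apply: uterm_add]; exact: uterm_var.
  apply: (@definable_env _ _ _ _ (fun z => if z is Some k then Some (Some (lift ord0 k)) else None) _ nQ.1).
  by move=> S0 v [].
move=> c w [y [yE /nQ.2 Hy]].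
have matM := existential_mat Hcl.
pose v (o : bool) := if o then y else w ord0.
have sub : range v `<=` cl (range w).
  move=> _ [[|] _ <-]; last by apply: (cl_in matM); exists ord0.
  by apply: (cl_mono matM _ Hy) => _ [k _ <-]; exists (lift ord0 k).
suff Hc : cl (range v) c by exact: (cl_sub matM sub Hc).
apply: (functional_cl (P := fun S (w : option bool -> S) =>
  w (Some true) = radd R (w None) (w (Some false))) kinf Hcl) => //.
  by apply: definable_eq; [|apply: uterm_add]; exact: uterm_var.
move=> x' /= yE'; apply: (radd_cancelr (domT MT) (z := w ord0)).
by rewrite -[RHS]yE -yE'.
Qed.

(** Replacing each x_i by x_i - e subtracts z e + e from both sides of the equation z x1 + x4 = z x2
    + x3. *)
Lemma shift_crit (S : structure L) I (P : ctxrel L (option I)) (u : I -> S) e :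
  is_integral_domain R S ->
  crit R P u -> crit R (fun S (w : option (option I) -> S) => exists y,
     y = radd R (w None) (w (Some None)) /\ P S (ocons y (fun k => w (Some (Some k))))) (ocons e u).
Proof.
move=> domS crP z; have [x1 [x2 [x3 [x4 [P1 P2 P3 P4 [x12 E]]]]]] := crP z.
have aux x := rsubK domS x e.
exists (rsub R x1 e), (rsub R x2 e), (rsub R x3 e), (rsub R x4 e); split.
- by exists x1; rewrite aux.
- by exists x2; rewrite aux.
- by exists x3; rewrite aux.
- by exists x4; rewrite aux.
split; first by move=> H; apply: x12; rewrite -(aux x1) H aux.
exact: (shift_equation domS).
Qed.

End Core.

Section FarClaims.
Variables (L : language) (R : ring_symbols L) (T : theory L) (kappa : Type) (M : structure L).
Variable cl : set M -> set M.
Hypothesis compT : complete T.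
Hypothesis MT : model T M.
Hypothesis domT : expands_integral_domains R T.
Hypothesis kinf : infinite_set [set: kappa].
Hypothesis Hcl : existential_matroid kappa cl.
Variable n : nat.
Local Notation LL := (expansion L n).
Local Notation dense := (dense_model R T cl).

(* Translating a far point of level i+2 by a point of level 1, which is dense,
   moves it into any given set of dimension 1. *)
Lemma far_claimS i : i < n -> far_claim R T cl n i.+1.
Proof.
move=> Hi S dS I u P m Q f defP crP nQ _.
(* The first entry of the shifted formula is left free in level [i.+1], so [e] avoids all translates
   of the fibres by points of that level, before the translation [p] is known. *)
have [e [le ae]] := far_from_level compT MT domT kinf Hcl u (scons None f) dS Hi (shift_narrow MT domT kinf Hcl nQ).
have domS := domT (dm_model dS).
have crP' := shift_crit (u := u : I -> reduct S) e domS crP.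
have [|p [Cp [y [yE Py]]]] := dense_exists dS _ crP'.
  apply: definable_ex; apply: definable_and.
    by apply: definable_eq; [|apply: uterm_add]; exact: uterm_var.
  apply: (@definable_env _ _ _ _ (fun z => if z is Some k then Some (Some (Some k)) else None) _ defP).
  by move=> S0 v [].
exists y; split.
- have lp : lev S i.+2 p by exact: (lev_mono dS (isT : 1 <= i.+2) Cp).
  rewrite yE; apply: (lev_closed dS).
  pose v (o : bool) : reduct S := if o then p else e.
  apply: (@transfer_mono _ _ cl (reduct S) (range v)); first by move=> _ [[] _ <-].
  apply: (transfer_uterm kinf Hcl (S := reduct S) v (t := fun S w => radd R (w true) (w false))).
  by apply: uterm_add; exact: uterm_var.
- exact: Py.
move=> b Hb Qb; apply: (ae (scons p b)).
  move=> k; case: (unliftP ord0 k) => [l|] ->; last first.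
    by rewrite !scons0; exact: (lev_mono dS (isT : 1 <= i.+1) Cp).
  by rewrite !sconsS; exact: Hb.
exists y; split.
  by rewrite yE /= scons0; exact: (Radd_comm (domain_ring_theory domS)).
move: Qb; congr (Q _ (ocons _ _)); apply/funext => k.
by rewrite /= sconsS.
Qed.

Lemma far_claimP i : i <= n -> far_claim R T cl n i.
Proof. by case: i => [_|i]; [exact: (far_claim0 compT MT domT kinf Hcl)|exact: far_claimS]. Qed.

End FarClaims.

(** * Back and forth *)

Section DropTerm.
Variables (L : language) (n : nat).

Fixpoint drop_term k (t : term (expansion L n) k) : term L k :=
  match t with
  | Var i => Var L i
  | App _ f ts => @App L k _ f (fun i => drop_term (ts i))
  end.

Lemma eval_drop (S : structure (expansion L n)) k (t : term (expansion L n) k) (v : 'I_k -> S) :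
  eval v t = @eval L (reduct S) k v (drop_term t).
Proof.
elim: t => [i //|m f ts IH] /=; congr fint; apply/funext => i; exact: IH.
Qed.

End DropTerm.

Lemma range_ocons (X I : Type) (b : X) (u : I -> X) :
  range (ocons b u) = range u `|` [set b].
Proof.
apply/seteqP; split=> [_ [[t|] _ <-]|_ [[t _ <-]|->]].
- by left; exists t.
- by right.
- by exists (Some t).
- by exists None.
Qed.

Section BackAndForth.
Variables (L : language) (R : ring_symbols L) (T : theory L) (kappa : Type) (M : structure L).
Variable cl : set M -> set M.
Hypothesis compT : complete T.
Hypothesis MT : model T M.
Hypothesis domT : expands_integral_domains R T.
Hypothesis kinf : infinite_set [set: kappa].
Hypothesis Hcl : existential_matroid kappa cl.
Variable n : nat.
Local Notation LL := (expansion L n).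
Local Notation dense := (dense_model R T cl).
Local Notation clos := (@clos L M cl n).
Local Notation matS := (clos_matroid MT domT kinf Hcl).

Record state I (S S' : structure LL) (u : I -> S) (u' : I -> S') : Prop := State {
  st_dense : dense S;
  st_dense' : dense S';
  st_type : forall P : ctxrel L I, definable P -> P (reduct S) u <-> P (reduct S') u';
  st_lev : forall i t, lev S i (u t) <-> lev S' i (u' t);
  st_good : forall i, good (clos (S := S)) (range u) (lev S i);
  st_good' : forall i, good (clos (S := S')) (range u') (lev S' i) }.

Lemma state_sym I (S S' : structure LL) (u : I -> S) (u' : I -> S') :
  state u u' -> state u' u.
Proof.
by case=> *; split=> // [P dP|i t]; apply: iff_sym; auto.
Qed.

Lemma state_extend I (S S' S2 : structure LL) (u : I -> S) (u' : I -> S') (j : S' -> S2) :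
  elementary_embedding j -> state u u' -> state u (j \o u').
Proof.
move=> Hj [dS dS' ty le go go']; split=> //.
- exact: dense_model_elementary Hj dS'.
- move=> P dP; rewrite (ty P dP).
  exact: (@elementary_definable L (reduct S') (reduct S2) j I P u' (reduct_elementary Hj) dP).
- move=> i t; rewrite le; exact: lev_elementary.
- move=> i; rewrite -(image_comp u' j); exact: (good_elementary Hcl Hj).
Qed.

Lemma clos_type I (S S' : structure LL) (u : I -> S) (u' : I -> S') b b' (X : set I) :
  (forall P : ctxrel L (option I), definable P ->
     P (reduct S) (ocons b u) -> P (reduct S') (ocons b' u')) ->
  clos (u @` X) b -> clos (u' @` X) b'.
Proof.
move=> H /transfer_elim [m [P [c [nP cX Pb]]]].
have ce k : exists2 t, X t & u t = c k by apply: cX; exists k.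
pose e k := s2val (cid2 (ce k)).
have eX k : X (e k) by rewrite /e; case: (cid2 _).
have ec : u \o e = c by apply/funext => k /=; rewrite /e; case: (cid2 _).
apply: (@transfer_intro _ _ _ _ Hcl (reduct S') 'I_m P (u' \o e)) => //.
  by move=> _ [k _ <-]; exists (e k).
have := H (fun S w => P S (w \o omap e)) (definable_omap e nP.1).
by rewrite !ocons_omap ec; exact.
Qed.

(** If [b] depends on the family and lies in a level, then by independence it depends on the members
    of the family in that level. This dependence belongs to the L-type, so it holds for [b'], and
    the level of [S'] is closed. *)
Lemma lev_type I (S S' : structure LL) (u : I -> S) (u' : I -> S') b b' i :
  dense S -> dense S' -> good (clos (S := S)) (range u) (lev S i) ->
  (forall P : ctxrel L (option I), definable P ->
     P (reduct S) (ocons b u) -> P (reduct S') (ocons b' u')) ->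
  (forall t, lev S i (u t) -> lev S' i (u' t)) ->
  clos (range u) b -> lev S i b -> lev S' i b'.
Proof.
case: i => [//|i] dS dS' go ty le ub lb; apply: (lev_closed dS').
pose X := [set t | lev S i.+1 (u t)].
have uX : range u `&` lev S i.+1 = u @` X.
  by apply/seteqP; split=> [_ [[t _ <-] lt]|_ [t Xt <-]]; [exists t|split=> //; exists t].
suff Hb : clos (u' @` X) b' by apply: transfer_mono Hb => _ [t Xt <-]; exact: le.
apply: (clos_type ty); rewrite -uX.
apply: (good_indep (matS S) (@lev_closed _ _ _ _ _ _ _ i dS) go) => //.
split=> //; apply: transfer_mono ub; by left.
Qed.

Lemma state_add I (S S' : structure LL) (u : I -> S) (u' : I -> S') b b' :
  state u u' ->
  (forall P : ctxrel L (option I), definable P ->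
     P (reduct S) (ocons b u) -> P (reduct S') (ocons b' u')) ->
  (forall i, lev S i b <-> lev S' i b') ->
  (forall i, [\/ clos (range u) b, lev S i b | ~ clos (range u `|` lev S i) b]) ->
  (forall i, [\/ clos (range u') b', lev S' i b' | ~ clos (range u' `|` lev S' i) b']) ->
  state (ocons b u) (ocons b' u').
Proof.
move=> [dS dS' ty le go go'] ty' le' gb gb'; split=> //.
- move=> P dP; split; first exact: ty'.
  move=> H; apply: contrapT => N; exact: (ty' _ (definable_not dP) N).
- by move=> i [t|] /=; [exact: le|exact: le'].
- move=> i; rewrite range_ocons; case: (gb i) => H.
  + by apply: (good_add_dependent (matS S)) => //; left.
  + by apply: (good_add_dependent (matS S)) => //; right.
  + exact: (good_add_free (matS S)).
- move=> i; rewrite range_ocons; case: (gb' i) => H.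
  + by apply: (good_add_dependent (matS S')) => //; left.
  + by apply: (good_add_dependent (matS S')) => //; right.
  + exact: (good_add_free (matS S')).
Qed.

Lemma add_dependent I (S S' : structure LL) (u : I -> S) (u' : I -> S') b :
  state u u' -> clos (range u) b ->
  exists (S2 : structure LL) (j : S' -> S2) b',
    elementary_embedding j /\ state (ocons b u) (ocons b' (j \o u')).
Proof.
move=> st ub; have [S2 [j [Hj Hr]]] := realizing_extension S'.
pose Sigma (Z : ctxrel LL (option S')) := exists P : ctxrel L (option I),
  [/\ definable P, P (reduct S) (ocons b u) & Z = fun S0 w => P (reduct S0) (w \o omap u')].
have [||||b' Hb'] := Hr Sigma.
- move=> _ [P [dP _ ->]]; exact: (definable_omap u' (definable_lift n dP)).
- eexists; exists (fun S w => True); split => //; exact: definable_cst.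
- move=> _ _ [P [dP Pb ->]] [Q [dQ Qb ->]].
  exists (fun S0 w => P (reduct S0) (w \o omap u') /\ Q (reduct S0) (w \o omap u')) => //.
  by exists (fun S w => P S w /\ Q S w); split=> //; exact: definable_and.
- move=> _ [P [dP Pb ->]].
  have defE : definable (fun (S0 : structure L) (w : I -> S0) => exists x, P S0 (ocons x w)).
    apply: definable_ex; apply: (@definable_env _ _ _ _ id _ dP).
    by move=> S0 v [].
  have [x Px] := (st_type st defE).1 (ex_intro _ b Pb).
  by exists x; rewrite ocons_omap.
have ty (P : ctxrel L (option I)) : definable P ->
     P (reduct S) (ocons b u) -> P (reduct S2) (ocons b' (j \o u')).
  move=> dP Pb; rewrite -ocons_omap.
  by apply: (Hb' (fun S0 w => P (reduct S0) (w \o omap u'))); exists P.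
exists S2, j, b'; split=> //.
have st2 := state_extend Hj st; have [dS dS2 _ le2 go2 go2'] := st2.
have ub' : clos (range (j \o u')) b' by exact: (clos_type ty ub).
apply: state_add => // [i|i|i]; [|by constructor 1|by constructor 1].
split; first exact: (lev_type dS dS2 (go2 i) ty (fun t => (le2 i t).1) ub).
apply: (lev_type dS2 dS (go2' i) _ (fun t => (le2 i t).2) ub') => P dP H.
by apply: contrapT => N; exact: (ty _ (definable_not dP) N).
Qed.

(** The L-type of [b] over [u] consists of sets of dimension 1, and [crit], being definable, says
    the same over [u']; a far point of this type settles all levels, as it lies in those above [i]
    and outside the others. It is even far from all of [S'], which the proof of Existence uses. *)
Lemma add_far I (S S' : structure LL) (u : I -> S) (u' : I -> S') b i :
  i <= n -> state u u' -> lev S i.+1 b -> ~ clos (range u `|` lev S i) b ->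
  exists (S2 : structure LL) (j : S' -> S2) b',
    [/\ elementary_embedding j, state (ocons b u) (ocons b' (j \o u')) &
        ~ clos (range j `|` lev S2 i) b'].
Proof.
move=> Hi st lb Nb.
have Nub : ~ clos (range u) b by move=> H; apply: Nb; apply: transfer_mono H; left.
pose F (Z : ctxrel L (option S')) := exists P : ctxrel L (option I),
  [/\ definable P, P (reduct S) (ocons b u) & Z = fun S0 w => P S0 (w \o omap u')].
have [||||S2 [j [b' [Hj dS2 Hb' lb' Nb']]]] :=
  far_extension compT MT domT kinf Hcl (far_claimP compT MT domT kinf Hcl Hi) (st_dense' st) (F := F).
- by move=> _ [P [dP _ ->]]; exact: definable_omap.
- eexists; exists (fun S w => True); split => //; exact: definable_cst.
- move=> _ _ [P [dP Pb ->]] [Q [dQ Qb ->]].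
  exists (fun S0 w => P S0 (w \o omap u') /\ Q S0 (w \o omap u')) => //.
  by exists (fun S w => P S w /\ Q S w); split=> //; exact: definable_and.
- move=> _ [P [dP Pb ->]].
  have crP : @crit L R _ P (reduct S) u by exact: (crit_of_generic MT domT kinf Hcl dP _ Pb Nub).
  apply: (crit_mono _ ((st_type st (definable_crit R dP)).1 crP)) => x.
  by rewrite ocons_omap.
have ty (P : ctxrel L (option I)) : definable P ->
     P (reduct S) (ocons b u) -> P (reduct S2) (ocons b' (j \o u')).
  move=> dP Pb; rewrite -ocons_omap.
  by apply: (Hb' (fun S0 w => P S0 (w \o omap u'))); exists P.
exists S2, j, b'; split=> //.
have st2 := state_extend Hj st; have [dS _ _ le2 go2 go2'] := st2.
have sub k : k <= i -> range (j \o u') `|` lev S2 k `<=` range j `|` lev S2 i.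
  move=> ki x [[t _ <-]|lx]; first by left; exists (u' t).
  by right; exact: (lev_mono dS2 ki).
have Nlev k : k <= i -> ~ clos (range u `|` lev S k) b.
  move=> ki H; apply: Nb; apply: transfer_mono H => x [|lx]; first by left.
  by right; exact: (lev_mono dS ki).
have Nlev' k : k <= i -> ~ clos (range (j \o u') `|` lev S2 k) b'.
  by move=> ki H; apply: Nb'; apply: transfer_mono H; exact: sub.
apply: state_add => // k; have [ki|ik] := leqP k i.
- split=> H; exfalso; [apply: (Nlev k ki)|apply: (Nlev' k ki)];
    by apply: (cl_in (matS _)); right.
- by split=> _; [exact: (lev_mono dS2 ik)|exact: (lev_mono dS ik)].
- by constructor 3; exact: Nlev.
- by constructor 2; exact: (lev_mono dS ik).
- by constructor 3; exact: Nlev'.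
- by constructor 2; exact: (lev_mono dS2 ik).
Qed.

(** The family may grow by more than [X]: an element of a high level can force elements of lower
    levels to be added with it. *)
Definition extends I (S S' : structure LL) (u : I -> S) (u' : I -> S') (X : set S) : Prop :=
  exists I' (g : I -> I') (u1 : I' -> S) (S2 : structure LL) (j : S' -> S2) (u1' : I' -> S2),
    [/\ elementary_embedding j, state u1 u1', u1 \o g = u, u1' \o g = j \o u' & X `<=` range u1].

Lemma extends_option I (S S' S2 : structure LL) (u : I -> S) (u' : I -> S') (j : S' -> S2) b b' :
  elementary_embedding j -> state (ocons b u) (ocons b' (j \o u')) -> extends u u' [set b].
Proof.
move=> Hj st; exists (option I), some, (ocons b u), S2, j, (ocons b' (j \o u')); split=> //.
by move=> _ ->; exists None.
Qed.

Lemma extends_trans I (S S' : structure LL) (u : I -> S) (u' : I -> S') (X Y : set S) :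
  extends u u' X ->
  (forall I' (S2 : structure LL) (u1 : I' -> S) (u1' : I' -> S2),
    state u1 u1' -> range u `|` X `<=` range u1 -> extends u1 u1' Y) ->
  extends u u' (X `|` Y).
Proof.
move=> [I1 [g1 [u1 [S1 [j1 [u1' [Hj1 st1 ug1 ug1' X1]]]]]]] H.
have [|I2 [g2 [u2 [S2 [j2 [u2' [Hj2 st2 ug2 ug2' Y2]]]]]]] := H _ _ _ _ st1.
  by move=> x [[t _ <-]|/X1 //]; exists (g1 t); rewrite // -ug1.
exists I2, (g2 \o g1), u2, S2, (j2 \o j1), u2'; split=> //.
- exact: elementary_comp.
- by rewrite compA ug2.
- by rewrite compA ug2' -compA ug1'.
move=> x [/X1 [t _ <-]|/Y2 //].
by exists (g2 t) => //; rewrite -ug2.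
Qed.

(** Either [b] is far from level [i], and [add_far] applies, or it depends on the family and
    finitely many elements of level [i]. These are added first, by induction on the level, after
    which [b] is dependent on the family. *)
Lemma extends_lev i : i <= n.+1 -> forall I (S S' : structure LL) (u : I -> S) (u' : I -> S') b,
  state u u' -> lev S i b -> extends u u' [set b].
Proof.
elim: i => [//|i IH] Hi I S S' u u' b st lb.
have [ub|Nub] := pselect (clos (range u `|` lev S i) b); last first.
  have [S2 [j [b' [Hj st2 _]]]] := add_far Hi st lb Nub.
  exact: extends_option Hj st2.
have [t tl ub'] := cl_split (matS S) ub.
have ext : extends u u' (listed t).
  clear ub ub'; elim: t tl I S' u u' st => [|a t IHt] tl I S' u u' st.
    by exists I, id, u, S', id, u'; split=> // x [].
  have -> : listed (a :: t) = [set a] `|` listed t.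
    by apply/seteqP; split=> x /= [->|]; [left|right|left|right].
  apply: extends_trans.
    by apply: (IH (ltnW Hi)) => //; apply: tl; left.
  move=> I' S2 u1 u1' st1 _; apply: IHt => //.
  by move=> x tx; apply: tl; right.
have : extends u u' (listed t `|` [set b]).
  apply: extends_trans ext _ => I' S2 u1 u1' st1 sub.
  have [|S3 [j [b' [Hj st2]]]] := add_dependent st1 (b := b).
    exact: (transfer_mono (S := reduct S) sub ub').
  exact: extends_option Hj st2.
move=> [I' [g [u1 [S2 [j [u1' [H1 H2 H3 H4 H5]]]]]]].
by exists I', g, u1, S2, j, u1'; split=> // x xb; apply: H5; right.
Qed.

(** Equations and old relations belong to the L-type. The new predicates are applied to a term,
    whose value is in the closure of the family, so [lev_type] decides them. *)
Theorem state_sat k (psi : formula LL k) I (S S' : structure LL) (u : I -> S) (u' : I -> S')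
    (e : 'I_k -> I) :
  state u u' -> sat psi (u \o e) <-> sat psi (u' \o e).
Proof.
elim: psi I S S' u u' e => {k} [k|k t1 t2|k m r ts|k p IHp q IHq|k p IH] I S S' u u' e st /=.
- by [].
- rewrite !eval_drop; apply: (st_type st (P := fun S0 w =>
    eval (w \o e) (drop_term t1) = eval (w \o e) (drop_term t2))).
  by apply: definable_eq; exact: uterm_eval.
- have E (S0 : structure LL) (v : I -> S0) : (fun i => eval (v \o e) (ts i)) =
      (fun i => @eval L (reduct S0) _ (v \o e) (drop_term (ts i))).
    by apply/funext => i; rewrite eval_drop.
  rewrite !E; case: r ts E => {m} [m r ts E|i ts E].
    exact: (st_type st (definable_sat (Atom r (fun i => drop_term (ts i))) e)).
  set x := fun i0 : 'I_1 => @eval L (reduct S) _ _ _.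
  set x' := fun i0 : 'I_1 => @eval L (reduct S') _ _ _.
  have Ex (S0 : structure LL) (y : 'I_1 -> S0) :
      @rint LL S0 1 (NewPred i) y <-> lev S0 i.+1 (y ord0).
    rewrite /= (@chain_insub _ _ _ _ (ltn_ord i)).
    have -> : Ordinal (ltn_ord i) = i by exact: val_inj.
    by have -> : (fun=> y ord0) = y by apply/funext => l; rewrite (ord1 l).
  have cx (S0 : structure LL) (v : I -> S0) :
      clos (range v) (@eval L (reduct S0) _ (v \o e) (drop_term (ts ord0))).
    exact: (transfer_uterm kinf Hcl (S := reduct S0) v (uterm_eval (drop_term (ts ord0)) e)).
  have ty (P : ctxrel L (option I)) : definable P ->
     P (reduct S) (ocons (x ord0) u) <-> P (reduct S') (ocons (x' ord0) u').
    move=> dP.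
    have d : definable (fun S0 w => exists y, y = eval (w \o e) (drop_term (ts ord0)) /\ P S0 (ocons y w)).
      apply: definable_ex; apply: definable_and.
        by apply: definable_eq; [exact: uterm_var|exact: (uterm_eval _ (some \o e))].
      apply: (@definable_env _ _ _ _ id _ dP).
      by move=> S0 v [].
    have H := st_type st d; split=> Px.
      have /H [y [yE Py]] : exists y : reduct S, y = @eval L (reduct S) k (u \o e) (drop_term (ts ord0)) /\
        P (reduct S) (ocons y u) by exists (x ord0).
      by rewrite /x' -yE.
    have /H [y [yE Py]] : exists y : reduct S', y = @eval L (reduct S') k (u' \o e) (drop_term (ts ord0)) /\
        P (reduct S') (ocons y u') by exists (x' ord0).
    by rewrite /x -yE.
  rewrite !Ex; have [dS dS' _ le go go'] := st; split.
    exact: (lev_type dS dS' (go _) (fun P dP => (ty P dP).1) (fun t => (le _ t).1) (cx S u)).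
  exact: (lev_type dS' dS (go' _) (fun P dP => (ty P dP).2) (fun t => (le _ t).2) (cx S' u')).
- by rewrite (IHp _ _ _ _ _ e st) (IHq _ _ _ _ _ e st).
suff half (S1 S2 : structure LL) (v : I -> S1) (w : I -> S2) : state v w ->
    sat (All p) (v \o e) -> sat (All p) (w \o e).
  by split; apply: half => //; exact: state_sym.
(* The element [a] of [S2] is matched in an elementary extension [S3] of [S1]. The universal formula
   still holds there, so extending one side is enough. *)
move=> stv H a.
have [|I' [g [w1 [S3 [j [v1 [Hj st1 wg vg /(_ a erefl) [t _ ta]]]]]]]] :=
  extends_lev (leqnn n.+1) (b := a) (state_sym stv); first by rewrite lev_last.
have e1 : w1 \o scons t (g \o e) = scons a (w \o e).
  by rewrite comp_scons ta; congr scons; exact: (congr1 (fun f => f \o e) wg).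
have e2 : v1 \o scons t (g \o e) = scons (v1 t) (j \o (v \o e)).
  by rewrite comp_scons; congr scons; exact: (congr1 (fun f => f \o e) vg).
have := IH _ _ _ _ _ (scons t (g \o e)) st1; rewrite e1 e2 => Hp; apply: Hp.2.
have {}H : sat (All p) (j \o (v \o e)) by apply/Hj.
exact: (H (v1 t)).
Qed.

Theorem dense_models_equivalent (S S' : structure LL) (s : sentence LL) :
  dense S -> dense S' -> holds S s -> holds S' s.
Proof.
move=> dS dS' HS.
pose u (S0 : structure LL) (x : void) : S0 := match x with end.
have st : state (@u S) (@u S').
  split=> //.
  - move=> P dP; have := valid_transfer compT MT (dm_model dS) dP.
    have := valid_transfer compT MT (dm_model dS) (definable_not dP).
    have := valid_transfer compT MT (dm_model dS') dP.
    have := valid_transfer compT MT (dm_model dS') (definable_not dP).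
    have E (X : Type) (v w : void -> X) : v = w by apply/funext => -[].
    pose uM (x : void) : M := match x with end.
    have [PM|NM] := pselect (P M uM).
      move=> _ H1 _ H2; split=> _; [apply: H1|apply: H2] => v; by rewrite (E _ v uM).
    move=> H1 _ H2 _; split=> H; exfalso; [apply: (H2 _ (@u S))|apply: (H1 _ (@u S'))] => //;
      move=> v; by rewrite (E _ v uM).
  - by move=> i; exists set0; split=> [x []|_ [[]]|x []].
  - by move=> i; exists set0; split=> [x []|_ [[]]|x []].
move=> v; have -> : v = @u S' \o @from_I0 void by apply/funext => i; exact: (from_I0 _ i).
by apply/(state_sat s _ st); exact: HS.
Qed.

End BackAndForth.

(** * The closure over the last member of the sequence *)

Lemma range_sval (X : Type) (A : set X) : range (fun x : {x | A x} => sval x) = A.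
Proof. by apply/seteqP; split=> [_ [[x Ax] _ <-]//|x Ax]; exists (exist _ x Ax). Qed.

Lemma matroid_localize (X : Type) (cl : set X -> set X) (B : set X) :
  matroid cl -> matroid (fun A => cl (A `|` B)).
Proof.
move=> mat; split.
- by move=> A x Ax; apply: (cl_in mat); left.
- by move=> A C AC; apply: (cl_mono mat) => x [/AC|]; [left|right].
- move=> A; apply/seteqP; split=> x; last by move=> H; apply: (cl_in mat); left.
  by apply: (cl_sub mat) => y [//|By]; apply: (cl_in mat); right.
- move=> A; apply/seteqP; split=> x.
    rewrite setUC => /(cl_split mat) [t tA Ht]; exists (listed t).
      by split=> //; exact: listed_finite.
    by rewrite setUC.
  move=> [C [_ CA]]; apply: (cl_mono mat) => y [/CA|]; [by left|by right].
move=> A a c [H N].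
have H' : cl (A `|` B `|` [set c]) a by apply: (cl_mono mat _ H); setincl.
by apply: (cl_mono mat _ (cl_exchange mat H' N)); setincl.
Qed.

Section DenseMatroid.
Variables (L : language) (R : ring_symbols L) (T : theory L) (kappa : Type) (M : structure L).
Variable cl : set M -> set M.
Hypothesis compT : complete T.
Hypothesis MT : model T M.
Hypothesis domT : expands_integral_domains R T.
Hypothesis kinf : infinite_set [set: kappa].
Hypothesis Hcl : existential_matroid kappa cl.
Variable n : nat.
Local Notation LL := (expansion L n).
Local Notation dense := (dense_model R T cl).
Local Notation clos := (@clos L M cl n).
Local Notation matS := (clos_matroid MT domT kinf Hcl).

Lemma state_definable I (S S' : structure LL) (u : I -> S) (u' : I -> S') (P : ctxrel LL I) :
  state R T cl u u' -> definable P -> P S u <-> P S' u'.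
Proof.
move=> st [k [phi [e H]]]; rewrite !H.
exact: (state_sat compT MT domT kinf Hcl phi e st).
Qed.

Variables (kappa' : Type) (S : structure LL).
Hypothesis kinf' : infinite_set [set: kappa'].
Hypothesis satS : saturated kappa' S.
Hypothesis dS : dense S.

Definition dense_closure (X : set S) : set S := clos (X `|` lev S n).

(** A dependence uses finitely many parameters from [X] and others from [lev S n], which is
    definable. Quantifying the latter away leaves a formula over [X], and [away_intro] shows that it
    is narrow for the new closure. *)
Lemma dense_closure_definable : definable_matroid dense_closure.
Proof.
move=> X; apply/seteqP; split=> a; last first.
  move=> [m [phi [b [nphi bX Hphi]]]].
  by apply: transfer_mono (nphi _ _ Hphi) => x [/bX|]; [left|right].
rewrite /dense_closure -{1}(range_sval X) => /away_elim [m [Q [f [nQ _ H]]]].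
pose J : finType := {k | isSome (f k)}.
have fJ (k : J) : exists t, f (sval k) = Some t by case: k => k /=; case: (f k) => // t; exists t.
pose c (k : J) : S := sval (projT1 (cid (fJ k))).
pose f0 (k : 'I_m) : option J := insub k.
have cP k : if f0 k is Some t then f k = Some (projT1 (cid (fJ t))) else f k = None.
  rewrite /f0; case: insubP => [t _ kE|]; last by case: (f k).
  by case: (cid (fJ t)) => t' /=; rewrite kE.
pose Z : ctxrel LL (option J) := fun S0 w => ~ away n Q f0 w.
have defZ : definable Z by apply: definable_not; exact: definable_away nQ.1.
have Za : Z S (ocons a c).
  move=> H'; apply: H => b Hb; apply: H' => k.
  have := cP k; have := Hb k; case: (f0 k) => [t|]; first by move=> + E; rewrite E.
  by move=> + E; rewrite E.
have [phi Hphi] := definable_formula (definable_omap (@enum_rank J) defZ).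
exists #|J|, phi, (c \o enum_val); split.
- move=> x b /Hphi; rewrite ocons_omap => Zx.
  have Hx : clos (range (b \o enum_rank) `|` lev S n) x.
    by apply: contrapT => N; apply: Zx; exact: (away_intro Hcl nQ N).
  by apply: transfer_mono Hx => z [[k _ <-]|lx]; [left; exists (enum_rank k)|right].
- by move=> _ [k _ <-]; rewrite /= /c; case: (projT1 _) => x /=.
apply/Hphi; rewrite ocons_omap (_ : (c \o enum_val) \o enum_rank = c) //.
by apply/funext => k /=; rewrite enum_rankK.
Qed.

Lemma good_above (X : set S) i : lev S n `<=` X -> good (clos (S := S)) X (lev S i).
Proof.
move=> nX; have [ni|ni] := leqP i n.
  apply: (good_of_sub (matS S)) => x lx; apply: nX; exact: (lev_mono dS ni).
exists set0; split=> // x Xx; apply: (cl_in (matS S)); right; split=> //.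
by apply: (lev_mono dS ni); rewrite lev_last.
Qed.

(** By saturation it suffices to find points of the type of [a] over [B] that are away from finitely
    many fibres over [C] and the last predicate. The identity on [B] and that predicate is a state,
    by [good_above]; adding [a] to it on one side gives a point far from all of [S] in an extension,
    with the same type in the expanded language. The resulting existential statement descends to
    [S]. *)
Lemma dense_closure_Existence : Existence kappa' dense_closure.
Proof.
move=> a B C sB sC Na.
have sBC := smallU kinf' sB sC.
pose incl (x : {x | B x}) : {x | (B `|` C) x} := exist _ (sval x) (or_introl (svalP x)).
pose G (Z : ctxrel LL (option {x | (B `|` C) x})) := exists P : ctxrel LL (option {x | B x}),
  [/\ definable P, P S (ocons a sval) & Z = fun S0 w => P S0 (w \o omap incl)].
have GE (P : ctxrel LL (option {x | B x})) x :
  P S (ocons x sval \o omap incl) = P S (ocons x sval) by rewrite ocons_omap.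
have [||||a' [Ha' Na']] := realize_far compT MT domT kinf Hcl (i := n) dS
    (saturated_realizes satS sBC) (G := G).
- by move=> _ [P [dP _ ->]]; exact: definable_omap.
- by eexists; exists (fun S w => True); split => //; exact: definable_cst.
- move=> _ _ [P [dP Pa ->]] [Q [dQ Qa ->]].
  exists (fun S0 w => P S0 (w \o omap incl) /\ Q S0 (w \o omap incl)) => //.
  by exists (fun S w => P S w /\ Q S w); split=> //; exact: definable_and.
- move=> _ m Q f [P [dP Pa ->]] nQ _.
  pose X := B `|` lev S n; pose u (x : {x | X x}) : S := sval x.
  have ru : range u = X by exact: range_sval.
  have st0 : state R T cl u u.
    by split=> // i; apply: good_above; rewrite ru => x; right.
  have Na0 : ~ clos (range u `|` lev S n) a.
    rewrite ru => H; apply: Na; apply: transfer_mono H => x [//|]; by right.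
  have la : lev S n.+1 a by rewrite lev_last.
  have [S2 [j [b [Hj st Nb]]]] := add_far compT MT domT kinf Hcl (leqnn n) st0 la Na0.
  pose inX (x : {x | B x}) : {x | X x} := exist _ (sval x) (or_introl (svalP x)).
  have Pb : P S2 (ocons b (j \o (fun x : {x | B x} => sval x))).
    have := (state_definable st (definable_omap inX dP)).1.
    by rewrite !ocons_omap; apply.
  have ab : away n Q f (ocons b (j \o (fun x : {x | (B `|` C) x} => sval x))).
    apply: (away_intro Hcl nQ) => H; apply: Nb; apply: transfer_mono H.
    by move=> z [[x _ <-]|lx]; [left; exists (sval x)|right].
  have dE : definable (fun (S0 : structure LL) (w : {x | (B `|` C) x} -> S0) =>
      exists x, P S0 (ocons x w \o omap incl) /\ away n Q f (ocons x w)).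
    apply: definable_ex; apply: definable_and.
      apply: (@definable_env LL _ _ _ id (fun S0 w => ocons (w None) (w \o some)) (definable_omap incl dP)).
      by move=> S0 v [].
    apply: (@definable_env LL _ _ _ id (fun S0 w => ocons (w None) (w \o some)) (definable_away n n f nQ.1)).
    by move=> S0 v [].
  apply/(elementary_definable _ Hj dE); exists b; split=> //.
  by rewrite ocons_omap.
exists a'.
  apply: same_type_of_definable => P dP Pa; rewrite -GE.
  by apply: (Ha' (fun S0 w => P S0 (w \o omap incl))); exists P.
by rewrite range_sval in Na'.
Qed.

Lemma dense_closure_nontrivial : dense_closure <> @trivial_matroid S.
Proof.
have s0 : small kappa' (@set0 S) by apply: finite_small => //; exact: finite_set0.
have [||||a [_ Na]] := realize_far compT MT domT kinf Hcl (i := n) dS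
    (saturated_realizes satS s0) (G := fun P => P = fun S w => True).
- by move=> _ ->; exact: definable_cst.
- by eexists.
- by move=> _ _ -> ->; eexists.
- move=> _ m Q f -> nQ f0.
  have [x [_ _ ax]] := far_claimP compT MT domT kinf Hcl (leqnn n) dS (definable_cst L _ True)
    (crit_true compT MT domT kinf Hcl (fun x : {x : reduct S | set0 x} => sval x) (dm_model dS)) nQ f0.
  by exists x.
move=> H; apply: Na; rewrite range_sval.
by rewrite -[clos _]/(dense_closure set0) H.
Qed.

Lemma dense_closure_existential : existential_matroid kappa' dense_closure.
Proof.
split.
- exact: (matroid_localize (lev S n) (matS S)).
- exact: dense_closure_definable.
- exact: dense_closure_Existence.
- exact: dense_closure_nontrivial.
Qed.

End DenseMatroid.

(** * Existence of a dense sequence *)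

Section Names.
Variable L : language.

(* A name is a term of a Skolem language: [Name k phi b] stands for an element x
   satisfying phi(x, b); the tag k allows several such elements. *)
Inductive name : Type :=
| Name : nat -> forall m, formula L m.+1 -> ('I_m -> name) -> name.

Definition name_tag (t : name) : nat := let: Name k _ _ _ := t in k.

Fixpoint name_depth (t : name) : nat :=
  match t with Name _ m _ b => (\max_(i < m) name_depth (b i)).+1 end.

Fixpoint code_nat (k : nat) : sentence L :=
  if k is k'.+1 then Imp Fls (code_nat k') else Fls.

Fixpoint code_closure k : formula L k -> sentence L :=
  match k with 0 => id | k'.+1 => fun phi => code_closure (All phi) end.

(** An injective coding of names by sentences bounds the number of names by the number of formulas
    without arithmetic of cardinals. The arity is coded before the formula because [code_closure] is
    injective only for a fixed arity. *)
Fixpoint code_name (t : name) : sentence L :=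
  match t with
  | Name k m phi b => Imp (code_nat k) (Imp (code_nat m) (Imp (code_closure phi)
      (foldr (fun i s => Imp (code_name (b i)) s) Fls (enum 'I_m))))
  end.

Definition imp_parts n (phi : formula L n) : option (formula L n * formula L n) :=
  match phi with Imp _ p q => Some (p, q) | _ => None end.

Definition all_part n (phi : formula L n) : option (formula L n.+1) :=
  match phi with All _ p => Some p | _ => None end.

Lemma Imp_inj n (p q p' q' : formula L n) : Imp p q = Imp p' q' -> p = p' /\ q = q'.
Proof. by move/(congr1 (@imp_parts n)) => [-> ->]. Qed.

Lemma code_nat_inj : injective code_nat.
Proof.
elim=> [|k IH] [|l] //=; try by move/(congr1 (@imp_parts 0)).
by move/Imp_inj => [_ /IH ->].
Qed.

Lemma code_closure_inj k : injective (@code_closure k).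
Proof.
elim: k => [//|k IH] p q /= /IH /(congr1 (@all_part k)) [].
by move=> ->.
Qed.

Lemma code_name_inj : injective code_name.
Proof.
elim=> k m phi b IH [k' m' phi' b'] /= /Imp_inj [/code_nat_inj <-] /Imp_inj [/code_nat_inj e].
move: phi' b'; rewrite -{}e => phi' b' /Imp_inj [/code_closure_inj /(congr1 (@all_part _)) [<-]] e.
suff -> : b = b' by [].
apply/funext => i; apply: IH.
have : i \in enum 'I_m by rewrite mem_enum.
elim: (enum 'I_m) e => //= j s IHs /Imp_inj [e /IHs H].
by rewrite inE => /orP [/eqP ->|/H].
Qed.

Lemma card_name_le : ([set: name] #<= [set: {n & formula L n}])%card.
Proof.
apply: (@injective_card_le _ _ _ _ (fun t => existT (formula L) 0 (code_name t))) => // x y _ _ e.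
apply: code_name_inj.
pose f (s : {n & formula L n}) : sentence L := let: existT k phi := s in
  match k return formula L k -> sentence L with 0 => id | _ => fun=> Fls end phi.
exact: (congr1 f e).
Qed.

Definition name_wo : ssrbool.rel name :=
  sval (wochoice.well_ordering_principle {classic name}).

Lemma name_wo_min (A : set name) : A !=set0 ->
  exists2 x, A x & forall y, A y -> name_wo x y.
Proof.
move=> [x Ax]; have wo := svalP (wochoice.well_ordering_principle {classic name}).
have [|z [[Az Hz] _]] := wo (fun x => `[< A x >]).
  by exists x; apply/asboolP.
by exists z; [apply/asboolP|move=> y Ay; apply: Hz; apply/asboolP].
Qed.

Lemma name_wo_anti x y : name_wo x y -> name_wo y x -> x = y.
Proof.
move=> xy yx; have wo := svalP (wochoice.well_ordering_principle {classic name}).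
have xx : name_wo x x by have [_ -> H] := @name_wo_min [set x] (ex_intro _ x erefl); apply: H.
have yy : name_wo y y by have [_ -> H] := @name_wo_min [set y] (ex_intro _ y erefl); apply: H.
have [|z [_ Uz]] := wo (fun z => `[< z = x \/ z = y >]).
  by exists x; apply/asboolP; left.
rewrite -(Uz x); last first.
  by split; [apply/asboolP; left|move=> w /asboolP [->|->]].
by apply: Uz; split; [apply/asboolP; right|move=> w /asboolP [->|->]].
Qed.

Lemma name_wo_total x y : name_wo x y \/ name_wo y x.
Proof.
have [|z [->|->] H] := @name_wo_min [set z | z = x \/ z = y].
- by exists x; left.
- by left; apply: H; right.
- by right; apply: H; left.
Qed.

Lemma name_wo_trans y x z : name_wo x y -> name_wo y z -> name_wo x z.
Proof.
move=> xy yz; have [|w [->|[->|->]] H] := @name_wo_min [set w | w = x \/ w = y \/ w = z].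
- by exists x; left.
- by apply: H; right; right.
- by rewrite (name_wo_anti xy _) //; apply: H; left.
- have zy : name_wo z y by apply: H; right; left.
  by rewrite -(name_wo_anti yz zy).
Qed.

(* A well-founded total order in which the arguments of a name precede it. *)
Definition name_lt (x y : name) : Prop :=
  name_depth x < name_depth y \/
  [/\ name_depth x = name_depth y, name_wo x y & x <> y].

Lemma name_lt_wf : well_founded name_lt.
Proof.
suff H d x : name_depth x = d -> Acc name_lt x by move=> x; apply: (H _ x erefl).
elim/ltn_ind: d x => d IH x xd; apply: contrapT => Nx.
have [|z [zd Nz] minz] := @name_wo_min [set z | name_depth z = d /\ ~ Acc name_lt z].
  by exists x.
apply: Nz; constructor => y [lt_yz|[e yz ne]].
  by apply: (IH (name_depth y)); rewrite // -zd.
apply: contrapT => Ny; apply: ne; apply: (name_wo_anti yz).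
by apply: minz; split; rewrite // e.
Qed.

Lemma name_lt_trans y x z : name_lt x y -> name_lt y z -> name_lt x z.
Proof.
move=> [xy|[exy xy nxy]] [yz|[eyz yz nyz]].
- by left; exact: ltn_trans yz.
- by left; rewrite -eyz.
- by left; rewrite exy.
right; split; [by rewrite exy|exact: name_wo_trans yz|].
by move=> xz; apply: nyz; apply: name_wo_anti yz _; rewrite -xz.
Qed.

Lemma name_lt_total x y : x <> y -> name_lt x y \/ name_lt y x.
Proof.
move=> ne; have [|//|e] := ltngtP (name_depth x) (name_depth y); [by left; left|by right; left|].
have [xy|yx] := name_wo_total x y; [left|right]; right; split=> //.
by move=> e'; apply: ne.
Qed.

Lemma name_list_max (l : seq name) : l <> [::] ->
  exists2 m, listed l m & forall s, listed l s -> s = m \/ name_lt s m.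
Proof.
elim: l => [//|s l IH] _; have [l0|l0] := pselect (l = [::]).
  by exists s; [left|rewrite l0 => r [->|//]; left].
have [m lm maxm] := IH l0.
have [sm|sm] := pselect (s = m).
  by exists m; [right|move=> r [<-|/maxm //]; left].
have [lt_sm|lt_ms] := name_lt_total sm.
  by exists m; [right|move=> r [<-|/maxm //]; right].
exists s; first by left.
move=> r [->|/maxm [->|rm]]; [by left|by right|].
by right; exact: name_lt_trans lt_ms.
Qed.

Lemma name_lt_arg k m (phi : formula L m.+1) b i : name_lt (b i) (Name k phi b).
Proof. by left; rewrite /= ltnS; exact: (leq_bigmax_cond (F := fun i => name_depth (b i))). Qed.

End Names.

Lemma sval_inj (X : Type) (A : set X) (x y : {x | A x}) : sval x = sval y -> x = y.
Proof. by case: x y => x Ax [y Ay] /= e; exact: eq_exist. Qed.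

Lemma listed_image (X Y : Type) (f : X -> Y) (Z : set X) l : listed l `<=` f @` Z ->
  exists2 s, listed s `<=` Z & listed l `<=` f @` listed s.
Proof.
elim: l => [|y l IH] lZ; first by exists [::] => // z [].
have [|s sZ ls] := IH; first by move=> z lz; apply: lZ; right.
have [x Zx xy] := lZ y (or_introl erefl).
exists (x :: s); first by move=> z [<-|/sZ].
by move=> z [<-|/ls [w sw <-]]; [exists x => //; left|exists w => //; right].
Qed.

Lemma tarski_vaught (L : language) (S : structure L) (A : set S)
    (HA : universe_of_substructure A) :
  (forall m (phi : formula L m.+1) (b : 'I_m -> S), (forall i, A (b i)) ->
     (exists a, sat phi (scons a b)) -> exists2 a, A a & sat phi (scons a b)) ->
  elementary_embedding (fun x : induced HA => sval x).
Proof.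
move=> TV n phi v.
have evalE k (t : term L k) (w : 'I_k -> induced HA) :
    sval (eval w t) = eval (fun i => sval (w i)) t.
  by elim: t => [//|m f ts IH] /=; congr fint; apply/funext => i; rewrite IH.
elim: phi v => {n} [n|n t u|n k r ts|n p IHp q IHq|n p IH] v //=.
- rewrite -!evalE; split=> [->//|]; exact: sval_inj.
- by split; congr (rint r _); apply/funext => i; rewrite evalE.
- by rewrite IHp IHq.
have E a : (fun x : induced HA => sval x) \o scons a v = scons (sval a) (fun i => sval (v i)).
  by rewrite comp_scons.
split=> [H a|H a]; last by apply/IH; rewrite E; exact: H.
apply: contrapT => N.
have [|a' Aa'] := TV _ (Neg p) (fun i => sval (v i)) (fun i => svalP (v i)).
  by exists a.
by apply; have /IH := H (exist _ a' Aa'); rewrite E.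
Qed.

Lemma dim_one_inv (X : Type) (cl : set X -> set X) (A : set X) (V : set ('I_1 -> X)) :
  matroid cl -> dim cl A V = Some 1 -> exists2 c, V c & ~ cl A (c ord0).
Proof.
move=> mat; rewrite /dim; case: asboolP => // _ [H]; apply: contrapT => N.
suff : \max_(k < 2 | `[< exists2 b, V b & rk cl A b = k >]) k <= 0 by rewrite H.
apply/bigmax_leqP => k /asboolP [c Vc <-].
apply/bigmax_leqP => B /asboolP indB; rewrite leqn0 cards_eq0.
apply/eqP/setP => i; rewrite inE; apply/negP => iB; apply: N; exists c => //.
move=> Hc; apply: (indB i iB); rewrite (ord1 i).
by apply: (cl_mono mat _ Hc); left.
Qed.

(** * Values of names, and the dense sequence inside the monster model *)

Section DenseChain.
Variables (L : language) (R : ring_symbols L) (T : theory L) (kappa : Type) (M : structure L).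
Variable cl : set M -> set M.
Hypothesis compT : complete T.
Hypothesis domT : expands_integral_domains R T.
Hypothesis monM : monster kappa T M.
Hypothesis Hcl : existential_matroid kappa cl.

Let MT : model T M. Proof. by case: monM. Qed.
Let kinf : infinite_set [set: kappa]. Proof. exact: monster_infinite monM. Qed.
Local Notation mat := (existential_mat Hcl).
Local Notation lt := (@name_lt L).

(* A name is sent to an element satisfying its formula over the values of its
   arguments, outside the closure of the values of the smaller names if
   possible. *)
Definition value_step (x0 : M) (t : name L) : (forall s, lt s t -> M) -> M :=
  match t return (forall s, lt s t -> M) -> M with
  | Name k m phi b => fun rec =>
    let vb i := rec (b i) (name_lt_arg k phi b i) in
    let V := [set a | exists s h, rec s h = a] in
    let G := [set a | sat phi (scons a vb) /\ ~ cl V a] in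
    if pselect (exists a, G a) then select x0 G
    else select x0 [set a | sat phi (scons a vb)]
  end.

Definition value (x0 : M) : name L -> M :=
  Fix (@name_lt_wf L) (fun=> M) (value_step x0).

Lemma valueE x0 t : value x0 t = value_step x0 (fun s (_ : lt s t) => value x0 s).
Proof.
apply: (Fix_eq (@name_lt_wf L) (fun=> M) (value_step x0)) => {}t f g fg.
suff -> : f = g by [].
by apply/functional_extensionality_dep => s; apply/funext => h.
Qed.

Variable x0 : M.
Local Notation val := (value x0).

Definition below (t : name L) : set M := val @` [set s | lt s t].

Lemma value_sat k m (phi : formula L m.+1) b :
  (exists a, sat phi (scons a (val \o b))) ->
  sat phi (scons (val (Name k phi b)) (val \o b)).
Proof.
move=> H; rewrite valueE /=; case: pselect => [G|N].
  by have [] := selectP x0 G.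
exact: (@selectP _ x0 [set a | sat phi (scons a (val \o b))]).
Qed.

Definition free (t : name L) : Prop := ~ cl (below t) (val t).

Lemma value_free k m (phi : formula L m.+1) b a :
  sat phi (scons a (val \o b)) -> ~ cl (below (Name k phi b)) a ->
  free (Name k phi b).
Proof.
move=> Ha Na; rewrite /free valueE /=.
have E : below (Name k phi b) =
    [set a | exists s (h : lt s (Name k phi b)), val s = a].
  by apply/seteqP; split=> [_ [s h <-]|_ [s [h <-]]]; exists s => //; exists h.
case: pselect => [G|N]; last by case: N; exists a; split; rewrite -?E.
by have [_] := selectP x0 G; rewrite E.
Qed.

Lemma small_values (A : set (name L)) : small kappa (val @` A).
Proof.
have [sk _ _ _] := monM; apply: card_le_small sk.
apply: card_le_trans (card_name_le L).
apply: card_le_trans (surjective_card_le A val) _.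
exact: card_leT.
Qed.

(** Freeness only compares a value with earlier ones. In a dependence, the latest name can be
    exchanged into a dependence on earlier names, against its own freeness. *)
Lemma free_independent (X : set (name L)) t :
  (forall s, X s -> free s) -> free t -> ~ X t -> ~ cl (val @` X) (val t).
Proof.
move=> freeX freet NX.
pose A := val @` [set s | X s /\ lt s t].
pose Y m := [set s | [/\ X s, lt t s & lt s m]].
have NA : ~ cl A (val t).
  move=> H; apply: freet; apply: (cl_mono mat _ H).
  by move=> _ [s [_ st] <-]; exists s.
have step (Z : set (name L)) : (forall s, Z s -> X s /\ lt t s) ->
    cl (A `|` val @` Z) (val t) -> exists2 m, Z m & cl (A `|` val @` Y m) (val t).
  move=> ZX /(cl_split mat) [l lZ]; have [s sZ ls] := listed_image lZ => Hl.
  have {l lZ ls Hl} Hs : cl (A `|` val @` listed s) (val t).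
    by apply: (cl_mono mat _ Hl) => z [|/ls]; [left|right].
  have [|m sm maxm] := @name_list_max L s.
    by move=> s0; apply: NA; apply: (cl_mono mat _ Hs) => z [//|[w]]; rewrite s0.
  have [Xm tm] := ZX m (sZ m sm).
  exists m; first exact: sZ.
  apply: contrapT => Nm; apply: (freeX m Xm).
  have H : cl (A `|` val @` Y m `|` [set val m]) (val t).
    apply: (cl_mono mat _ Hs) => z [Az|[w sw <-]]; first by left; left.
    have [->|wm] := maxm w sw; first by right.
    by left; right; exists w => //; have [Xw tw] := ZX w (sZ w sw).
  apply: (cl_mono mat _ (cl_exchange mat H Nm)).
  move=> z [[[s' [_ st] <-]|[s' [_ _ sm'] <-]]|->].
  - by exists s' => //; exact: name_lt_trans st tm.
  - by exists s'.
  - by exists t.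
have PY m : ~ cl (A `|` val @` Y m) (val t).
  elim/(well_founded_ind (@name_lt_wf L)): m => m IH H.
  by have [|m' [_ _ mm'] Hm'] := step (Y m) _ H; [move=> s []|exact: (IH m')].
move=> H; have [||m _] := step [set s | X s /\ lt t s]; [by []| |exact: PY].
apply: (cl_mono mat _ H) => z [s Xs <-].
have [|st|ts] := @name_lt_total L s t; first by move=> st; apply: NX; rewrite -st.
  by left; exists s.
by right; exists s.
Qed.

Lemma small_proper (A : set M) : small kappa A -> exists a, ~ cl A a.
Proof.
move=> sA; have [a Na] := generic_exists Hcl.
have [_ _ + _] := Hcl => /(_ a set0 A) [||//|a' _]; last by rewrite set0U; exists a'.
  by apply: finite_small kinf _; exact: finite_set0.
exact: sA.
Qed.

Variable n : nat.
Local Notation LL := (expansion L n).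

(** A generic element with no condition imposed. The tag [i.+1] keeps these names apart from each
    other and from tag 0, which is reserved for the witnesses of formulas. *)
Definition top_name (i : nat) : name L := Name i.+1 (Imp Fls Fls) (@from_I0 (name L)).

Lemma free_top i : free (top_name i).
Proof.
have [a Na] := small_proper (small_values [set s | lt s (top_name i)]).
exact: (value_free (a := a)).
Qed.

Definition base (i : nat) : set (name L) :=
  [set t | free t /\ name_tag t = 0 \/ exists2 j, j < i & t = top_name j].

Lemma top_independent i : ~ cl (val @` base i) (val (top_name i)).
Proof.
apply: free_independent; [|exact: free_top|].
  by move=> s [[]//|[j _ ->]]; exact: free_top.
case=> [[_ //]|[j ji /(congr1 (@name_tag L)) [e]]].
by rewrite e ltnn in ji.
Qed.

Definition hull : set M := range val.

(** The witness is the name with tag 0 built from names of the parameters. If some solution is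
    generic over [b], Existence moves it out of the closure of all earlier values, which form a
    small set, so the chosen value is free; with tag 0 it then lies in the first member of the
    chain. *)
Lemma hull_witness m (phi : formula L m.+1) (b : 'I_m -> M) : (forall i, hull (b i)) ->
  exists2 t, name_tag t = 0 &
    ((exists a, sat phi (scons a b)) -> sat phi (scons (val t) b)) /\
    ((exists2 a, sat phi (scons a b) & ~ cl (range b) a) -> free t).
Proof.
move=> Hb; have Hb' i : exists t, val t = b i by have [t _ e] := Hb i; exists t.
pose b' i := projT1 (cid (Hb' i)).
have bE : val \o b' = b by apply/funext => i /=; rewrite /b'; case: (cid _).
exists (Name 0 phi b') => //; split; first by rewrite -bE; exact: value_sat.
move=> [a Ha Na]; have [_ _ + _] := Hcl.
move=> /(_ a (range b) _ _ (small_values [set s | lt s (Name 0 phi b')]) Na) [|a' st Na'].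
  by apply: finite_small kinf _; exact: finite_range.
have Ha' : sat phi (scons a' (val \o b')).
  rewrite bE; have [H _] : psat a (PFormula phi b) <-> psat a' (PFormula phi b) by exact: st.
  exact: H.
by apply: (value_free Ha') => H; apply: Na'; apply: (cl_mono mat _ H); right.
Qed.

Lemma hull_universe : universe_of_substructure hull.
Proof.
split; first by constructor; exists (val (top_name 0)); exists (top_name 0).
move=> k f v Hv.
pose phi : formula L k.+1 := Eq (Var L ord0) (App f (fun i => Var L (lift ord0 i))).
have [t _ [H _]] := hull_witness phi Hv.
have vE a : (fun i => eval (scons a v) (Var L (lift ord0 i))) = v.
  by apply/funext => i /=; rewrite sconsS.
exists t => //; have := H; rewrite /= vE => {}H.
have := H; rewrite !scons0 => ->; rewrite ?scons0 //.
by exists (fint f v); rewrite scons0 vE.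
Qed.

(* The values of the names of tag 0 which are free form a dense set; over it,
   the values of the n formulas True are independent, and generate the chain. *)
Definition chain_member (i : nat) : set M := [set x | i < n -> cl (val @` base i) x].

Definition hull_rint k (r : Defs.Rel LL k) : ('I_k -> {x | hull x}) -> Prop :=
  match r in exp_rel _ _ k return ('I_k -> {x | hull x}) -> Prop with
  | OldRel _ r => fun v => rint r (fun i => sval (v i))
  | NewPred i => fun v => chain_member i (sval (v ord0))
  end.

Definition hull_structure : structure LL :=
  @Structure LL {x | hull x} (us_nonempty hull_universe)
    (@fint L (induced hull_universe)) hull_rint.
Local Notation S := hull_structure.

Lemma hull_elementary : @elementary_embedding L (reduct S) M (fun x => sval x).
Proof.
apply: (tarski_vaught (HA := hull_universe)) => m phi b Hb ex.
have [t _ [H _]] := hull_witness phi Hb.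
by exists (val t); [exists t|exact: H].
Qed.

Lemma hull_model : model T (reduct S).
Proof.
move=> s Ts v; apply/(hull_elementary s v); exact: MT.
Qed.

Lemma hull_chain i (x : S) : chain S i x <-> chain_member i (sval x).
Proof.
have [Hi|Hi] := ltnP i n; first by rewrite (@chain_insub _ _ _ _ Hi).
by rewrite chain_last //; split=> // _; rewrite /chain_member /= ltnNge Hi.
Qed.

Lemma base_mono i j : i <= j -> base i `<=` base j.
Proof.
move=> ij t [H|[k ki ->]]; [by left|right; exists k => //].
exact: leq_trans ij.
Qed.

Lemma chain_member_mono i : chain_member i `<=` chain_member i.+1.
Proof.
move=> x Hx Hi; apply: (cl_mono mat _ (Hx (ltnW Hi))).
by move=> _ [t bt <-]; exists t => //; exact: (base_mono (leqnSn i)).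
Qed.

Lemma chain_member_cl i (X : set M) : X `<=` chain_member i -> cl X `<=` chain_member i.
Proof.
move=> XK x Hx Hi; apply: (cl_sub mat _ Hx) => y /XK; exact.
Qed.

Lemma hull_dense m (phi : formula L m.+1) (b : 'I_m -> S) :
  (exists2 a, sat phi (scons a (fun i => sval (b i))) & ~ cl (range (fun i => sval (b i))) a) ->
  exists a : S, chain S 0 a /\ @sat L (reduct S) _ phi (scons a b).
Proof.
move=> ex; have [t t0 [H1 H2]] := hull_witness phi (fun i => svalP (b i)).
pose a : S := exist _ (val t) (ex_intro2 _ _ t I erefl).
exists a; split.
  apply/hull_chain => n0; apply: (cl_in mat); exists t => //; left; split=> //.
  exact: H2.
apply/(hull_elementary phi (scons a b)); rewrite comp_scons /=; apply: H1.
by have [x Hx _] := ex; exists x.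
Qed.

(** This is the Tarski-Vaught condition for a member of the chain. A solution in the closure of the
    parameters is already in the member, which is closed; any other is generic and density provides
    one in the first member. *)
Lemma hull_chain_witness i m (phi : formula L m.+1) (b : 'I_m -> S) :
  (forall k, chain S i (b k)) -> (exists a, @sat L (reduct S) _ phi (scons a b)) ->
  exists2 a : S, chain S i a & @sat L (reduct S) _ phi (scons a b).
Proof.
move=> bi [a Ha].
have [ca|Na] := pselect (cl (range (fun k => sval (b k))) (sval a)).
  exists a => //; apply/hull_chain; apply: (chain_member_cl _ ca) => _ [k _ <-].
  exact/hull_chain.
have [|a' [a'0 Ha']] := hull_dense (phi := phi) (b := b).
  exists (sval a) => //.
  by move/(hull_elementary phi (scons a b)): Ha; rewrite comp_scons.
exists a' => //; apply/hull_chain; move/hull_chain: a'0.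
elim: i {bi} => // i IH /IH; exact: chain_member_mono.
Qed.

Lemma hull_chain_universe i : @universe_of_substructure L (reduct S) (chain S i).
Proof.
split.
  have [a _] := small_proper (finite_small kinf (finite_set0 M)).
  have [||a' a'i _] := @hull_chain_witness i 0 (Imp Fls Fls) (@from_I0 S).
  - by move=> k; exact: (from_I0 _ k).
  - by exists (exist _ (val (top_name 0)) (ex_intro2 _ _ (top_name 0) Logic.I erefl)) => /= -[].
  by constructor; exists a'.
move=> k f v Hv; apply/hull_chain.
apply: (@chain_member_cl i (range (fun j => sval (v j)))).
  by move=> _ [j _ <-]; exact/hull_chain.
have := @uterm_cl L kappa M cl kinf Hcl 'I_k (fun j => sval (v j))
  (fun S w => fint f (fun j => w j)).
apply; apply: uterm_app => j; exact: uterm_var.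
Qed.

Lemma hull_dense_chain : dense_chain T cl S.
Proof.
split; first exact: hull_model.
exists kappa, M, (fun x => sval x).
have defcl : definable_matroid cl by case: Hcl.
split; [exact: monM|exact: hull_elementary| |].
  move=> i Hi; split.
  - have AB : chain S i `<=` chain S i.+1.
      by move=> x /hull_chain Hx; apply/hull_chain; exact: chain_member_mono.
    exists (hull_chain_universe i), (hull_chain_universe i.+1), AB => m phi v.
    have elem k := @tarski_vaught L (reduct S) (chain S k) (hull_chain_universe k)
      (@hull_chain_witness k) m phi.
    by rewrite (elem i) (elem i.+1).
  - move=> e; pose x : S := exist _ (val (top_name i)) (ex_intro2 _ _ (top_name i) Logic.I erefl).
    have : chain S i.+1 x.
      apply/hull_chain => Hi1; apply: (cl_in mat); exists (top_name i) => //.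
      by right; exists i.
    by rewrite -e => /hull_chain /(_ Hi) /=; exact: top_independent.
  - apply/seteqP; split=> [z [Hz [x Hx xz]]|z [x Hx <-]].
      move: Hz; rewrite -defcl => Hx'; exists x => //; apply/hull_chain; rewrite xz.
      have sub : [set sval y | y in chain S i] `<=` chain_member i by move=> _ [y /hull_chain Hy <-].
      exact: (chain_member_cl sub Hx').
    split; first by rewrite -defcl; apply: (cl_in mat); exists x.
    exists x => //; apply/hull_chain/chain_member_mono; exact/hull_chain.
move=> m phi b /=.
have -> : transfer cl M = cl by apply/funext => X; rewrite -defcl.
move=> /(dim_one_inv mat) [c Hc Nc].
by have [|a [a0 Ha]] := hull_dense (phi := phi) (b := b); [exists (c ord0)|exists a].
Qed.

End DenseChain.

Definition expansion_ring (L : language) (R : ring_symbols L) n :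
    ring_symbols (expansion L n) :=
  @RingSymbols (expansion L n) (zero_sym R) (one_sym R) (opp_sym R) (add_sym R) (mul_sym R).

Lemma complete_theory_of (L : language) (C : structure L -> Prop) (S : structure L) :
  C S -> (forall S', model (theory_of C) S' -> forall s, holds S s -> holds S' s) ->
  complete (theory_of C).
Proof.
move=> CS H; split; first by exists S => s; apply.
move=> s; have [Hs|Ns] := pselect (holds S s); [left|right] => S' mS'; apply: H => //.
move=> v Hv; apply: Ns => w.
suff -> : w = v by [].
by apply/funext => i; exact: (from_I0 _ i).
Qed.

Unset Implicit Arguments.

Theorem theorem13p5 (L : language) (R : ring_symbols L) (T : theory L)
    (kappa : Type) (M : structure L) (cl : set M -> set M) (n : nat) :
  complete T -> only_infinite_models T -> expands_integral_domains R T ->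
  monster kappa T M -> existential_matroid kappa cl ->
  complete (nd_theory T cl n) /\
  forall (kappa' : Type) (M' : structure (nd_language L n)),
    monster kappa' (nd_theory T cl n) M' ->
    exists! cl' : set M' -> set M', existential_matroid kappa' cl'.
Proof.
move=> compT _ domT monM Hcl.
have kinf := monster_infinite monM; have [_ MT _ _] := monM.
case: n => [|k] /=.
  split=> // kappa' M' monM'; exists (transfer cl M').
  have H := transfer_existential compT MT domT kinf Hcl monM'.
  split=> // cl' H'; have [_ MT' _ _] := monM'.
  exact: (existential_matroid_unique (domT _ MT') (monster_infinite monM') H H').
have [x0] := Defs.nonempty M.
have dc := hull_dense_chain monM Hcl x0 k.+1.
(* A model of the theory only shares the sentences true in all dense sequences; this is where the
   first-order form of the conditions is used. *)
have dense_of S : model (theory_of (@dense_chain L T M cl k.+1)) S -> dense_model R T cl S.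
  apply: dense_model_theory_of => S0 H.
  exact: (@dense_chain_model L R T kappa M cl compT MT domT kinf Hcl k.+1 S0 H).
split.
  apply: (complete_theory_of dc) => S' /dense_of dS' s.
  apply: (dense_models_equivalent compT MT domT kinf Hcl) => //.
  exact: (dense_chain_model compT MT domT kinf Hcl dc).
move=> kappa' M' monM'; have kinf' := monster_infinite monM'.
have [_ MT' satM' _] := monM'; have dM' := dense_of _ MT'.
have H := dense_closure_existential compT MT domT kinf Hcl kinf' satM' dM'.
exists (dense_closure cl (S := M')); split=> // cl' H'.
(* The expansion keeps the ring symbols, so the criterion for dimension 1 is available in the
   expanded language and determines the matroid on [M'] as well. *)
apply: (existential_matroid_unique (R := expansion_ring R k.+1) _ kinf' H H').
exact: (domT _ (dm_model dM')).
Qed.
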